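(* Let $\Omega\subseteq\mathbb{R}^n$ be open and let $C_1,\dots,C_{n-1},\nu\in\mathcal{C}^{\infty}(\Omega,\mathbb{R})$. Consider the smooth vector field $X$ on $\Omega$ with components $X_i=\nu\cdot\dfrac{\partial(C_1,\dots,C_{n-2},x_i,C_{n-1})}{\partial(x_1,\dots,x_n)}$, $i=1,\dots,n$ (i.e. $X=(-\nu)\star(\nabla C_1\wedge\dots\wedge\nabla C_{n-1})$, the Hamiltonian vector field of $H=C_{n-1}$ with respect to the Poisson bracket $\{f,g\}\,\mathrm{d}x_1\wedge\dots\wedge\mathrm{d}x_n=\nu\,\mathrm{d}C_1\wedge\dots\wedge\mathrm{d}C_{n-2}\wedge\mathrm{d}f\wedge\mathrm{d}g$). Call $\overline{x}\in\Omega$ a regular equilibrium state if $\nu(\overline{x})\neq0$, $\nabla C_1(\overline{x})\wedge\dots\wedge\nabla C_{n-2}(\overline{x})\neq0$ and $\nabla C_1(\overline{x})\wedge\dots\wedge\nabla C_{n-1}(\overline{x})=0$; for such a point there is a unique $\overrightarrow{\lambda}=(\lambda_1,\dots,\lambda_{n-2})\in\mathbb{R}^{n-2}$ with $\nabla F_{\overrightarrow{\lambda}}(\overline{x})=0$, where $F_{\overrightarrow{\lambda}}:=C_{n-1}+\lambda_1C_1+\dots+\lambda_{n-2}C_{n-2}$, and the point is called non-degenerate if moreover $\det(\operatorname{Hess}F_{\overrightarrow{\lambda}}(\overline{x}))\neq0$. For a non-degenerate regular equilibrium $\overline{x}$ set $$\mathcal{I}_{X}(\overline{x}):=\nu^2(\overline{x})\det(\operatorname{Hess}F_{\overrightarrow{\lambda}}(\overline{x}))\,\Big\langle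 [\operatorname{Hess}F_{\overrightarrow{\lambda}}(\overline{x})]^{-1}\nabla C_1(\overline{x})\wedge\dots\wedge[\operatorname{Hess}F_{\overrightarrow{\lambda}}(\overline{x})]^{-1}\nabla C_{n-2}(\overline{x}),\ \nabla C_1(\overline{x})\wedge\dots\wedge\nabla C_{n-2}(\overline{x})\Big\rangle_{n-2},$$ where $\langle u_1\wedge\dots\wedge u_{n-2},v_1\wedge\dots\wedge v_{n-2}\rangle_{n-2}=\det([\langle u_i,v_j\rangle])$. Let $\overline{x}_e$ be a non-degenerate regular equilibrium point of $X$, and let $\overrightarrow{\lambda_{e}}=(\lambda^{e}_1,\dots,\lambda^{e}_{n-2})\in\mathbb{R}^{n-2}$ be such that $\overline{x}_e$ is a non-degenerate critical point of $F_{\overrightarrow{\lambda_{e}}}=C_{n-1}+\lambda^{e}_1 C_1 +\dots + \lambda^{e}_{n-2} C_{n-2}$. Then the following implications hold true: \begin{enumerate} \item if $\mathcal{I}_{X}(\overline{x}_e)<0$, then there exist $V\subseteq \mathbb{R}^{n-2}$, an open neighborhood of $\overrightarrow{\lambda_{e}}$, $U\subseteq \Omega$, an open neighborhood of $\overline{x}_e$, a smooth function $\overline{x}: V\rightarrow U$ such that $\overline{x}(\overrightarrow{\lambda_{e}})=\overline{x}_e$, and for every $\overrightarrow{\lambda}\in V$, $\overline{x}(\overrightarrow{\lambda})\in U$ is an unstable non-degenerate regular equilibrium state of $X$. \item if $\mathcal{I}_{X}(\overline{x}_e)>0$, then there exist $V\subseteq \mathbb{R}^{n-2}$, an open neighborhood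 of $\overrightarrow{\lambda_{e}}$, $U\subseteq \Omega$, an open neighborhood of $\overline{x}_e$, a smooth function $\overline{x}: V\rightarrow U$ such that $\overline{x}(\overrightarrow{\lambda_{e}})=\overline{x}_e$, and for every $\overrightarrow{\lambda}\in V$, $\overline{x}(\overrightarrow{\lambda})\in U$ is a Lyapunov stable non-degenerate regular equilibrium state of $X$. \end{enumerate} *)

(* Defs.v *)
From HB Require Import structures.
From mathcomp Require Import all_boot all_order all_algebra.
From mathcomp Require Import all_classical all_reals.
From mathcomp Require Import topology normedtype derive.
Set Implicit Arguments. Unset Strict Implicit. Unset Printing Implicit Defensive.
Import Order.TTheory GRing.Theory Num.Theory.
Import numFieldNormedType.Exports.
Local Open Scope classical_set_scope.
Local Open Scope ring_scope.

Section Defs.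
Variable R : realType.

Definition ebasis (k : nat) (i : 'I_k) : 'rV[R]_k := delta_mx 0 i.

Definition partial (k : nat) (i : 'I_k) (f : 'rV[R]_k -> R) (x : 'rV[R]_k) : R :=
  derive f x (ebasis i).

Fixpoint iter_partial (k : nat) (s : seq 'I_k) (f : 'rV[R]_k -> R) : 'rV[R]_k -> R :=
  match s with
  | [::] => f
  | i :: s' => fun x => partial i (iter_partial s' f) x
  end.

Definition smooth_on (k : nat) (D : set 'rV[R]_k) (f : 'rV[R]_k -> R) : Prop :=
  forall s : seq 'I_k, forall x, D x ->
    (forall i : 'I_k, derivable (iter_partial s f) x (ebasis i)) /\
    {for x, continuous (iter_partial s f)}.

Definition smooth_on_vec (k l : nat) (D : set 'rV[R]_k) (f : 'rV[R]_k -> 'rV[R]_l) :=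
  forall j : 'I_l, smooth_on D (fun x => f x 0 j).

Definition grad (k : nat) (f : 'rV[R]_k -> R) (x : 'rV[R]_k) : 'rV[R]_k :=
  \row_j partial j f x.

Definition hess (k : nat) (f : 'rV[R]_k -> R) (x : 'rV[R]_k) : 'M[R]_k :=
  \matrix_(i, j) partial i (partial j f) x.

(* The decomposable k-vector u_1 /\ ... /\ u_p (rows of A), represented
   (via the pairing <.,.>_p) as the alternating form
   (w_1,...,w_p) |-> det [<u_i, w_j>]. *)
Definition wedge (p k : nat) (A : 'M[R]_(p, k)) : 'M[R]_(p, k) -> R :=
  fun W => \det (A *m W^T).

Definition wedge_dot (p k : nat) (A B : 'M[R]_(p, k)) : R := \det (A *m B^T).

Variable m : nat.
Notation n := (m + 2)%N.
Notation V := 'rV[R]_n.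

Variables (C : 'I_m -> V -> R) (H : V -> R) (nu : V -> R).

Definition gradC (x : V) : 'M[R]_(m, n) := \matrix_(k, j) grad (C k) x 0 j.

(* Jacobian matrix of (C_1, ..., C_{n-2}, x_i, C_{n-1}) *)
Definition jacX (i : 'I_n) (x : V) : 'M[R]_n :=
  col_mx (gradC x) (col_mx (ebasis i) (grad H x)).

Definition vfX (x : V) : V := \row_i (nu x * \det (jacX i x)).

Definition Flam (lam : 'rV[R]_m) (x : V) : R :=
  H x + \sum_(k < m) lam 0 k * C k x.

Definition regular_equilibrium (Om : set V) (x : V) : Prop :=
  [/\ Om x, nu x != 0,
      wedge (gradC x) <> (fun _ => 0) &
      wedge (col_mx (gradC x) (grad H x)) = (fun _ => 0)].

Definition nondeg_regular_equilibrium (Om : set V) (x : V) : Prop :=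
  regular_equilibrium Om x /\
  exists lam : 'rV[R]_m, grad (Flam lam) x = 0 /\ \det (hess (Flam lam) x) != 0.

(* I_X(x), computed with the multiplier lam for which grad F_lam (x) = 0 *)
Definition IX (lam : 'rV[R]_m) (x : V) : R :=
  let Hs := hess (Flam lam) x in
  nu x ^+ 2 * \det Hs *
  wedge_dot ((invmx Hs *m (gradC x)^T)^T) (gradC x).

Definition solution_on (Om : set V) (phi : R -> V) (a b : R) : Prop :=
  forall t, a < t < b -> Om (phi t) /\ is_derive t 1 phi (vfX (phi t)).

Definition solution_on_pinfty (Om : set V) (phi : R -> V) (a : R) : Prop :=
  forall t, a < t -> Om (phi t) /\ is_derive t 1 phi (vfX (phi t)).

Definition lyapunov_stable (Om : set V) (xe : V) : Prop :=
  forall eps : R, 0 < eps -> exists2 delta : R, 0 < delta &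
    forall y : V, `|y - xe| < delta ->
      (exists phi a, a < 0 /\ phi 0 = y /\ solution_on_pinfty Om phi a) /\
      (forall phi a b, a < 0 -> 0 < b -> phi 0 = y -> solution_on Om phi a b ->
         forall t, 0 <= t < b -> `|phi t - xe| < eps).

Definition unstable (Om : set V) (xe : V) : Prop := ~ lyapunov_stable Om xe.

End Defs.

(* Main.v *)
(* At a critical point [x] of [F = F_lam], the kernel [T] of the gradients of
   the Casimirs [C_k] is a plane, and [I_X(x)] has the sign of the determinant of
   [Hess F] restricted to [T] (a Schur complement computation).  The point itself
   depends smoothly on [lam] by the implicit function theorem for
   [grad F_lam (x) = 0], and the sign of [I_X] is an open condition.

   If the sign is positive, [Hess F] is definite on [T], so that
   [+- (F - F(x)) + K |C - C(x)| ^ 2] is, for K large, a conserved quantity with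
   a nondegenerate minimum at [x].

   If the sign is negative, [Hess F] has two independent null vectors [a], [b] in
   [T].  The functionals [<(Hess F) a, .>] and [<(Hess F) b, .>] are left eigenvectors of
   the linearization, with eigenvalues [mu] and [- mu], and together with the
   conserved functions [C_k - C_k(x)] they give local coordinates [p, q, c].
   Since [c] is constant along solutions, [p ^ 2 - q ^ 2 - |c| ^ 2] grows
   exponentially once it is positive. *)

Require Import Defs.
From HB Require Import structures.
From mathcomp Require Import all_boot all_order all_algebra.
From mathcomp Require Import all_classical all_reals.
From mathcomp Require Import topology normedtype derive.
From mathcomp Require Import interval_inference sequences realfun exp.
From mathcomp Require Import measure lebesgue_measure.
From mathcomp Require Import lebesgue_integral ftc ring lra.
Import Order.TTheory GRing.Theory Num.Theory.
Import numFieldNormedType.Exports.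
Local Open Scope classical_set_scope.
Local Open Scope ring_scope.
Set Implicit Arguments.
Unset Strict Implicit.
Unset Printing Implicit Defensive.

(** * Strict differentiability *)

Section Calculus.
Variable R : realType.

(** [smooth_on] speaks of iterated partial derivatives only, so regularity is first converted into
    strict differentiability, an estimate on [f y - f z] with both points free near [x]; it yields
    the Lipschitz bounds, the chain rule and the contraction that produces the branch.
    [lyapunov_stable] contains the existence of solutions for all positive times, so a Picard
    theorem is part of the stable case. In the unstable case existence comes for free: stability,
    assumed for contradiction, supplies a solution confined to a small ball for all positive times.
    Level sets of the Casimirs are never parametrized. They are only approximately parallel to [T],
    neighbouring ones need not contain [x], and the gradients of the Casimirs are left eigenvectors
    of the linearization for the eigenvalue 0, so the motion in these directions has to be
    controlled. Keeping [C - C(x)] as an explicit quantity does this in both cases. For instability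
    the starting point is [x + s b]: there [q] vanishes, [p] is of exact order [s] and [c] is only
    [o(s)], because [b] lies in [T]. *)

Definition dot k (u v : 'rV[R]_k) : R := (u *m v^T) 0 0.

Lemma dotE k (u v : 'rV[R]_k) : dot u v = \sum_j u 0 j * v 0 j.
Proof. by rewrite /dot mxE; apply: eq_bigr => j _; rewrite mxE. Qed.

Lemma dotC k (u v : 'rV[R]_k) : dot u v = dot v u.
Proof. by rewrite !dotE; apply: eq_bigr => j _; rewrite mulrC. Qed.

Lemma dotDl k (u v w : 'rV[R]_k) : dot (u + v) w = dot u w + dot v w.
Proof. by rewrite /dot mulmxDl mxE. Qed.

Lemma dotBl k (u v w : 'rV[R]_k) : dot (u - v) w = dot u w - dot v w.
Proof. by rewrite /dot mulmxBl !mxE. Qed.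

Lemma dotZl k a (u w : 'rV[R]_k) : dot (a *: u) w = a * dot u w.
Proof. by rewrite /dot -scalemxAl mxE. Qed.

Lemma dotDr k (u v w : 'rV[R]_k) : dot w (u + v) = dot w u + dot w v.
Proof. by rewrite dotC dotDl !(dotC w). Qed.

Lemma dot0l k (w : 'rV[R]_k) : dot 0 w = 0.
Proof. by rewrite /dot mul0mx mxE. Qed.

Lemma dot0r k (w : 'rV[R]_k) : dot w 0 = 0.
Proof. by rewrite dotC dot0l. Qed.

Lemma coord_le_norm k (x : 'rV[R]_k) j : `|x 0 j| <= `|x|.
Proof.
rewrite [leRHS]/Num.norm /= mx_normrE.
exact: (le_bigmax _ (fun ij => `|x ij.1 ij.2|) (0, j)).
Qed.

Lemma norm_le_coord k (x : 'rV[R]_k) c :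
  0 <= c -> (forall j, `|x 0 j| <= c) -> `|x| <= c.
Proof.
move=> c0 xc; rewrite [leLHS]/Num.norm /= mx_normrE.
by apply: bigmax_le => // -[i j] _ /=; rewrite ord1.
Qed.

Lemma norm_ebasis k (i : 'I_k) : `|ebasis R i| <= 1.
Proof.
apply: norm_le_coord => // j; rewrite mxE.
by case: eqP => //= _; rewrite ?normr1 ?normr0//; case: eqP => _; rewrite ?normr1 ?normr0.
Qed.

Lemma mulmx_bound k l (A : 'M[R]_(k, l)) :
  exists2 K : R, 0 < K & forall u : 'rV[R]_k, `|u *m A| <= K * `|u|.
Proof.
pose K := \sum_i \sum_j `|A i j|.
have K0 : 0 <= K by apply: sumr_ge0 => i _; apply: sumr_ge0.
exists (K + 1); first by rewrite ltr_wpDl.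
move=> u; apply: norm_le_coord; first by rewrite mulr_ge0// addr_ge0.
move=> j; rewrite mxE (le_trans (ler_norm_sum _ _ _))//.
apply: (@le_trans _ _ (\sum_i `|u| * \sum_j `|A i j|)).
  apply: ler_sum => i _; rewrite normrM ler_pM ?coord_le_norm//.
  by rewrite (bigD1 j)//= lerDl; apply: sumr_ge0.
by rewrite -mulr_sumr mulrC ler_wpM2r// /K lerDl.
Qed.

Lemma dot_bound k (v : 'rV[R]_k) :
  exists2 K : R, 0 < K & forall u, `|dot u v| <= K * `|u|.
Proof.
have [K K0 KP] := mulmx_bound v^T; exists K => // u.
exact: le_trans (coord_le_norm _ _) (KP u).
Qed.

(** Multiplying the difference quotient by [h] removes both the division and the punctured
    neighbourhood; derivatives computed by hand go through this form. *)
Lemma is_derive_epsP (V W : normedModType R) (f : V -> W) a v w :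
  is_derive a v f w <->
  forall e : R, 0 < e -> exists2 d : R, 0 < d &
    forall h, `|h| < d -> `|f (h *: v + a) - f a - h *: w| <= e * `|h|.
Proof.
split=> [[fav <-] e e0|H].
  move/cvgrPdist_le: fav => /(_ _ e0) /nbhs_ballP[d /= d0 dP].
  exists d => // h hd; have [->|hn0] := eqVneq h 0.
    by rewrite scale0r add0r subrr scale0r subr0 !normr0 mulr0.
  have /= := dP h; rewrite -ball_normE /= sub0r normrN => /(_ hd hn0).
  rewrite -(ler_pM2r (_ : 0 < `|h|)) ?normr_gt0// mulrC -normrZ.
  by rewrite scalerBr scalerA divff// scale1r -normrN opprB.
have c : (fun h => h^-1 *: ((f \o shift a) (h *: v) - f a)) @ 0^' --> w.
  apply/cvgrPdist_le => e e0; have [d d0 dP] := H _ e0.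
  apply/nbhs_ballP; exists d => //= h.
  rewrite -ball_normE /= sub0r normrN => hd hn0.
  rewrite -(ler_pM2r (_ : 0 < `|h|)) ?normr_gt0// mulrC -normrZ.
  by rewrite scalerBr scalerA divff// scale1r -normrN opprB dP.
split; first by apply/cvg_ex; exists w.
exact/cvg_lim.
Qed.

Lemma near_epsP (V : normedModType R) (x : V) (P : V -> Prop) :
  nbhs x P <->
  exists2 d : R, 0 < d & forall y, `|y - x| < d -> P y.
Proof.
split=> [/nbhs_ballP[d /= d0 dP]|[d d0 dP]].
  by exists d => // y yx; apply: dP; rewrite -ball_normE /= distrC.
apply/nbhs_ballP; exists d => //= y; rewrite -ball_normE /= distrC; exact: dP.
Qed.

Lemma continuous_epsP (V W : normedModType R) (f : V -> W) x :
  {for x, continuous f} <->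
  forall e : R, 0 < e -> exists2 d : R, 0 < d &
    forall y, `|y - x| < d -> `|f y - f x| <= e.
Proof.
split=> [/cvgrPdist_le fx e e0|H].
  have /near_epsP[d d0 dP] := fx _ e0; exists d => // y /dP; by rewrite distrC.
apply/cvgrPdist_le => e e0; have [d d0 dP] := H _ e0.
by apply/near_epsP; exists d => // y /dP; rewrite distrC.
Qed.

Lemma derivable_line (V : normedModType R) (f : V -> R) (x v : V) (t s : R) :
  derivable f (x + (t * s) *: v) v ->
  is_derive t 1 (fun r => f (x + (r * s) *: v)) (s * derive f (x + (t * s) *: v) v).
Proof.
move=> /derivableP /is_derive_epsP H; apply/is_derive_epsP => e e0.
(* [|s| + 1] stands in for [|s|], which may vanish. *)
have s1 : 0 < `|s| + 1 by rewrite ltr_wpDl.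
have [d d0 dP] := H (e / (`|s| + 1)) (divr_gt0 e0 s1).
exists (d / (`|s| + 1)); first exact: divr_gt0.
move=> h; rewrite ltr_pdivlMr// => hd.
have hs : `|h * s| < d.
  rewrite normrM; apply: le_lt_trans hd; rewrite ler_wpM2l// lerDl//.
have := dP _ hs; rewrite [h%:A]mulr1 mulrDl scalerDl addrCA => Hd.
rewrite -[h *: _]/(h * _) mulrA; apply: le_trans Hd _.
rewrite normrM -[leLHS]mulrA ler_wpM2l// ?(ltW e0)//.
by rewrite mulrC ler_pdivrMr// ler_wpM2l// lerDl.
Qed.

(** The segment is parametrized by [[0, 1]], so that [s] may have either sign or vanish. *)
Lemma partial_mvt (V : normedModType R) (f : V -> R) (x v : V) (s : R) :
  (forall t : R, 0 <= t <= 1 -> derivable f (x + (t * s) *: v) v) ->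
  exists2 t, 0 <= t <= 1 &
    f (x + s *: v) - f x = s * derive f (x + (t * s) *: v) v.
Proof.
move=> fd.
have dv (t : R) : 0 <= t <= 1 -> is_derive t 1 (fun r => f (x + (r * s) *: v))
    (s * derive f (x + (t * s) *: v) v).
  by move=> /fd /derivable_line.
have [||t] := @MVT_segment R (fun r => f (x + (r * s) *: v))
  (fun t => s * derive f (x + (t * s) *: v) v) 0 1 ler01.
- move=> t; rewrite in_itv /= => /andP[t0 t1]; apply: dv.
  by rewrite !ltW.
- apply: derivable_within_continuous => t; rewrite in_itv /= => /dv.
  by case.
- rewrite in_itv /= => t01; rewrite mul0r scale0r addr0 mul1r subr0 mulr1 => E.
  by exists t.
Qed.

(** Strict differentiability at [x] with gradient [g]: minus its linear part, [f] is Lipschitz near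
    [x] with an arbitrarily small constant, which is the form that contraction arguments use. *)
Definition sdiff k (f : 'rV[R]_k -> R) (x g : 'rV[R]_k) : Prop :=
  forall e : R, 0 < e -> exists2 d : R, 0 < d &
    forall y z, `|y - x| < d -> `|z - x| < d ->
      `|f y - f z - dot (y - z) g| <= e * `|y - z|.

Lemma convex_norm_lt (a b t d : R) :
  0 <= t <= 1 -> `|a| < d -> `|b| < d -> `|a + t * (b - a)| < d.
Proof.
move=> /andP[t0 t1]; rewrite !ltr_norml => /andP[a1 a2] /andP[b1 b2].
have [ab|/ltW ab] := lerP a b.
  have H1 : 0 <= t * (b - a) by rewrite mulr_ge0 ?subr_ge0.
  have H2 : 0 <= (1 - t) * (b - a) by rewrite mulr_ge0 ?subr_ge0.
  by apply/andP; split; lra.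
have H1 : 0 <= t * (a - b) by rewrite mulr_ge0 ?subr_ge0.
have H2 : 0 <= (1 - t) * (a - b) by rewrite mulr_ge0 ?subr_ge0.
by apply/andP; split; lra.
Qed.

Lemma norm_lt_coord k (x : 'rV[R]_k) c :
  0 < c -> (forall j, `|x 0 j| < c) -> `|x| < c.
Proof.
move=> c0 xc; rewrite [ltLHS]/Num.norm /= mx_normrE.
by apply: bigmax_lt => // -[i j] _ /=; rewrite ord1.
Qed.

(** Going from [z] to [y] one coordinate at a time, each step falls under the mean value theorem for
    one partial derivative. The sup norm keeps the path in the ball, since every coordinate of a
    path point lies between those of [z] and [y]. *)
Lemma C1_sdiff k (f : 'rV[R]_k -> R) (x : 'rV[R]_k) :
  (\forall p \near x, forall j, derivable f p (ebasis R j)) ->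
  (forall j, {for x, continuous (partial j f)}) ->
  sdiff f x (grad f x).
Proof.
move=> /near_epsP[r r0 fd] fc e e0.
have e1 : 0 < e / k.+1%:R by apply: divr_gt0.
have /near_epsP[d' d'0 d'P] : \forall p \near x, forall j,
    `|partial j f p - partial j f x| <= e / k.+1%:R.
  apply: (@filter_forall _ _ (fun j p =>
    `|partial j f p - partial j f x| <= e / k.+1%:R) (nbhs x)) => j /=.
  have /continuous_epsP /(_ _ e1) H := fc j.
  exact/near_epsP.
exists (Num.min r d'); first by rewrite lt_min r0.
move=> y z yx zx; pose d := Num.min r d'.
have d0 : 0 < d by rewrite lt_min r0.
pose hyb (j : nat) : 'rV[R]_k := \row_i (if (i < j)%N then y 0 i else z 0 i).
have hyb0 : hyb 0%N = z by apply/rowP => i; rewrite mxE.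
have hybk : hyb k = y by apply/rowP => i; rewrite mxE ltn_ord.
have hybS (j : 'I_k) : hyb j.+1 = hyb j + (y - z) 0 j *: ebasis R j.
  apply/rowP => i; rewrite !mxE eqxx /= ltnS leq_eqVlt -val_eqE /=.
  have [ij|ij] /= := eqVneq (i : nat) j; last by rewrite mulr0 addr0.
  have -> : i = j by exact: val_inj.
  by rewrite ltnn mulr1 addrC subrK.
have near_hyb (j : 'I_k) (t : R) : 0 <= t <= 1 ->
    `|hyb j + (t * (y - z) 0 j) *: ebasis R j - x| < d.
  move=> t01; apply: norm_lt_coord => // i.
  have yi : `|y 0 i - x 0 i| < d.
    by apply: le_lt_trans yx; have := coord_le_norm (y - x) i; rewrite !mxE.
  have zi : `|z 0 i - x 0 i| < d.
    by apply: le_lt_trans zx; have := coord_le_norm (z - x) i; rewrite !mxE.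
  rewrite !mxE eqxx /=; have [E|ij] /= := eqVneq i j.
    rewrite -E ltnn mulr1.
    rewrite (_ : _ - _ = z 0 i - x 0 i + t * (y 0 i - x 0 i - (z 0 i - x 0 i))).
      exact: convex_norm_lt.
    by ring.
  by rewrite mulr0 addr0; case: ifP.
have fdj (j : 'I_k) (t : R) : 0 <= t <= 1 ->
    derivable f (hyb j + (t * (y - z) 0 j) *: ebasis R j) (ebasis R j).
  by move=> /(near_hyb j) H; apply: fd; apply: lt_le_trans H _; rewrite ge_min lexx.
have step (j : 'I_k) : `|f (hyb j.+1) - f (hyb j) - (y - z) 0 j * partial j f x|
    <= `|y - z| * (e / k.+1%:R).
  have [t t01] := partial_mvt (fdj j); rewrite -hybS => ->.
  rewrite -mulrBr normrM ler_pM ?coord_le_norm// d'P//.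
  by apply: lt_le_trans (near_hyb j t t01) _; rewrite ge_min lexx orbT.
have -> : f y - f z = \sum_(j < k) (f (hyb j.+1) - f (hyb j)).
  by rewrite -[in LHS]hybk -[in LHS]hyb0 -(telescope_sumr (f \o hyb))// big_mkord.
rewrite dotE -sumrB (le_trans (ler_norm_sum _ _ _))//.
apply: (@le_trans _ _ (\sum_(j < k) `|y - z| * (e / k.+1%:R))).
  by apply: ler_sum => j _; rewrite [grad _ _ _ _]mxE; exact: step.
rewrite sumr_const card_ord -[leLHS]mulr_natl mulrCA [leLHS]mulrC ler_wpM2r//.
rewrite mulrCA ger_pMr// ler_pdivrMr// mul1r ler_nat.
by [].
Qed.

Lemma smooth_on_partial k (D : set 'rV[R]_k) f j :
  smooth_on D f -> smooth_on D (partial j f).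
Proof.
(* [iter_partial] applies the last index of the list first, so an inner derivative is appended at
   the end. *)
move=> sf s x Dx; have := sf (rcons s j) x Dx.
suff -> : iter_partial (rcons s j) f = iter_partial s (partial j f) by [].
by elim: s => //= i s ->.
Qed.

Lemma smooth_on_continuous k (D : set 'rV[R]_k) f x :
  smooth_on D f -> D x -> {for x, continuous f}.
Proof. by move=> sf /(sf [::])[]. Qed.

Lemma smooth_on_sdiff k (D : set 'rV[R]_k) f x :
  open D -> smooth_on D f -> D x -> sdiff f x (grad f x).
Proof.
move=> oD sf Dx; apply: C1_sdiff => [|j].
  by apply: filterS (open_nbhs_nbhs (conj oD Dx)) => p /(sf [::])[].
by have [_] := sf [:: j] x Dx.
Qed.

Lemma sdiff_lip k (f : 'rV[R]_k -> R) x g : sdiff f x g ->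
  exists L d : R, [/\ 0 < L, 0 < d & forall y z, `|y - x| < d -> `|z - x| < d ->
     `|f y - f z| <= L * `|y - z|].
Proof.
move=> /(_ _ ltr01)[d d0 dP]; have [K K0 KP] := dot_bound g.
exists (1 + K), d; split=> // [|y z yx zx]; first by rewrite addr_gt0.
rewrite -[f y - f z](subrK (dot (y - z) g)) (le_trans (ler_normD _ _))// mulrDl.
by rewrite lerD ?dP.
Qed.

Lemma is_derive_comp_sdiff (V : normedModType R) k (phi : V -> 'rV[R]_k) a v w
  (f : 'rV[R]_k -> R) g :
  is_derive a v phi w -> sdiff f (phi a) g -> is_derive a v (f \o phi) (dot w g).
Proof.
move=> /is_derive_epsP dphi sf; apply/is_derive_epsP => e e0.
have [K K0 KP] := dot_bound g.
have w1 : 0 < `|w| + 1 by rewrite ltr_wpDl.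
have e1 : 0 < e / (2 * (`|w| + 1)) by rewrite divr_gt0// mulr_gt0.
have e2 : 0 < e / (2 * K) by rewrite divr_gt0// mulr_gt0.
have [d1 d10 d1P] := sf _ e1; have [d2 d20 d2P] := dphi _ e2.
(* With error 1 this bounds the increment [D] of [phi] by [(|w| + 1) * |h|], which turns the
   remainder of [f] into a multiple of [|h|]. *)
have [d3 d30 d3P] := dphi _ ltr01.
have d40 : 0 < d1 / (`|w| + 1) by rewrite divr_gt0.
exists (Num.min d2 (Num.min d3 (d1 / (`|w| + 1)))).
  by rewrite !lt_min d20 d30.
move=> h; rewrite !lt_min => /and3P[h2 h3 h4] /=.
pose D := phi (h *: v + a) - phi a.
have D1 : `|D| <= (`|w| + 1) * `|h|.
  rewrite -[D](subrK (h *: w)) (le_trans (ler_normD _ _))// addrC mulrDl.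
  by apply: lerD; [rewrite normrZ mulrC | exact: d3P].
have Dd1 : `|D| < d1 by apply: le_lt_trans D1 _; rewrite mulrC -ltr_pdivlMr.
have := d1P (phi (h *: v + a)) (phi a) Dd1; rewrite subrr normr0 => /(_ d10) H1.
have H2 := d2P _ h2; rewrite -/D in H1 H2.
have -> : f (phi (h *: v + a)) - f (phi a) - h *: dot w g =
  (f (phi (h *: v + a)) - f (phi a) - dot D g) + dot (D - h *: w) g.
  by rewrite (dotBl D) dotZl -[h *: dot w g]/(h * dot w g); ring.
rewrite (le_trans (ler_normD _ _))// [leRHS](_ : _ = e / 2 * `|h| + e / 2 * `|h|); last by field.
apply: lerD.
  apply: le_trans H1 _; rewrite invfM mulrA -[leLHS]mulrA.
  rewrite ler_wpM2l ?divr_ge0 ?(ltW e0)//.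
  by rewrite [leLHS]mulrC ler_pdivrMr// [leRHS]mulrC.
apply: le_trans (KP _) _; apply: le_trans (ler_wpM2l (ltW K0) H2) _.
by rewrite le_eqVlt; apply/orP; left; apply/eqP; field; rewrite gt_eqF.
Qed.

End Calculus.

(** * Classes of functions closed under polynomial operations *)

Section PolynomialClosure.
Variables (R : comNzRingType) (T : Type) (P : (T -> R) -> Prop).
Hypothesis P_cst : forall c, P (fun=> c).
Hypothesis P_add : forall f g, P f -> P g -> P (fun y => f y + g y).
Hypothesis P_mul : forall f g, P f -> P g -> P (fun y => f y * g y).

(** [P] is later continuity at a point, [loclip] or [branch_fun]. Determinants and adjugates are
    polynomials in the entries, so they inherit each of these properties without a separate
    argument. *)
Lemma closed_sum (I : Type) (r : seq I) (F : I -> T -> R) :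
  (forall i, P (F i)) -> P (fun y => \sum_(i <- r) F i y).
Proof.
move=> PF; elim: r => [|i r IH].
  by rewrite (_ : (fun _ => _) = fun=> 0)//; apply/funext => y; rewrite big_nil.
rewrite (_ : (fun _ => _) = fun y => F i y + \sum_(j <- r) F j y).
  exact: P_add.
by apply/funext => y; rewrite big_cons.
Qed.

Lemma closed_prod (I : Type) (r : seq I) (F : I -> T -> R) :
  (forall i, P (F i)) -> P (fun y => \prod_(i <- r) F i y).
Proof.
move=> PF; elim: r => [|i r IH].
  by rewrite (_ : (fun _ => _) = fun=> 1)//; apply/funext => y; rewrite big_nil.
rewrite (_ : (fun _ => _) = fun y => F i y * \prod_(j <- r) F j y).
  exact: P_mul.
by apply/funext => y; rewrite big_cons.
Qed.

Lemma closed_det n (A : T -> 'M[R]_n) :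
  (forall i j, P (fun y => A y i j)) -> P (fun y => \det (A y)).
Proof.
move=> PA; rewrite /determinant.
apply: closed_sum => s; apply: P_mul; first exact: P_cst.
exact: closed_prod.
Qed.

Lemma closed_adj n (A : T -> 'M[R]_n) :
  (forall i j, P (fun y => A y i j)) ->
  forall i j, P (fun y => (\adj (A y)) i j).
Proof.
move=> PA i j; under eq_fun do rewrite mxE /cofactor.
apply: P_mul; first exact: P_cst.
by apply: closed_det => k l; under eq_fun do rewrite !mxE.
Qed.

Lemma closed_mulmx m n p (A : T -> 'M[R]_(m, n)) (B : T -> 'M[R]_(n, p)) :
  (forall i j, P (fun y => A y i j)) -> (forall i j, P (fun y => B y i j)) ->
  forall i j, P (fun y => (A y *m B y) i j).
Proof.
move=> PA PB i j; under eq_fun do rewrite mxE.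
by apply: closed_sum => k; apply: P_mul.
Qed.

End PolynomialClosure.

(** * Local Lipschitz bounds *)

Section LocallyLipschitz.
Variables (R : realType) (k : nat) (x : 'rV[R]_k).

Definition loclip (f : 'rV[R]_k -> R) : Prop :=
  exists L d : R, [/\ 0 < L, 0 < d & forall y z, `|y - x| < d -> `|z - x| < d ->
     `|f y - f z| <= L * `|y - z|].

Lemma loclip_cst c : loclip (fun=> c).
Proof. by exists 1, 1; split=> // y z _ _; rewrite subrr normr0 mul1r. Qed.

Lemma loclip_add f g : loclip f -> loclip g -> loclip (fun y => f y + g y).
Proof.
move=> [L [d [L0 d0 fP]]] [L' [d' [L'0 d'0 gP]]].
exists (L + L'), (Num.min d d'); split; first exact: addr_gt0.
  by rewrite lt_min d0.
move=> y z; rewrite !lt_min => /andP[y1 y2] /andP[z1 z2].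
rewrite opprD addrACA mulrDl (le_trans (ler_normD _ _))//.
by apply: lerD; [exact: fP|exact: gP].
Qed.

Lemma loclip_bounded f : loclip f -> exists M d : R,
  [/\ 0 < M, 0 < d & forall y, `|y - x| < d -> `|f y| <= M].
Proof.
move=> [L [d [L0 d0 fP]]]; exists (L * d + `|f x|), d; split=> //.
  by rewrite ltr_wpDr// mulr_gt0.
move=> y yx; rewrite -[f y](subrK (f x)) (le_trans (ler_normD _ _))// lerD2r.
apply: le_trans (fP y x yx _) _; first by rewrite subrr normr0.
by rewrite ler_pM2l// ltW.
Qed.

Lemma loclip_mul f g : loclip f -> loclip g -> loclip (fun y => f y * g y).
Proof.
move=> lf lg; have [M [e [M0 e0 MP]]] := loclip_bounded lf.
have [M' [e' [M'0 e'0 M'P]]] := loclip_bounded lg.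
move: lf lg => [L [d [L0 d0 fP]]] [L' [d' [L'0 d'0 gP]]].
exists (L * M' + M * L'), (Num.min (Num.min d d') (Num.min e e')); split.
- by rewrite addr_gt0// mulr_gt0.
- by rewrite !lt_min d0 d'0 e0.
move=> y z; rewrite !lt_min => /andP[/andP[y1 y2] /andP[y3 y4]].
move=> /andP[/andP[z1 z2] /andP[z3 z4]].
have -> : f y * g y - f z * g z = (f y - f z) * g y + f z * (g y - g z) by ring.
rewrite (le_trans (ler_normD _ _))// !normrM mulrDl mulrAC -[M * _ * _]mulrA.
by apply: lerD; apply: ler_pM => //; [exact: fP|exact: M'P|exact: MP|exact: gP].
Qed.

End LocallyLipschitz.

(** * Symmetry of second derivatives *)

Section Schwarz.
Variable R : realType.

Lemma close_half (u v w e : R) :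
  `|w - u| <= e / 2 -> `|w - v| <= e / 2 -> `|u - v| <= e.
Proof.
rewrite !ler_norml => /andP[? ?] /andP[? ?]; apply/andP; split; lra.
Qed.

Lemma is_derive_translate (V W : normedModType R) (f : V -> W) p c v w :
  is_derive (p + c) v f w -> is_derive p v (fun q => f (q + c)) w.
Proof.
move=> /is_derive_epsP H; apply/is_derive_epsP => e /H[d d0 dP].
by exists d => // h /dP; rewrite addrA.
Qed.

Variables (k : nat) (D : set 'rV[R]_k) (f : 'rV[R]_k -> R).
Hypotheses (oD : open D) (sf : smooth_on D f).

Let derD s p i : D p -> derivable (iter_partial s f) p (ebasis R i).
Proof. by move=> /(sf s)[]. Qed.

(** The mean value theorem in direction [i] for the increment in direction [j], then in direction
    [j] for [partial i f]. The left-hand side is symmetric in [i] and [j] and the right-hand side is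
    not, which is what the symmetry of the Hessian exploits. *)
Lemma second_difference x r i j (h : R) :
  (forall y, `|y - x| < r -> D y) -> 0 < h -> 2 * h < r ->
  exists2 p, `|p - x| <= 2 * h &
   f (x + h *: ebasis R i + h *: ebasis R j) - f (x + h *: ebasis R i)
    - (f (x + h *: ebasis R j) - f x) = h * (h * partial j (partial i f) p).
Proof.
move=> rD h0 hr.
have nb (s t : R) : 0 <= s <= 1 -> 0 <= t <= 1 ->
    `|x + (s * h) *: ebasis R i + (t * h) *: ebasis R j - x| <= 2 * h.
  have step (r' : R) l : 0 <= r' <= 1 -> `|(r' * h) *: ebasis R l| <= h.
    move=> /andP[r0 r1]; rewrite normrZ -[leRHS]mulr1.
    apply: ler_pM => //; last exact: norm_ebasis.
    by rewrite ger0_norm ?mulr_ge0 ?(ltW h0)// ler_piMl// ltW.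
  move=> s01 t01; rewrite addrAC [x + _]addrC addrK (le_trans (ler_normD _ _))//.
  by rewrite mulr_natl mulr2n lerD ?step.
have inD (s t : R) : 0 <= s <= 1 -> 0 <= t <= 1 ->
    D (x + (s * h) *: ebasis R i + (t * h) *: ebasis R j).
  by move=> s01 t01; apply: rD; apply: le_lt_trans hr; exact: nb.
have u0 : 0 <= (0 : R) <= 1 by rewrite lexx ler01.
have u1 : 0 <= (1 : R) <= 1 by rewrite lexx ler01.
pose F p := f (p + h *: ebasis R j) - f p.
have dF (t : R) : 0 <= t <= 1 -> is_derive (x + (t * h) *: ebasis R i) (ebasis R i) F
    (partial i f (x + (t * h) *: ebasis R i + h *: ebasis R j)
     - partial i f (x + (t * h) *: ebasis R i)).
  move=> t01; apply: is_deriveB.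
    apply: is_derive_translate; apply/derivableP.
    by have := inD t 1 t01 u1; rewrite mul1r => /(derD (s := [::])).
  apply/derivableP; have := inD t 0 t01 u0.
  by rewrite mul0r scale0r addr0 => /(derD (s := [::])).
have [|t t01] := @partial_mvt R _ F x (ebasis R i) h.
  by move=> t /dF[].
have [_ ->] := dF t t01; rewrite /F => ->.
have [|s s01 ->] := @partial_mvt R _ (partial i f) (x + (t * h) *: ebasis R i) (ebasis R j) h.
  by move=> s s01; apply: (derD (s := [:: i])); exact: inD.
by exists (x + (t * h) *: ebasis R i + (s * h) *: ebasis R j); first exact: nb.
Qed.

Lemma hess_sym x : D x -> (hess f x)^T = hess f x.
Proof.
move=> Dx; apply/matrixP => j i; rewrite !mxE.
have /near_epsP[r r0 rD] : nbhs x D by exact: open_nbhs_nbhs.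
apply/subr0_eq/normr0_eq0/eqP; rewrite eq_le normr_ge0 andbT.
apply/ler_addgt0Pr => e e0; rewrite add0r.
have e20 : 0 < e / 2 by rewrite divr_gt0.
have /continuous_epsP/(_ _ e20)[d1 d10 d1P] := (sf [:: i; j] Dx).2.
have /continuous_epsP/(_ _ e20)[d2 d20 d2P] := (sf [:: j; i] Dx).2.
pose d := Num.min r (Num.min d1 d2).
have d0 : 0 < d by rewrite !lt_min r0 d10.
pose h := d / 3; have h0 : 0 < h by rewrite divr_gt0.
have hd : 2 * h < d by rewrite /h; lra.
have hr : 2 * h < r by apply: lt_le_trans hd _; rewrite ge_min lexx.
have hd1 : 2 * h < d1 by apply: lt_le_trans hd _; rewrite !ge_min lexx orbT.
have hd2 : 2 * h < d2 by apply: lt_le_trans hd _; rewrite !ge_min lexx !orbT.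
have [p px Ep] := second_difference i j rD h0 hr.
have [q qx Eq] := second_difference j i rD h0 hr.
have {Ep Eq} E : partial j (partial i f) p = partial i (partial j f) q.
  apply: (mulfI (lt0r_neq0 h0)); apply: (mulfI (lt0r_neq0 h0)).
  apply: etrans (esym Ep) _; apply: etrans _ Eq.
  by rewrite (addrAC x (h *: ebasis R j)); ring.
have H1 : `|partial i (partial j f) q - partial i (partial j f) x| <= e / 2.
  exact: d1P q (le_lt_trans qx hd1).
have H2 : `|partial j (partial i f) p - partial j (partial i f) x| <= e / 2.
  exact: d2P p (le_lt_trans px hd2).
rewrite E in H2; exact: close_half H1 H2.
Qed.

End Schwarz.

(** * Global solutions of Lipschitz differential equations *)

Section GlobalSolutions.
Variable R : realType.

Lemma is_derive_le (f df : R -> R) (a b : R) : a <= b ->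
  (forall t, a <= t <= b -> is_derive t 1 f (df t)) ->
  (forall t, a <= t <= b -> 0 <= df t) -> f a <= f b.
Proof.
move=> ab fd df0.
have [||t] := @MVT_segment R f df a b ab.
- move=> t; rewrite in_itv /= => /andP[a_t tb]; apply: fd.
  by rewrite !ltW.
- by apply: derivable_within_continuous => t; rewrite in_itv /= => /fd[].
rewrite in_itv /= => /df0 dt0 E; by rewrite -subr_ge0 E mulr_ge0// subr_ge0.
Qed.

Lemma is_derive_constant (f df : R -> R) (a b : R) :
  (forall t, Num.min a b <= t <= Num.max a b -> is_derive t 1 f (df t)) ->
  (forall t, Num.min a b <= t <= Num.max a b -> df t = 0) -> f a = f b.
Proof.
wlog ab : a b / a <= b => [H|].
  have [ab|/ltW ba fd f0] := lerP a b; first by have := H a b ab; rewrite min_l// max_r.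
  by apply: esym; apply: (H b a ba); rewrite min_l// max_r.
rewrite min_l// max_r// => fd df0; apply/eqP; rewrite eq_le; apply/andP; split.
  by apply: (@is_derive_le f df) => // t /df0 ->.
rewrite -lerN2; apply: (@is_derive_le (fun t => - f t) (fun t => - df t)) => // t tab.
  by have := fd t tab => H; apply: is_deriveN.
by rewrite df0// oppr0.
Qed.

Lemma is_derive_continuous (V : normedModType R) (f : R -> V) (t : R) w :
  is_derive t 1 f w -> {for t, continuous f}.
Proof. by case=> /derivable1_diffP /differentiable_continuous. Qed.

(** The fundamental theorem applies to the right of a fixed lower bound, so no single integral
    serves all real [t]. Once normalized to vanish at 0, the integral no longer depends on its lower
    bound, which may then move with [t]. *)
Lemma antiderivative (f : R -> R) : continuous f ->
  exists P : R -> R, P 0 = 0 /\ forall t : R, is_derive t 1 P (f t).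
Proof.
move=> cf.
pose F a t := (\int[@lebesgue_measure R]_(s in [set` `[a, t]]) f s)%R.
have dF (a t : R) : a < t -> is_derive t 1 (F a) (f t).
  move=> a_t; have tt : t < t + 1 by rewrite ltrDl.
  have ig : (@lebesgue_measure R).-integrable `[a, t + 1] (EFin \o f).
    apply: continuous_compact_integrable; first exact: segment_compact.
    exact: continuous_subspaceT.
  have [dFt Ft] := continuous_FTC1_closed tt ig a_t (cf t).
  by apply: (DeriveDef dFt); rewrite -derive1E.
have FE (a b t : R) : a < 0 -> b < 0 -> a < t -> b < t -> F a t - F a 0 = F b t - F b 0.
  move=> a0 b0 a_t bt.
  have := @is_derive_constant (fun s => F a s - F b s) (fun s => f s - f s) 0 t.
  move=> H; suff : F a 0 - F b 0 = F a t - F b t by move=> E; lra.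
  apply: H => [s /andP[+ _]|s _]; last exact: subrr.
  by rewrite ge_min => /orP[] h; apply: is_deriveB; apply: dF; apply: lt_le_trans h.
pose A (t : R) : R := - (`|t| + 1).
have A0 t : A t < 0 by rewrite oppr_lt0 ltr_wpDl.
have At t : A t < t.
  by rewrite /A ltrNl (le_lt_trans (ler_norm _))// normrN ltrDl.
exists (fun t => F (A t) t - F (A t) 0); split; first by rewrite subrr.
(* [B] lies below 0 and below every [t] within 1 of [t0], so near [t0] the function is one integral
   with a fixed lower bound. *)
move=> t0; pose B := A t0 - 1.
have B0 : B < 0 by rewrite subr_lt0 (lt_trans (A0 _)).
apply: (@near_eq_is_derive _ _ _ (fun t => F B t - F B 0)).
  apply/near_epsP; exists 1 => // t tt0; apply: FE => //.
  have := ler_norm (- t0); move: tt0; rewrite ltr_norml /B /A normrN => /andP[]; lra.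
rewrite -[f t0]subr0; apply: is_deriveB.
by apply: dF; rewrite /B (lt_trans _ (At t0))// ltrBlDr ltrDl.
Qed.

Lemma is_derive_row (V : normedModType R) k (phi : V -> 'rV[R]_k) t v (w : 'rV[R]_k) :
  (forall i, is_derive t v (fun s => phi s 0 i) (w 0 i)) -> is_derive t v phi w.
Proof.
move=> H; have D : derivable phi t v.
  by apply/derivable_mxP => i j; rewrite ord1; case: (H j).
apply: DeriveDef => //; rewrite derive_mx//; apply/matrixP => i j.
by rewrite mxE ord1; case: (H j).
Qed.

Lemma is_derive_coord (V : normedModType R) k (phi : V -> 'rV[R]_k) t v (w : 'rV[R]_k) i :
  is_derive t v phi w -> is_derive t v (fun s => phi s 0 i) (w 0 i).
Proof.
move=> [D E]; have Di : derivable (fun s => phi s 0 i) t v.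
  by move/derivable_mxP: D => /(_ 0 i).
by apply: (DeriveDef Di); rewrite -E (derive_mx D) mxE.
Qed.

Lemma is_derive_expM (K t : R) :
  is_derive t 1 (fun s => expR (K * s)) (K * expR (K * t)).
Proof.
rewrite mulrC; apply: (is_derive1_comp (f := expR) (g := fun s => K * s)).
by apply: is_derive_eq; rewrite -[_ *: _]/(_ * _) mulr1.
Qed.

Section Weight.
Variable K : R.
Hypothesis K0 : 0 < K.

(** A smooth substitute for [expR (K * |t|)]: in the norm weighted by it the Picard operator
    contracts on the whole line, in both time directions. *)
Definition weight (t : R) : R := expR (K * t) + expR (- K * t).

Lemma weight_ge1 t : 1 <= weight t.
Proof.
have [t0|t0] := lerP 0 t.
  rewrite -[leLHS]addr0 lerD ?expR_ge0// -[leLHS]addr0.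
  by apply: le_trans (expR_ge1Dx _); rewrite lerD2l mulr_ge0// ltW.
rewrite -[leLHS]add0r lerD ?expR_ge0// -[leLHS]addr0.
by apply: le_trans (expR_ge1Dx _); rewrite lerD2l mulNr oppr_ge0 mulr_ge0_le0// ltW.
Qed.

Lemma weight_le t B : `|t| <= B -> weight t <= 2 * expR (K * B).
Proof.
rewrite ler_norml => /andP[tB1 tB2]; rewrite mulr_natl mulr2n.
by rewrite lerD// ler_expR ?mulNr -?mulrN ler_pM2l// lerNl.
Qed.

(* The odd function [s] below is an antiderivative of the weight, and
   [`|s|] is at most [weight / K]. *)
Lemma weight_integrate (d dd : R -> R) A : 0 <= A -> d 0 = 0 ->
  (forall t : R, is_derive t 1 d (dd t)) -> (forall t, `|dd t| <= A * weight t) ->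
  forall t, `|d t| <= A / K * weight t.
Proof.
move=> A0 d0 dP ddA.
pose s (t : R) : R := (expR (K * t) - expR (- K * t)) / K.
have ds (t : R) : is_derive t 1 s (weight t).
  have H1 := is_derive_expM K t; have H2 := is_derive_expM (- K) t.
  have := is_deriveZ K^-1 (is_deriveB H1 H2).
  rewrite (_ : K^-1 *: _ = weight t); last first.
    by rewrite -[LHS]/(_ * _) /weight; field; rewrite gt_eqF.
  congr (is_derive t 1 _ _); apply/funext => u.
  by rewrite /s mulrC.
have s0 : s 0 = 0 by rewrite /s !mulr0 subrr mul0r.
have sw t : - (weight t / K) <= s t <= weight t / K.
  have e1 := expR_ge0 (K * t); have e2 := expR_ge0 (- K * t).
  rewrite /s -mulNr !ler_pM2r ?invr_gt0// /weight; apply/andP; split; lra.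
have up (a b : R) : a <= b -> A * s a - d a <= A * s b - d b.
  move=> ab; apply: (@is_derive_le (fun t => A * s t - d t) (fun t => A * weight t - dd t)) => // t _.
  by rewrite subr_ge0; apply: le_trans (ddA t); exact: ler_norm.
have dn (a b : R) : a <= b -> A * s a + d a <= A * s b + d b.
  move=> ab; apply: (@is_derive_le (fun t => A * s t + d t) (fun t => A * weight t + dd t)) => // t _.
  rewrite -lerBlDr sub0r; apply: le_trans (ddA t); rewrite -normrN; exact: ler_norm.
move=> t; have /andP[sw1 sw2] := sw t.
have sw1' : - (A / K * weight t) <= A * s t.
  by rewrite mulrAC -[A * _ / K]mulrA -mulrN ler_wpM2l.
have sw2' : A * s t <= A / K * weight t.
  by rewrite mulrAC -[A * _ / K]mulrA ler_wpM2l.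
rewrite ler_norml; have [t0|/ltW t0] := lerP 0 t.
  by have := up _ _ t0; have := dn _ _ t0; rewrite s0 d0 mulr0; move=> *; apply/andP; split; lra.
by have := up _ _ t0; have := dn _ _ t0; rewrite s0 d0 mulr0; move=> *; apply/andP; split; lra.
Qed.

End Weight.

Lemma pow2_small (B e : R) : 0 <= B -> 0 < e -> exists n : nat, B / 2 ^+ n <= e.
Proof.
move=> B0 e0; exists (Num.bound (B / e)).
have H := archi_boundP (divr_ge0 B0 (ltW e0)).
rewrite ler_pdivrMr ?exprn_gt0// mulrC -ler_pdivrMr//.
apply: le_trans (ltW H) _; rewrite -natrX ler_nat.
exact/ltnW/ltn_expl.
Qed.

Lemma geometric_limit_real (u : nat -> R) B :
  0 <= B -> (forall n, `|u n.+1 - u n| <= B / 2 ^+ n) ->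
  exists l, forall n, `|l - u n| <= 2 * B / 2 ^+ n.
Proof.
move=> B0 uB.
have dist m n : `|u (n + m)%N - u n| <= 2 * B / 2 ^+ n - 2 * B / 2 ^+ (n + m).
  elim: m => [|m IH]; first by rewrite addn0 !subrr normr0.
  rewrite -[u _ - u n](subrKA (u (n + m)%N)) (le_trans (ler_normD _ _))//.
  rewrite addnS (le_trans (lerD (uB _) IH))// exprSr invfM.
  by rewrite le_eqVlt; apply/orP; left; apply/eqP; field; rewrite !expf_neq0.
have dist' m n : `|u (n + m)%N - u n| <= 2 * B / 2 ^+ n.
  apply: le_trans (dist m n) _; rewrite gerBl divr_ge0 ?exprn_ge0// mulr_ge0//.
have cu : cvgn u.
  apply/cauchy_cvgP/cauchyP => e e0.
  have e20 : 0 < e / 2 by rewrite divr_gt0.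
  have [n nP] := pow2_small (mulr_ge0 (ler0n _ 2) B0) e20.
  exists (u n); exists n => // m /= nm; rewrite -ball_normE /= distrC.
  rewrite -(subnKC nm) (le_lt_trans (dist' _ _))// (le_lt_trans nP)//.
  by rewrite ltr_pdivrMr// ltr_pMr// ltr1n.
exists (limn u) => n; apply/ler_addgt0Pr => e e0.
have /cvgrPdist_lt/(_ _ e0)[N _ NP] := cu.
have := NP (maxn N n) (leq_maxl _ _); have := dist' (maxn N n - n)%N n.
rewrite subnKC ?leq_maxr// => H1 H2.
rewrite -(subrKA (u (maxn N n))) (le_trans (ler_normD _ _))// addrC lerD//.
exact: ltW.
Qed.

Lemma geometric_limit k (u : nat -> 'rV[R]_k) B :
  0 <= B -> (forall n, `|u n.+1 - u n| <= B / 2 ^+ n) ->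
  exists l, forall n, `|l - u n| <= 2 * B / 2 ^+ n.
Proof.
move=> B0 uB.
have /choice[l lP] : forall i, exists l, forall n, `|l - u n 0 i| <= 2 * B / 2 ^+ n.
  move=> i; apply: geometric_limit_real => // n; apply: le_trans (uB n).
  by have := coord_le_norm (u n.+1 - u n) i; rewrite !mxE.
exists (\row_i l i) => n; apply: norm_le_coord => [|i]; last by rewrite !mxE.
by rewrite divr_ge0 ?exprn_ge0// mulr_ge0.
Qed.

Section Picard.
Variables (k : nat) (g : 'rV[R]_k -> 'rV[R]_k) (L : R) (y0 : 'rV[R]_k).
Hypotheses (L0 : 0 < L) (gL : forall x y, `|g x - g y| <= L * `|x - y|).

Lemma lipschitz_continuous : continuous g.
Proof.
move=> x; apply/continuous_epsP => e e0; exists (e / L); first exact: divr_gt0.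
move=> y; rewrite ltr_pdivlMr// => yx; apply: le_trans (gL _ _) _.
by rewrite mulrC ltW.
Qed.

(** Integration against the weight gains [L / K = 1 / 2], so one Picard step halves the weighted
    distance. *)
Let K := 2 * L.
Let K0 : 0 < K. Proof. by rewrite mulr_gt0. Qed.

Lemma integral_equation (phi : R -> 'rV[R]_k) : continuous phi ->
  exists psi : R -> 'rV[R]_k, psi 0 = y0 /\ forall t : R, is_derive t 1 psi (g (phi t)).
Proof.
move=> cphi.
have /choice[P PP] : forall i : 'I_k, exists P : R -> R, P 0 = 0 /\
    forall t : R, is_derive t 1 P (g (phi t) 0 i).
  move=> i; apply: antiderivative => t; apply: (@continuous_comp _ _ _ (g \o phi) (fun M : 'rV[R]_k => M 0 i)).
    apply: (@continuous_comp _ _ _ phi g); first exact: cphi.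
    exact: lipschitz_continuous.
  exact: coord_continuous.
exists (fun t => y0 + \row_i P i t); split.
  by apply/rowP => i; rewrite !mxE (PP i).1 addr0.
move=> t; apply: is_derive_row => i.
have -> : (fun s => (y0 + \row_i0 P i0 s) 0 i) = (fun s => y0 0 i + P i s).
  by apply/funext => s; rewrite !mxE.
have H := is_deriveD (is_derive_cst (y0 0 i) t 1) ((PP i).2 t).
by rewrite add0r in H.
Qed.

Lemma integral_compare (phi phi' psi psi' : R -> 'rV[R]_k) A : 0 <= A ->
  psi 0 = y0 -> psi' 0 = y0 ->
  (forall t : R, is_derive t 1 psi (g (phi t))) ->
  (forall t : R, is_derive t 1 psi' (g (phi' t))) ->
  (forall t, `|phi t - phi' t| <= A * weight K t) ->
  forall t, `|psi t - psi' t| <= A / 2 * weight K t.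
Proof.
move=> A0 p0 p0' dp dp' H t.
have w0 : 0 <= weight K t by rewrite (le_trans ler01)// weight_ge1.
apply: norm_le_coord => [|i]; first by rewrite mulr_ge0// divr_ge0.
have -> : A / 2 = (L * A) / K by rewrite /K; field; rewrite gt_eqF.
have := @weight_integrate K K0 (fun t => psi t 0 i - psi' t 0 i)
  (fun t => g (phi t) 0 i - g (phi' t) 0 i) (L * A).
rewrite !mxE; apply.
- by rewrite mulr_ge0// ltW.
- by rewrite p0 p0' subrr.
- by move=> s; apply: is_deriveB; apply: is_derive_coord.
move=> s; have := coord_le_norm (g (phi s) - g (phi' s)) i; rewrite !mxE => /le_trans; apply.
by apply: le_trans (gL _ _) _; rewrite -mulrA ler_pM2l.
Qed.

(** Picard iteration carried out pointwise in [t]; the weighted bounds, valid on the whole line,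
    replace a complete function space. *)
Lemma global_solution :
  exists phi : R -> 'rV[R]_k, phi 0 = y0 /\ forall t : R, is_derive t 1 phi (g (phi t)).
Proof.
(* The Picard operator is made total; its value on discontinuous functions is arbitrary. *)
have /choice[Phi PhiP] : forall phi : R -> 'rV[R]_k, exists psi : R -> 'rV[R]_k,
    continuous phi -> psi 0 = y0 /\ forall t : R, is_derive t 1 psi (g (phi t)).
  move=> phi; have [cphi|ncphi] := pselect (continuous phi); last by exists phi.
  by have [psi psiP] := integral_equation cphi; exists psi.
have Phic phi : continuous phi -> continuous (Phi phi).
  by move=> /PhiP[_ H] t; exact: is_derive_continuous (H t).
pose u n := iter n Phi (fun=> y0).
have uc n : continuous (u n).
  elim: n => [|n IH]; first by move=> t; exact: cvg_cst.
  exact: Phic.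
have u0 n : u n 0 = y0.
  by case: n => [//|n]; have [] := PhiP _ (uc n).
have du n (t : R) : is_derive t 1 (u n.+1) (g (u n t)) by have [_] := PhiP _ (uc n); exact.
pose M := `|g y0| / K.
have M0 : 0 <= M by rewrite divr_ge0// ltW.
have step n : forall t, `|u n.+1 t - u n t| <= M / 2 ^+ n * weight K t.
  elim: n => [|n IH] t.
    have w0 : 0 <= weight K t by rewrite (le_trans ler01)// weight_ge1.
    rewrite expr0 divr1; apply: norm_le_coord => [|i]; first by rewrite mulr_ge0.
    have := @weight_integrate K K0 (fun t => u 1 t 0 i - y0 0 i) (fun t => g y0 0 i) `|g y0|.
    rewrite !mxE; apply => //.
    - by rewrite u0 subrr.
    - move=> s; have H := is_deriveB (is_derive_coord i (du 0%N s)) (is_derive_cst (y0 0 i) s 1).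
      by rewrite subr0 in H.
    move=> s; apply: le_trans (coord_le_norm _ _) _; rewrite ler_peMr//.
    exact: weight_ge1.
  rewrite exprSr invfM mulrA.
  apply: (integral_compare _ (u0 _) (u0 _) (du n.+1) (du n) IH).
  by rewrite divr_ge0// exprn_ge0.
have /choice[phi phiP] : forall t, exists l, forall n,
    `|l - u n t| <= 2 * (M * weight K t) / 2 ^+ n.
  move=> t; have B0 : 0 <= M * weight K t.
    by rewrite mulr_ge0// (le_trans ler01)// weight_ge1.
  have stepB n : `|u n.+1 t - u n t| <= M * weight K t / 2 ^+ n by rewrite mulrAC.
  exact: (geometric_limit (u := fun n => u n t) B0 stepB).
have phiu n t : `|phi t - u n t| <= 2 * M / 2 ^+ n * weight K t.
  by apply: le_trans (phiP t n) _; rewrite mulrA mulrAC.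
have M20 n : 0 <= 2 * M / 2 ^+ n by rewrite divr_ge0 ?exprn_ge0// mulr_ge0.
have cphi : continuous phi.
  (* [W] bounds the weight at all times of size at most [|t| + 1], so convergence is uniform there
     and the errors can be split in three. *)
  move=> t; apply/continuous_epsP => e e0; pose W := 2 * expR (K * (`|t| + 1)).
  have W0 : 0 < W by rewrite mulr_gt0// expR_gt0.
  have e30 : 0 < e / 3 by rewrite divr_gt0.
  have [n nP] := pow2_small (mulr_ge0 (mulr_ge0 (ler0n _ 2) M0) (ltW W0)) e30.
  have /continuous_epsP/(_ _ e30)[d d0 dP] := uc n t.
  exists (Num.min 1 d); first by rewrite lt_min ltr01.
  move=> s; rewrite lt_min => /andP[s1 sd].
  have close r : `|r| <= `|t| + 1 -> `|phi r - u n r| <= e / 3.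
    move=> rt; apply: le_trans (phiu n r) _; apply: le_trans nP.
    rewrite mulrAC ler_wpM2r ?invr_ge0 ?exprn_ge0// ler_wpM2l ?mulr_ge0//.
      by rewrite invr_ge0 ltW.
    exact: (weight_le K0 rt).
  have st : `|s| <= `|t| + 1.
    by rewrite -[s](subrK t) (le_trans (ler_normD _ _))// addrC lerD2l ltW.
  have tt : `|t| <= `|t| + 1 by rewrite lerDl.
  have -> : phi s - phi t = (phi s - u n s) + (u n s - u n t) - (phi t - u n t).
    by rewrite addrA subrK opprB addrA subrK.
  rewrite (le_trans (ler_normB _ _))// (le_trans (lerD (ler_normD _ _) (lexx _)))//.
  by have := close _ st; have := close _ tt; have := dP _ sd; lra.
have [psi [psi0 dpsi]] := integral_equation cphi.
(* [psi] is the Picard image of [phi]. Its weighted distance to [u n.+1] is at most half the bound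
   on the distance from [phi] to [u n], so both functions are the limit of the iterates. *)
suff E : psi = phi by exists phi; rewrite -{1 2}E.
apply/funext => t; apply/subr0_eq/normr0_eq0/eqP; rewrite eq_le normr_ge0 andbT.
apply/ler_addgt0Pr => e e0; rewrite add0r.
have w0 : 0 <= weight K t by rewrite (le_trans ler01)// weight_ge1.
have e20 : 0 < e / 2 by rewrite divr_gt0.
have [n nP] := pow2_small (mulr_ge0 (mulr_ge0 (ler0n _ 2) M0) w0) e20.
have H1 := integral_compare (M20 n) psi0 (u0 n.+1) dpsi (du n) (phiu n) t.
have H2 := phiu n.+1 t.
rewrite -(subrKA (u n.+1 t)) (le_trans (ler_normD _ _))// [leRHS](splitr e).
have H3 : 2 * M / 2 ^+ n * weight K t <= e / 2 by rewrite mulrAC.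
have H4 : 0 <= 2 * M / 2 ^+ n * weight K t by rewrite mulr_ge0.
rewrite lerD//.
  by apply: le_trans H1 _; rewrite mulrAC; lra.
rewrite distrC; apply: le_trans H2 _; rewrite exprSr invfM mulrA mulrAC; lra.
Qed.

End Picard.

End GlobalSolutions.

(** * Quadratic forms on a two-dimensional kernel *)

Section LinearAlgebra.
Variable R : realType.

Lemma dot_self_eq0 k (u : 'rV[R]_k) : dot u u = 0 -> u = 0.
Proof.
rewrite dotE => /eqP; rewrite psumr_eq0; last by move=> i _; rewrite -expr2 sqr_ge0.
by move=> /allP H; apply/rowP => i; rewrite mxE; apply/eqP;
  have := H i (mem_index_enum _); rewrite -expr2 sqrf_eq0.
Qed.

Lemma dot_mulmx k l (u : 'rV[R]_k) (A : 'M[R]_(k, l)) v :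
  dot (u *m A) v = dot u (v *m A^T).
Proof. by rewrite /dot trmx_mul trmxK mulmxA. Qed.

Lemma dot_norm k (u v : 'rV[R]_k) : `|dot u v| <= k%:R * (`|u| * `|v|).
Proof.
rewrite dotE (le_trans (ler_norm_sum _ _ _))//.
apply: (@le_trans _ _ (\sum_(j < k) `|u| * `|v|)).
  by apply: ler_sum => j _; rewrite normrM ler_pM ?coord_le_norm.
by rewrite sumr_const card_ord mulr_natl.
Qed.

Lemma unitmx_inj n (A : 'M[R]_n) :
  (forall u : 'rV[R]_n, u *m A = 0 -> u = 0) -> A \in unitmx.
Proof.
move=> H; rewrite -row_free_unit -kermx_eq0; apply/eqP/row_matrixP => i.
by rewrite row0; apply: H; rewrite -row_mul mulmx_ker row0.
Qed.

Lemma gram_unit p n (A : 'M[R]_(p, n)) : row_free A -> A *m A^T \in unitmx.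
Proof.
move=> fA; apply: unitmx_inj => u uA.
have : dot (u *m A) (u *m A) = 0.
  by rewrite dot_mulmx -mulmxA uA dot0r.
by move/dot_self_eq0/eqP; rewrite mulmx_free_eq0// => /eqP.
Qed.

Lemma ker_basis m (G : 'M[R]_(m, m + 2)) : row_free G ->
  exists N : 'M[R]_(2, m + 2), [/\ row_free N, N *m G^T = 0 &
    forall z : 'rV[R]_(m + 2), z *m G^T = 0 -> exists s : 'rV[R]_2, z = s *m N].
Proof.
move=> /eqP rG; set K := kermx G^T.
have rK : \rank K = 2%N by rewrite mxrank_ker mxrank_tr rG addKn.
(* [row_base K] has [\rank K] rows, a number equal to 2 only propositionally; the whole existential
   is transported along that equality. *)
suff [N NP] : exists N : 'M[R]_(\rank K, m + 2), [/\ row_free N, N *m G^T = 0 &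
    forall z : 'rV[R]_(m + 2), z *m G^T = 0 -> exists s, z = s *m N].
  by move: N NP; rewrite rK => N NP; exists N.
exists (row_base K); split.
- exact: row_base_free.
- by apply/sub_kermxP; rewrite eq_row_base.
- move=> z /sub_kermxP; rewrite -/K -(eq_row_base K) => /submxP[s ->].
  by exists s.
Qed.

Lemma sum2 (F : 'I_2 -> R) : \sum_i F i = F 0 + F 1.
Proof.
rewrite big_ord_recl big_ord_recl big_ord0 addr0.
by congr (F _ + F _); apply: val_inj.
Qed.

Lemma det2 (A : 'M[R]_2) : \det A = A 0 0 * A 1 1 - A 0 1 * A 1 0.
Proof.
have l00 : lift (0 : 'I_2) (0 : 'I_1) = 1 by apply: val_inj.
have l10 : lift (1 : 'I_2) (0 : 'I_1) = 0 by apply: val_inj.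
rewrite (expand_det_row _ 0) sum2 /cofactor !det_mx11 !mxE l00 l10 /=.
by rewrite expr0 mul1r expr1 mulN1r mulrN.
Qed.

Section Restricted.
Variables (m : nat) (G : 'M[R]_(m, m + 2)) (Q : 'M[R]_(m + 2)).
Hypotheses (fG : row_free G) (uQ : Q \in unitmx) (sQ : Q^T = Q).
Implicit Types w z a b : 'rV[R]_(m + 2).

(* Both sides come from multiplying [col_mx (G *m invmx Q) N] by
   [row_mx G^T N^T], directly and after inserting [Q]. *)
Lemma det_restricted (N : 'M[R]_(2, m + 2)) : N *m G^T = 0 ->
  \det Q * \det (G *m invmx Q *m G^T) * \det (N *m N^T) =
  \det (G *m G^T) * \det (N *m Q *m N^T).
Proof.
move=> NG; have GN : G *m N^T = 0 by rewrite -[G]trmxK -trmx_mul NG trmx0.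
pose E := col_mx (G *m invmx Q) N; pose Y := row_mx G^T N^T.
have EQY : E *m Q *m Y = block_mx (G *m G^T) 0 (N *m Q *m G^T) (N *m Q *m N^T).
  by rewrite /E /Y mul_col_mx mulmxKV// mul_col_row GN.
have EY : E *m Y = block_mx (G *m invmx Q *m G^T) (G *m invmx Q *m N^T) 0 (N *m N^T).
  by rewrite /E /Y mul_col_row NG.
have H1 : \det E * \det Q * \det Y = \det (G *m G^T) * \det (N *m Q *m N^T).
  by rewrite -!det_mulmx EQY det_lblock.
have H2 : \det E * \det Y = \det (G *m invmx Q *m G^T) * \det (N *m N^T).
  by rewrite -det_mulmx EY det_ublock.
by rewrite -H1 -mulrA -H2; ring.
Qed.

Lemma det_restricted_sign (N : 'M[R]_(2, m + 2)) : row_free N -> N *m G^T = 0 ->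
  exists2 c : R, 0 < c &
  \det Q * \det (G *m invmx Q *m G^T) = c * \det (N *m Q *m N^T).
Proof.
move=> fN NG; have GN : G *m N^T = 0 by rewrite -[G]trmxK -trmx_mul NG trmx0.
have gN := gram_unit fN; have gG := gram_unit fG.
rewrite unitmxE unitfE in gN; rewrite unitmxE unitfE in gG.
(* The rows of [G] are orthogonal to those of [N], so the Gram matrix of [col_mx G N] is block
   diagonal. The product of the two Gram determinants is thus a nonzero square, and their quotient
   is positive. *)
have M2 : \det (col_mx G N) ^+ 2 = \det (G *m G^T) * \det (N *m N^T).
  rewrite expr2 -{2}det_tr -det_mulmx tr_col_mx mul_col_row GN NG.
  by rewrite det_ublock.
exists (\det (G *m G^T) / \det (N *m N^T)).
  have H : 0 < \det (G *m G^T) * \det (N *m N^T).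
    by rewrite lt0r -{2}M2 sqr_ge0 mulf_neq0.
  have -> : \det (G *m G^T) / \det (N *m N^T) =
    \det (G *m G^T) * \det (N *m N^T) / \det (N *m N^T) ^+ 2 by field.
  by rewrite divr_gt0// exprn_even_gt0.
by apply: (mulIf gN); rewrite det_restricted//; field.
Qed.

Let B w z := dot (w *m Q) z.

Let BC w z : B w z = B z w.
Proof. by rewrite /B dot_mulmx sQ dotC. Qed.

Let BDl w w' z : B (w + w') z = B w z + B w' z.
Proof. by rewrite /B mulmxDl dotDl. Qed.

Let BDr w w' z : B z (w + w') = B z w + B z w'.
Proof. by rewrite /B dotDr. Qed.

Let B_restricted (N : 'M[R]_(2, m + 2)) (s t : 'rV[R]_2) :
  B (s *m N) (t *m N) = dot (s *m (N *m Q *m N^T)) t.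
Proof. by rewrite /B dotC dot_mulmx dotC !mulmxA. Qed.

(** In a basis of the kernel this is a symmetric 2 by 2 matrix of positive determinant: its diagonal
    entries have a common sign, which is [sg]. *)
Lemma definite_on_ker :
  0 < \det Q * \det (G *m invmx Q *m G^T) ->
  exists sg c : R, [/\ sg ^+ 2 = 1, 0 < c &
    forall z, z *m G^T = 0 -> c * `|z| ^+ 2 <= sg * dot (z *m Q) z].
Proof.
have [N [fN NG kN]] := ker_basis fG.
have [e e0 ->] := det_restricted_sign fN NG.
rewrite pmulr_rgt0//; set S := N *m Q *m N^T.
have sS : S^T = S by rewrite /S !trmx_mul trmxK sQ mulmxA.
have S10 : S 1 0 = S 0 1 by rewrite -[in LHS]sS mxE.
rewrite det2 S10; set al := S 0 0; set be := S 0 1; set ga := S 1 1 => dS.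
have al0 : al != 0.
  by apply/eqP => E; move: dS; rewrite E mul0r sub0r oppr_gt0 ltNge -expr2 sqr_ge0.
pose sg := Num.sg al; have sg2 : sg ^+ 2 = 1 by rewrite /sg sqr_sg al0.
have sgal : 0 < sg * al by rewrite /sg -normrEsg normr_gt0.
have sgga : 0 < sg * ga.
  rewrite -(pmulr_rgt0 _ sgal) mulrACA -expr2 sg2 mul1r.
  by rewrite (lt_le_trans dS)// gerBl -expr2 sqr_ge0.
have [K K0 KP] := mulmx_bound N.
have t0 : 0 < sg * (al + ga) by rewrite mulrDr addr_gt0.
(* Determinant over trace bounds the smaller eigenvalue of [sg * S] from below; [K ^+ 2] passes from
   the coordinates [s] to [z = s *m N]. *)
pose c := (al * ga - be * be) / (sg * (al + ga)) / K ^+ 2.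
have c0 : 0 < c by rewrite !divr_gt0// exprn_gt0.
exists sg, c; split=> // z /kN[s ->].
rewrite -/(B _ _) B_restricted -/S.
have -> : dot (s *m S) s = al * s 0 0 ^+ 2 + 2 * be * s 0 0 * s 0 1 + ga * s 0 1 ^+ 2.
  rewrite dotE sum2 !mxE !sum2.
  by rewrite -/al -/be -/ga S10 -/be; ring.
have n2 : `|s *m N| ^+ 2 <= K ^+ 2 * (s 0 0 ^+ 2 + s 0 1 ^+ 2).
  apply: (@le_trans _ _ (K ^+ 2 * `|s| ^+ 2)).
    by rewrite -exprMn lerXn2r ?nnegrE ?mulr_ge0// ltW.
  rewrite ler_pM2l ?exprn_gt0//.
  have : `|s| <= Num.sqrt (s 0 0 ^+ 2 + s 0 1 ^+ 2).
    apply: norm_le_coord; first exact: sqrtr_ge0.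
    move=> j; rewrite -sqrtr_sqr ler_sqrt ?addr_ge0 ?sqr_ge0//.
    have j01 : j = 0 \/ j = 1.
      by case: j => -[|[|//]] j2; [left|right]; apply: val_inj.
    by case: j01 => ->; [rewrite lerDl sqr_ge0|rewrite lerDr sqr_ge0].
  move=> H; rewrite -[leRHS]sqr_sqrtr ?addr_ge0 ?sqr_ge0//.
  by rewrite lerXn2r ?nnegrE ?sqrtr_ge0.
apply: le_trans (ler_wpM2l (ltW c0) n2) _.
rewrite /c mulrA divfK ?gt_eqF ?exprn_gt0// mulrAC ler_pdivrMr//.
rewrite -subr_ge0; set s0 := s 0 0; set s1 := s 0 1.
have -> : sg * (al * s0 ^+ 2 + 2 * be * s0 * s1 + ga * s1 ^+ 2) * (sg * (al + ga)) =
   sg ^+ 2 * ((al * s0 ^+ 2 + 2 * be * s0 * s1 + ga * s1 ^+ 2) * (al + ga)) by ring.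
(* By Cayley-Hamilton, [tr S * S - det S = S ^ 2], so the difference is the squared Euclidean length
   of [s *m S]. *)
rewrite sg2 mul1r (_ : _ - _ = (al * s0 + be * s1) ^+ 2 + (be * s0 + ga * s1) ^+ 2).
  by rewrite addr_ge0 ?sqr_ge0.
by ring.
Qed.

(** Finsler's lemma: a form definite on the kernel becomes definite on the whole space after adding
    a large multiple of the squared distance to the kernel, here measured by [w *m G^T]. *)
Lemma definite_on_ker_coercive (sg c : R) : sg ^+ 2 = 1 -> 0 < c ->
  (forall z, z *m G^T = 0 -> c * `|z| ^+ 2 <= sg * dot (z *m Q) z) ->
  exists2 C : R, 0 < C & forall w,
    c / 4 * `|w| ^+ 2 - C * `|w *m G^T| ^+ 2 <= sg * dot (w *m Q) w.
Proof.
move=> sg2 c0 posB.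
(* [w *m G^T *m Z] is the orthogonal projection of [w] to the row space of [G]; it is controlled by
   [w *m G^T] alone. *)
pose Z := invmx (G *m G^T) *m G.
have ZG : Z *m G^T = 1%:M by rewrite /Z -mulmxA mulVmx// gram_unit.
have [K K0 KP] := mulmx_bound Z; have [L L0 LP] := mulmx_bound Q.
pose be := (m + 2)%:R * L.
have be0 : 0 < be by rewrite mulr_gt0// ltr0n addn2.
have Bb w z : `|sg * B w z| <= be * (`|w| * `|z|).
  have -> : `|sg * B w z| = `|B w z|.
    rewrite normrM; have -> : `|sg| = 1; last by rewrite mul1r.
    by apply/eqP; rewrite -(@eqrXn2 _ 2)// -normrX sg2 normr1 expr1n.
  rewrite (le_trans (dot_norm _ _))// /be -[leRHS]mulrA ler_wpM2l// mulrA.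
  by rewrite ler_wpM2r.
pose C := (2 * be ^+ 2 / c + be + c / 2) * K ^+ 2.
have C'0 : 0 < 2 * be ^+ 2 / c + be + c / 2.
  by rewrite !addr_gt0// !divr_gt0// mulr_gt0// exprn_gt0.
exists C; first by rewrite mulr_gt0// exprn_gt0.
move=> w; pose e := w *m G^T *m Z; pose z := w - e.
have zG : z *m G^T = 0 by rewrite /z mulmxBl /e -[_ *m Z *m _]mulmxA ZG mulmx1 subrr.
have wze : w = z + e by rewrite /z subrK.
have eK : `|e| <= K * `|w *m G^T| by exact: KP.
clearbody z.
have W : `|w| <= `|z| + `|e| by rewrite {1}wze ler_normD.
have e2 : `|e| ^+ 2 <= K ^+ 2 * `|w *m G^T| ^+ 2.
  by rewrite -exprMn lerXn2r ?nnegrE ?mulr_ge0// ltW.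
have W2 : `|w| ^+ 2 <= 2 * `|z| ^+ 2 + 2 * `|e| ^+ 2.
  apply: (@le_trans _ _ ((`|z| + `|e|) ^+ 2)).
    by rewrite lerXn2r ?nnegrE ?addr_ge0.
  by rewrite -subr_ge0 (_ : _ - _ = (`|z| - `|e|) ^+ 2) ?sqr_ge0//; ring.
have BE : sg * B w w = sg * B z z + 2 * (sg * B z e) + sg * B e e.
  have -> : B w w = B (z + e) (z + e) by rewrite -wze.
  by rewrite BDl !BDr (BC e z); ring.
have B1 : c * `|z| ^+ 2 <= sg * B z z by exact: posB.
have := Bb z e; rewrite ler_norml => /andP[B2 _].
have := Bb e e; rewrite ler_norml => /andP[B3 _].
(* Young's inequality: half of the coercivity on the kernel absorbs the cross term, and the other
   half pays for [c / 4 * |w| ^ 2] through [W2]. *)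
have sq : 0 <= c / 2 * `|z| ^+ 2 - 2 * be * (`|z| * `|e|) + 2 * be ^+ 2 / c * `|e| ^+ 2.
  rewrite (_ : _ + _ = c / 2 * (`|z| - 2 * be / c * `|e|) ^+ 2).
    by rewrite mulr_ge0 ?sqr_ge0// divr_ge0// ltW.
  by field; rewrite gt_eqF.
rewrite -/(B w w) BE.
apply: (@le_trans _ _ (c / 4 * (2 * `|z| ^+ 2 + 2 * `|e| ^+ 2) -
   (2 * be ^+ 2 / c + be + c / 2) * `|e| ^+ 2)).
  apply: lerB; first by rewrite ler_wpM2l// divr_ge0// ltW.
  by rewrite /C -[leRHS]mulrA ler_wpM2l// ltW.
lra.
Qed.

(** A binary form of negative determinant has two independent real null lines. With second
    coordinate 1 they are the roots of [al * x ^ 2 + 2 * be * x + ga]; when [al = 0], one root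
    escapes to infinity and is replaced by the vector [(1, 0)]. *)
Lemma indefinite_on_ker :
  \det Q * \det (G *m invmx Q *m G^T) < 0 ->
  exists a b, [/\ a *m G^T = 0, b *m G^T = 0, dot (a *m Q) a = 0,
     dot (b *m Q) b = 0 & dot (a *m Q) b != 0].
Proof.
have [N [fN NG kN]] := ker_basis fG.
have [e e0 ->] := det_restricted_sign fN NG.
rewrite pmulr_rlt0//; set S := N *m Q *m N^T.
have sS : S^T = S by rewrite /S !trmx_mul trmxK sQ mulmxA.
have S10 : S 1 0 = S 0 1 by rewrite -[in LHS]sS mxE.
rewrite det2 S10; set al := S 0 0; set be := S 0 1; set ga := S 1 1 => dS.
have BS s t : B (s *m N) (t *m N) = dot (s *m S) t by exact: B_restricted.
clearbody S; pose v (x y : R) : 'rV[R]_2 := \row_j if j == 0 then x else y.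
have Bv x y x' y' : B (v x y *m N) (v x' y' *m N) =
    al * x * x' + be * (x * y' + x' * y) + ga * y * y'.
  rewrite BS dotE sum2 !mxE !sum2 !mxE/=.
  by rewrite -/al -/be -/ga S10 -/be; ring.
have kv s : s *m N *m G^T = 0 by rewrite -mulmxA NG mulmx0.
have [al0|al0] := eqVneq al 0.
  have be0 : be != 0.
    by apply/eqP => E; move: dS; rewrite E al0 mul0r mulr0 subrr ltxx.
  exists (v 1 0 *m N), (v (- ga / (2 * be)) 1 *m N).
  by split=> //; rewrite -/(B _ _) Bv al0; [ring|field|rewrite (_ : _ + _ = be)//; ring].
pose D := Num.sqrt (be ^+ 2 - al * ga).
have D2 : D ^+ 2 = be ^+ 2 - al * ga by rewrite sqr_sqrtr//; nra.
exists (v ((- be + D) / al) 1 *m N), (v ((- be - D) / al) 1 *m N).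
have E x : al * x * x + be * (x * 1 + x * 1) + ga * 1 * 1 =
  ((al * x + be) ^+ 2 - (be ^+ 2 - al * ga)) / al by field.
split=> //; rewrite -/(B _ _) Bv ?E -?D2.
- by field.
- by field.
rewrite (_ : _ + _ = (al * ga - be ^+ 2) * 2 / al + (be ^+ 2 - al * ga - D ^+ 2) / al); last by field.
by rewrite D2 subrr mul0r addr0 !mulf_neq0 ?invr_neq0// lt_eqF// expr2.
Qed.

End Restricted.

(** Linearity of the determinant in one row, phrased for a matrix-valued function so that it applies
    to a row placed inside nested [col_mx]. The cofactors along [i0] do not see that row. *)
Lemma det_row_expand n (M : 'rV[R]_n -> 'M[R]_n) i0 :
  (forall u, row i0 (M u) = u) -> (forall u v, row' i0 (M u) = row' i0 (M v)) ->
  forall u, \det (M u) = \sum_j u 0 j * \det (M (ebasis R j)).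
Proof.
move=> rM rM' u.
have cof v w j : cofactor (M v) i0 j = cofactor (M w) i0 j.
  rewrite /cofactor; congr (_ * \det _); apply/matrixP => i l.
  by have /matrixP/(_ i (lift j l)) := rM' v w; rewrite !mxE.
have Mu v j : M v i0 j = v 0 j by rewrite -[in RHS](rM v) mxE.
rewrite (expand_det_row _ i0); apply: eq_bigr => j _; rewrite Mu; congr (_ * _).
rewrite (expand_det_row _ i0) (bigD1 j)//= big1 ?addr0 => [|l /negPf lj].
  by rewrite Mu mxE !eqxx mul1r (cof _ (ebasis R j)).
by rewrite Mu mxE lj andbF mul0r.
Qed.

(** * The bracket as an alternating form on gradients *)

Section Jdet.
Variables (m : nat) (G : 'M[R]_(m, m + 2)).
Implicit Types u v w z a b : 'rV[R]_(m + 2).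

Definition jmx u v : 'M[R]_(m + 2) := col_mx G (col_mx u v).

(** Up to the factor [nu], this is the Poisson bracket of two functions with gradients [u] and [v],
    the rows of [G] being the gradients of the Casimirs. *)
Definition jdet u v : R := \det (jmx u v).

Let i1 : 'I_(m + 2) := rshift m (lshift 1 (0 : 'I_1)).
Let i2 : 'I_(m + 2) := rshift m (rshift 1 (0 : 'I_1)).

Let jmx0 u v k j : jmx u v (lshift 2 k) j = G k j.
Proof. exact: (@col_mxEu _ m (1 + 1)). Qed.

Let jmx1 u v j : jmx u v i1 j = u 0 j.
Proof.
rewrite /jmx (@col_mxEd _ m (1 + 1)); exact: (@col_mxEu _ 1 1).
Qed.

Let jmx2 u v j : jmx u v i2 j = v 0 j.
Proof.
rewrite /jmx (@col_mxEd _ m (1 + 1)); exact: (@col_mxEd _ 1 1).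
Qed.

Let i12 : i1 != i2.
Proof. by rewrite -val_eqE /= eqn_add2l. Qed.

Let ord3 (i : 'I_(m + 2)) : [\/ exists k, i = lshift 2 k, i = i1 | i = i2].
Proof.
case: (split_ordP i) => [k ->|k ->]; first by constructor 1; exists k.
by case: (@split_ordP 1 1 k) => l ->; rewrite (ord1 l); [constructor 2|constructor 3].
Qed.

Lemma jdetEl u v : jdet u v = \sum_j u 0 j * jdet (ebasis R j) v.
Proof.
apply: (@det_row_expand _ (fun u => jmx u v) i1) => [w|w z].
  by apply/rowP => j; rewrite mxE jmx1.
apply/matrixP => i j; rewrite [LHS]mxE [RHS]mxE.
have : lift i1 i != i1 by rewrite eq_sym neq_lift.
have [[k ->] _|->|-> _] := ord3 (lift i1 i); last 2 first.
- by rewrite eqxx.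
- by rewrite !jmx2.
by rewrite !jmx0.
Qed.

Lemma jdetEr u v : jdet u v = \sum_j v 0 j * jdet u (ebasis R j).
Proof.
apply: (@det_row_expand _ (fun v => jmx u v) i2) => [w|w z].
  by apply/rowP => j; rewrite mxE jmx2.
apply/matrixP => i j; rewrite [LHS]mxE [RHS]mxE.
have : lift i2 i != i2 by rewrite eq_sym neq_lift.
have [[k ->] _|-> _|->] := ord3 (lift i2 i); last 2 first.
- by rewrite !jmx1.
- by rewrite eqxx.
by rewrite !jmx0.
Qed.

Lemma jdetDl u u' v : jdet (u + u') v = jdet u v + jdet u' v.
Proof.
rewrite jdetEl (jdetEl u) (jdetEl u') -big_split/=.
by apply: eq_bigr => j _; rewrite mxE mulrDl.
Qed.

Lemma jdetDr u v v' : jdet u (v + v') = jdet u v + jdet u v'.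
Proof.
rewrite jdetEr (jdetEr u v) (jdetEr u v') -big_split/=.
by apply: eq_bigr => j _; rewrite mxE mulrDl.
Qed.

Lemma jdetvv u : jdet u u = 0.
Proof.
by apply: (determinant_alternate i12) => j; rewrite jmx1 jmx2.
Qed.

Lemma jdetC u v : jdet u v = - jdet v u.
Proof.
have := jdetvv (u + v); rewrite jdetDl !jdetDr !jdetvv add0r addr0 => /eqP.
by rewrite addr_eq0 => /eqP.
Qed.

Lemma jdet_rowr k u : jdet u (row k G) = 0.
Proof.
have ki : lshift 2 k != i2.
  by rewrite -val_eqE /= neq_ltn (leq_trans (ltn_ord k))// leq_addr.
apply: (determinant_alternate ki) => j.
by rewrite jmx0 jmx2 mxE.
Qed.

Lemma jdet_rowl k u : jdet (row k G) u = 0.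
Proof. by rewrite jdetC jdet_rowr oppr0. Qed.

(** This is what allows [grad H] to be replaced by [grad F_lam] in the vector field: the two differ
    by a combination of Casimir gradients. *)
Lemma jdet_addr u v (l : 'rV[R]_m) : jdet u (v + l *m G) = jdet u v.
Proof.
rewrite jdetDr (_ : jdet u (l *m G) = 0) ?addr0// mulmx_sum_row.
apply: (big_ind (fun z => jdet u z = 0)).
- by rewrite jdetEr big1// => j _; rewrite mxE mul0r.
- by move=> z w z0 w0; rewrite jdetDr z0 w0 addr0.
move=> k _; rewrite jdetEr.
under eq_bigr do rewrite mxE -mulrA.
by rewrite -mulr_sumr -jdetEr jdet_rowr mulr0.
Qed.

(* The functional [jdet (a *m Q)] kills the rows of G and [a *m Q], which are
   all orthogonal to [a]; hence it is a multiple of [dot a]. *)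
Lemma jdet_null (Q : 'M[R]_(m + 2)) a b : row_free G -> Q^T = Q ->
  a *m G^T = 0 -> b *m G^T = 0 -> dot (a *m Q) a = 0 -> dot (b *m Q) b = 0 ->
  dot (a *m Q) b != 0 ->
  exists2 ka : R, ka != 0 &
    (forall z, jdet (a *m Q) z = ka * dot a z) /\
    (forall z, jdet (b *m Q) z = - ka * dot b z).
Proof.
move=> fG sQ aG bG aa bb ab.
have ba : dot (b *m Q) a = dot (a *m Q) b by rewrite dot_mulmx sQ dotC.
pose M := jmx (a *m Q) (b *m Q).
have uM : M \in unitmx.
  apply: unitmx_inj => w.
  pose l : 'rV[R]_m := lsubmx (w : 'rV[R]_(m + (1 + 1))).
  pose r : 'rV[R]_(1 + 1) := rsubmx (w : 'rV[R]_(m + (1 + 1))).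
  pose r1 := lsubmx r; pose r2 := rsubmx r.
  have wE : w = row_mx l (row_mx r1 r2 : 'rV[R]_(1 + 1)).
    by rewrite /r1 /r2 hsubmxK [RHS]hsubmxK.
  have -> : w *m M = l *m G + (r1 0 0 *: (a *m Q) + r2 0 0 *: (b *m Q)).
    rewrite wE /M /jmx (@mul_row_col _ _ m (1 + 1)) mul_row_col.
    by rewrite {1}[r1]mx11_scalar {1}[r2]mx11_scalar !mul_scalar_mx.
  move=> E.
  (* Pairing the relation with [a] or [b] kills the rows of [G]; since both vectors are null for
     [Q], a single coefficient survives each time. *)
  have key c : c *m G^T = 0 -> r1 0 0 * dot (a *m Q) c + r2 0 0 * dot (b *m Q) c = 0.
    move=> cG; have := congr1 (fun v => dot v c) E.
    by rewrite !dotDl !dotZl dot0l dot_mulmx cG dot0r add0r.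
  have r20 : r2 0 0 = 0.
    by have := key _ aG; rewrite aa mulr0 add0r ba => /eqP; rewrite mulf_eq0 (negPf ab) orbF => /eqP.
  have r10 : r1 0 0 = 0.
    by have := key _ bG; rewrite bb mulr0 addr0 => /eqP; rewrite mulf_eq0 (negPf ab) orbF => /eqP.
  move: E; rewrite r10 r20 !scale0r !addr0 => /eqP; rewrite mulmx_free_eq0// => /eqP lz.
  have r1z : r1 = 0 by rewrite [r1]mx11_scalar r10 raddf0.
  have r2z : r2 = 0 by rewrite [r2]mx11_scalar r20 raddf0.
  by rewrite wE r1z r2z lz !row_mx0.
(* Evaluation at [b *m Q] forces this value; antisymmetry of [jdet] gives the opposite sign for
   [b]. *)
pose ka := jdet (a *m Q) (b *m Q) / dot (a *m Q) b.
have ka0 : ka != 0.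
  by rewrite mulf_neq0 ?invr_neq0// -[jdet _ _]/(\det M) -unitfE -unitmxE.
have lin u (c : 'rV[R]_(m + 2)) z : jdet u z - dot c z = dot (\row_j jdet u (ebasis R j) - c) z.
  rewrite dotBl [in RHS]dotE jdetEr; congr (_ - _).
  by apply: eq_bigr => j _; rewrite mxE mulrC.
have zeroM (c : 'rV[R]_(m + 2)) : (forall k, dot c (row k G) = 0) ->
    dot c (a *m Q) = 0 -> dot c (b *m Q) = 0 -> c = 0.
  move=> cG ca cb; suff : c *m M^T = 0.
    move=> cM; have := congr1 (mulmx^~ (invmx M^T)) cM.
    by rewrite mulmxK ?unitmx_tr// mul0mx.
  have -> : c *m M^T = row_mx (c *m G^T)
      (row_mx (c *m (a *m Q)^T) (c *m (b *m Q)^T) : 'rV[R]_(1 + 1)).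
    by rewrite /M /jmx (@tr_col_mx _ m (1 + 1)) (@mul_mx_row _ _ _ m (1 + 1)) tr_col_mx mul_mx_row.
  have z1 : c *m G^T = 0.
    apply/rowP => k; rewrite mxE [RHS]mxE; apply: etrans (cG k).
    by rewrite dotE; apply: eq_bigr => j _; rewrite !mxE.
  have z2 : c *m (a *m Q)^T = 0 by apply/rowP => j; rewrite ord1 [LHS]ca mxE.
  have z3 : c *m (b *m Q)^T = 0 by apply/rowP => j; rewrite ord1 [LHS]cb mxE.
  by rewrite z1 z2 z3 !row_mx0.
have Grow (c : 'rV[R]_(m + 2)) k : c *m G^T = 0 -> dot c (row k G) = 0.
  move=> /rowP/(_ k); rewrite mxE [RHS]mxE => cGk; apply: etrans cGk; rewrite dotE.
  by apply: eq_bigr => j _; rewrite !mxE.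
have fin u c : (forall k, dot c (row k G) = 0) ->
    jdet u (a *m Q) = dot c (a *m Q) -> jdet u (b *m Q) = dot c (b *m Q) ->
    forall z, jdet u z = dot c z.
  move=> cG ca cb z; apply/eqP; rewrite -subr_eq0 lin; apply/eqP.
  suff -> : \row_j jdet u (ebasis R j) - c = 0 by rewrite dot0l.
  apply: zeroM => [k||]; rewrite -lin ?ca ?cb ?subrr//.
  by rewrite jdet_rowr cG subrr.
exists ka => //; split=> z; rewrite -dotZl; apply: fin => //.
- by move=> k; rewrite dotZl Grow// mulr0.
- by rewrite jdetvv dotZl dotC aa mulr0.
- by rewrite dotZl [dot a _]dotC ba /ka divfK.
- by move=> k; rewrite dotZl Grow// mulr0.
- by rewrite dotZl [dot b _]dotC jdetC mulNr /ka divfK.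
- by rewrite jdetvv dotZl dotC bb mulr0.
Qed.

End Jdet.

End LinearAlgebra.

(** * Common constants for finite families, and a contraction principle *)

Section FiniteFamilies.
Variable R : realType.

Lemma continuous_at_cst (T : topologicalType) (x : T) (c : R) :
  {for x, continuous (fun=> c : R)}.
Proof. exact: cvg_cst. Qed.

Lemma continuous_at_add (T : topologicalType) (x : T) (f g : T -> R) :
  {for x, continuous f} -> {for x, continuous g} ->
  {for x, continuous (fun y => f y + g y)}.
Proof. exact: cvgD. Qed.

Lemma continuous_at_mul (T : topologicalType) (x : T) (f g : T -> R) :
  {for x, continuous f} -> {for x, continuous g} ->
  {for x, continuous (fun y => f y * g y)}.
Proof. exact: cvgM. Qed.

Lemma half_absorb (x a b c : R) : x <= a + b -> a <= x / 2 -> b <= c -> x <= 2 * c.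
Proof. lra. Qed.

Lemma half_le0 (x : R) : x <= x / 2 -> x <= 0.
Proof. lra. Qed.

(** The inverse of 1 plus the sum of the inverses lies below every radius and stays meaningful for
    an empty family, such as the Casimirs when [m = 0]. *)
Lemma fin_common_radius (I : finType) (P : I -> R -> Prop) :
  (forall i d d', 0 < d' -> d' <= d -> P i d -> P i d') ->
  (forall i, exists2 d, 0 < d & P i d) ->
  exists2 d, 0 < d & forall i, P i d.
Proof.
move=> Pmono Pex.
have /choice[d dP] : forall i, exists d, 0 < d /\ P i d.
  by move=> i; have [d d0 Pd] := Pex i; exists d.
have S0 i : 0 <= (d i)^-1 by rewrite invr_ge0 ltW// (dP i).1.
have S1 : 0 < 1 + \sum_i (d i)^-1 by rewrite ltr_wpDr// sumr_ge0.
exists (1 + \sum_i (d i)^-1)^-1; first by rewrite invr_gt0.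
move=> i; apply: Pmono (dP i).2; first by rewrite invr_gt0.
rewrite -[leRHS]invrK lef_pV2 ?posrE ?invr_gt0 ?(dP i).1//.
by rewrite (bigD1 i)//= addrCA lerDl addr_ge0// sumr_ge0.
Qed.

Lemma loclip_family k (I : finType) (f : I -> 'rV[R]_k -> R) x :
  (forall i, loclip x (f i)) -> exists L d : R, [/\ 0 < L, 0 < d &
    forall y z, `|y - x| < d -> `|z - x| < d ->
      forall i, `|f i y - f i z| <= L * `|y - z|].
Proof.
move=> fl; have /choice[L LP] : forall i, exists L, exists d : R,
    [/\ 0 < L, 0 < d & forall y z, `|y - x| < d -> `|z - x| < d ->
     `|f i y - f i z| <= L * `|y - z|] by exact: fl.
have [|i|d d0 dP] := @fin_common_radius I (fun i d => forall y z, `|y - x| < d ->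
  `|z - x| < d -> `|f i y - f i z| <= L i * `|y - z|).
- move=> i d d' _ dd' H y z yd zd; apply: H; exact: lt_le_trans dd'.
- by have [d [_ d0 dP]] := LP i; exists d.
have L0 i : 0 <= L i by have [d' [/ltW]] := LP i.
exists (1 + \sum_i L i), d; split=> //; first by rewrite ltr_wpDr// sumr_ge0.
move=> y z yd zd i; apply: le_trans (dP i y z yd zd) _.
by rewrite ler_wpM2r// (bigD1 i)//= addrCA lerDl addr_ge0// sumr_ge0.
Qed.

Lemma loclip_mulmx k m n (A : 'rV[R]_k -> 'M[R]_(m, n)) x :
  (forall i j, loclip x (fun y => A y i j)) -> exists L d : R, [/\ 0 < L, 0 < d &
    forall y z, `|y - x| < d -> `|z - x| < d ->
      forall w : 'rV[R]_m, `|w *m (A y - A z)| <= L * (`|w| * `|y - z|)].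
Proof.
move=> AL; have [ij|L [d [L0 d0 LP]]] :=
  @loclip_family k ('I_m * 'I_n)%type (fun ij y => A y ij.1 ij.2) x; first exact: AL.
exists (m%:R * L + 1), d; split=> //.
  by rewrite ltr_wpDl// mulr_ge0// ltW.
move=> y z yd zd w; apply: norm_le_coord => [|j].
  by rewrite mulr_ge0// ?mulr_ge0// addr_ge0// mulr_ge0// ltW.
rewrite mxE (le_trans (ler_norm_sum _ _ _))//.
apply: (@le_trans _ _ (\sum_(i < m) L * (`|w| * `|y - z|))).
  apply: ler_sum => i _; rewrite normrM mulrCA ler_pM ?coord_le_norm//.
  by have := LP y z yd zd (i, j); rewrite !mxE.
rewrite sumr_const card_ord -[leLHS]mulr_natl mulrA ler_wpM2r ?mulr_ge0//.
by rewrite lerDl.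
Qed.

Lemma smooth_on_loclip k (D : set 'rV[R]_k) f x :
  open D -> smooth_on D f -> D x -> loclip x f.
Proof. by move=> oD sf Dx; apply: sdiff_lip; exact: smooth_on_sdiff sf Dx. Qed.

(** Column [j] of [hess f x] is the gradient of [partial j f], so strict differentiability of the
    partial derivatives with a common radius is exactly this estimate. *)
Lemma smooth_on_grad_sdiff k (D : set 'rV[R]_k) f x :
  open D -> smooth_on D f -> D x -> forall e : R, 0 < e ->
  exists2 d : R, 0 < d & forall y z, `|y - x| < d -> `|z - x| < d ->
    `|grad f y - grad f z - (y - z) *m hess f x| <= e * `|y - z|.
Proof.
move=> oD sf Dx e e0.
have [|j|d d0 dP] := @fin_common_radius 'I_k (fun j d => forall y z, `|y - x| < d ->
  `|z - x| < d -> `|partial j f y - partial j f z - dot (y - z) (grad (partial j f) x)|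
    <= e * `|y - z|).
- move=> j d d' _ dd' H y z yd zd; apply: H; exact: lt_le_trans dd'.
- by have := smooth_on_sdiff oD (smooth_on_partial j sf) Dx; exact.
exists d => // y z yd zd; apply: norm_le_coord => [|j]; first by rewrite mulr_ge0// ltW.
have := dP j y z yd zd; rewrite dotE !mxE; congr (`| _ - _ | <= _).
by apply: eq_bigr => i _; rewrite !mxE.
Qed.

Lemma half_contraction_fixpoint k (T : 'rV[R]_k -> 'rV[R]_k) x (r : R) :
  (forall y, `|y - x| <= r -> `|T y - x| <= r) -> 0 <= r ->
  (forall y z, `|y - x| <= r -> `|z - x| <= r -> `|T y - T z| <= `|y - z| / 2) ->
  exists2 l, `|l - x| <= r & T l = l.
Proof.
move=> Tr r0 TL; pose u n := iter n T x.
have ur n : `|u n - x| <= r by elim: n => [|n IH]; rewrite ?subrr ?normr0//; exact: Tr.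
have step n : `|u n.+1 - u n| <= `|T x - x| / 2 ^+ n.
  elim: n => [|n IH]; first by rewrite divr1.
  have H := TL _ _ (ur n.+1) (ur n); apply: le_trans H _.
  by rewrite exprSr invfM mulrA ler_pM2r// invr_gt0.
have [l lP] := geometric_limit (normr_ge0 _) step.
have B0 : 0 <= 2 * `|T x - x| by rewrite mulr_ge0.
have lr : `|l - x| <= r.
  apply/ler_addgt0Pr => e e0; have [n nP] := pow2_small B0 e0.
  rewrite -(subrKA (u n)) (le_trans (ler_normD _ _))// addrC lerD//.
  exact: le_trans (lP n) nP.
exists l => //; apply/subr0_eq/normr0_eq0/eqP; rewrite eq_le normr_ge0 andbT.
apply/ler_addgt0Pr => e e0; rewrite add0r; have e20 : 0 < e / 2 by rewrite divr_gt0.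
have [n nP] := pow2_small B0 e20.
have H1 := TL _ _ lr (ur n); have H2 := lP n; have H3 := lP n.+1.
have H4 : 2 * `|T x - x| / 2 ^+ n.+1 <= 2 * `|T x - x| / 2 ^+ n.
  by rewrite ler_wpM2l// lef_pV2 ?posrE ?exprn_gt0// exprSr ler_peMr ?exprn_ge0// ler1n.
rewrite -(subrKA (T (u n))) (le_trans (ler_normD _ _))//.
by rewrite [`|T (u n) - l|]distrC -[T (u n)]/(u n.+1); lra.
Qed.

End FiniteFamilies.

(** * The branch of equilibria *)

Section Continuation.
Variables (R : realType) (m : nat) (Om : set 'rV[R]_(m + 2)).
Variables (C : 'I_m -> 'rV[R]_(m + 2) -> R) (H : 'rV[R]_(m + 2) -> R).
Hypotheses (oOm : open Om) (sC : forall k, smooth_on Om (C k)) (sH : smooth_on Om H).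
Implicit Types (x y z : 'rV[R]_(m + 2)) (lam mu w : 'rV[R]_m).

Lemma iter_partial_Flam lam s x : Om x ->
  iter_partial s (Flam C H lam) x =
  iter_partial s H x + \sum_(k < m) lam 0 k * iter_partial s (C k) x.
Proof.
elim: s x => [//|i s IH] x Omx; rewrite /= /partial.
pose F y := iter_partial s H y + (\sum_(k < m) lam 0 k *: iter_partial s (C k)) y.
(* The induction hypothesis holds on [Om] only, so the two functions are compared near [x]. *)
rewrite (@near_eq_derive _ _ _ _ F); last first.
  have : nbhs x Om by exact: open_nbhs_nbhs.
  apply: filterS => y Omy; rewrite IH// /F fct_sumE; congr (_ + _).
have [dH _] := sH s Omx.
have dC k : is_derive x (ebasis R i) (lam 0 k *: iter_partial s (C k))
    (lam 0 k *: 'D_(ebasis R i) (iter_partial s (C k)) x).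
  by apply: is_deriveZ; apply/derivableP; have [+ _] := sC k s Omx; exact.
have [_ ->] := is_deriveD (derivableP (dH i)) (is_derive_sum dC).
by [].
Qed.

Lemma smooth_on_Flam lam : smooth_on Om (Flam C H lam).
Proof.
move=> s x Omx.
pose F y := iter_partial s H y + (\sum_(k < m) lam 0 k *: iter_partial s (C k)) y.
have FE : \forall y \near x, F y = iter_partial s (Flam C H lam) y.
  have : nbhs x Om by exact: open_nbhs_nbhs.
  by apply: filterS => y Omy; rewrite iter_partial_Flam// /F fct_sumE.
split=> [i|].
  apply: near_eq_derivable FE _; apply: derivableD; first by have [] := sH s Omx.
  apply: derivable_sum => k; apply: derivableZ.
  by have [+ _] := sC k s Omx; exact.
apply/continuous_epsP => e e0.
have cF : {for x, continuous F}.
  apply: continuousD; first by have [] := sH s Omx.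
  rewrite fct_sumE; apply: (@closed_sum R _ (fun f => {for x, continuous f})).
  - exact: continuous_at_cst.
  - exact: continuous_at_add.
  move=> k; apply: continuous_at_mul; first exact: continuous_at_cst.
  by have [] := sC k s Omx.
have /continuous_epsP/(_ _ e0)[d d0 dP] := cF.
have /near_epsP[d' d'0 d'P] := FE.
exists (Num.min d d'); first by rewrite lt_min d0.
move=> y; rewrite lt_min => /andP[yd yd'].
by rewrite -!d'P//; [exact: dP|rewrite subrr normr0].
Qed.

Lemma grad_Flam lam x : Om x ->
  grad (Flam C H lam) x = grad H x + lam *m gradC C x.
Proof.
move=> Omx; apply/rowP => j; rewrite !mxE; have /= -> := iter_partial_Flam lam [:: j] Omx.
by congr (_ + _); apply: eq_bigr => k _; rewrite !mxE.
Qed.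

Lemma hess_Flam_sym lam x : Om x ->
  (hess (Flam C H lam) x)^T = hess (Flam C H lam) x.
Proof. exact: hess_sym oOm (smooth_on_Flam lam) x. Qed.

Lemma gradC_loclip x i j : Om x -> loclip x (fun y => gradC C y i j).
Proof.
move=> Omx; under eq_fun do rewrite !mxE.
exact: smooth_on_loclip oOm (smooth_on_partial j (sC i)) Omx.
Qed.

Section Branch.
Variables (xe : 'rV[R]_(m + 2)) (lame : 'rV[R]_m).
Hypotheses (Omxe : Om xe) (ge0 : grad (Flam C H lame) xe = 0).
Hypothesis (uQ : hess (Flam C H lame) xe \in unitmx).

(* Fixed points of [x |-> x - grad F_lam(x) (Hess F_lame(xe))^-1], a
   1/2-contraction near [xe] for [lam] near [lame]. *)
Lemma continuous_branch : exists (rho L : R) (xb : 'rV[R]_m -> 'rV[R]_(m + 2)),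
  [/\ 0 < rho, 0 < L, xb lame = xe &
   forall lam, `|lam - lame| < rho ->
     [/\ Om (xb lam), grad (Flam C H lam) (xb lam) = 0 &
      forall mu, `|mu - lame| < rho -> `|xb lam - xb mu| <= L * `|lam - mu|]].
Proof.
pose Q := hess (Flam C H lame) xe; have uQ' : Q \in unitmx by exact: uQ.
have [K K0 KP] := mulmx_bound (invmx Q).
have e0 : 0 < (4 * K)^-1 by rewrite invr_gt0 mulr_gt0.
have [d1 d10 d1P] := smooth_on_grad_sdiff oOm (smooth_on_Flam lame) Omxe e0.
have [i j|L [d2 [L0 d20 LP]]] := @loclip_mulmx _ _ _ _ (gradC C) xe.
  exact: gradC_loclip.
have [K2 K20 K2P] := mulmx_bound (gradC C xe).
have /near_epsP[d3 d30 d3P] : nbhs xe Om by exact: open_nbhs_nbhs.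
pose d := Num.min d1 (Num.min d2 d3); pose r := d / 2.
have d0 : 0 < d by rewrite !lt_min d10 d20.
have r0 : 0 < r by rewrite divr_gt0.
have rd : r < d by rewrite ltr_pdivrMr// ltr_pMr// ltr1n.
have nd x : `|x - xe| <= r -> [/\ `|x - xe| < d1, `|x - xe| < d2 & Om x].
  move=> xr; have : `|x - xe| < d by exact: le_lt_trans xr rd.
  by rewrite !lt_min => /and3P[H1 H2 H3]; split=> //; exact: d3P.
pose T lam x := x - grad (Flam C H lam) x *m invmx Q.
pose M := K2 + L * r; have M0 : 0 < M by rewrite addr_gt0// mulr_gt0.
have GM w x : `|x - xe| <= r -> `|w *m gradC C x| <= M * `|w|.
  move=> xr; have [_ xd2 _] := nd x xr.
  have -> : w *m gradC C x = w *m gradC C xe + w *m (gradC C x - gradC C xe).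
    by rewrite mulmxBr addrC subrK.
  rewrite (le_trans (ler_normD _ _))// mulrDl lerD//.
  have xe2 : `|xe - xe| < d2 by rewrite subrr normr0.
  apply: le_trans (LP _ _ xd2 xe2 w) _.
  by rewrite -mulrA ler_pM2l// mulrC ler_wpM2r.
have Flin lam mu x : Om x ->
    grad (Flam C H lam) x = grad (Flam C H mu) x + (lam - mu) *m gradC C x.
  by move=> Omx; rewrite !grad_Flam// mulmxBl -[RHS]addrA [mu *m _ + _]addrC subrK.
have TT lam mu x : `|x - xe| <= r -> `|T lam x - T mu x| <= K * M * `|lam - mu|.
  move=> xr; have [_ _ Omx] := nd x xr.
  have -> : T lam x - T mu x = - ((lam - mu) *m gradC C x *m invmx Q).
    rewrite /T (Flin lam mu)// mulmxDl.
    move: (grad _ _ *m _) (_ *m gradC C x *m _) => a b.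
    by apply/rowP => j; rewrite !mxE; ring.
  by rewrite normrN (le_trans (KP _))// -mulrA ler_pM2l// GM.
(* The first bound limits the contribution of [lam - lame] to the Lipschitz constant of [T lam] to
   1/4, the other 1/4 coming from [d1P]; the second makes [T lam] move [xe] by at most [r / 2]. *)
pose rho := Num.min (4 * K * L)^-1 (r / (2 * (K * M))).
have rho0 : 0 < rho.
  rewrite lt_min; apply/andP; split; first by rewrite invr_gt0 !mulr_gt0.
  by rewrite divr_gt0// !mulr_gt0.
have TL lam y z : `|lam - lame| < rho -> `|y - xe| <= r -> `|z - xe| <= r ->
    `|T lam y - T lam z| <= `|y - z| / 2.
  rewrite lt_min => /andP[lr _] yr zr.
  have [yd1 yd2 Omy] := nd y yr; have [zd1 zd2 Omz] := nd z zr.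
  pose A := grad (Flam C H lame) y - grad (Flam C H lame) z - (y - z) *m Q.
  pose B := (lam - lame) *m (gradC C y - gradC C z).
  have -> : T lam y - T lam z = - ((A + B) *m invmx Q).
    rewrite /T (Flin lam lame y)// (Flin lam lame z)// /A /B mulmxBr.
    rewrite !(mulmxDl, mulNmx, mulmxK uQ').
    move: (grad _ y *m _) (grad _ z *m _) (_ *m gradC C y *m _) (_ *m gradC C z *m _).
    by move=> a b c a'; apply/rowP => j; rewrite !mxE; ring.
  rewrite normrN (le_trans (KP _))//.
  have HA : `|A| <= (4 * K)^-1 * `|y - z| by exact: d1P.
  have HB : `|B| <= L * ((4 * K * L)^-1 * `|y - z|).
    by apply: le_trans (LP y z yd2 zd2 _) _; rewrite ler_pM2l// ler_wpM2r// ltW.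
  apply: (@le_trans _ _ (K * ((4 * K)^-1 * `|y - z| + L * ((4 * K * L)^-1 * `|y - z|)))).
    by rewrite ler_pM2l// (le_trans (ler_normD _ _))// lerD.
  by rewrite le_eqVlt; apply/orP; left; apply/eqP; field; rewrite !gt_eqF.
have xer : `|xe - xe| <= r by rewrite subrr normr0 ltW.
have Txe : T lame xe = xe by rewrite /T ge0 mul0mx subr0.
have fix_ex lam : `|lam - lame| < rho -> exists2 x, `|x - xe| <= r & T lam x = x.
  move=> lr; apply: half_contraction_fixpoint (ltW r0) _; last by move=> y z; exact: TL.
  move=> y yr; rewrite -(subrKA (T lam xe)) (le_trans (ler_normD _ _))//.
  rewrite [leRHS]splitr lerD//.
    by apply: le_trans (TL lam y xe lr yr xer) _; rewrite ler_pM2r// invr_gt0.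
  rewrite -[X in `|_ - X|]Txe (le_trans (TT _ _ _ xer))//.
  move: lr; rewrite lt_min => /andP[_ lr].
  rewrite mulrC -ler_pdivlMr ?mulr_gt0//; apply: le_trans (ltW lr) _.
  by rewrite le_eqVlt; apply/orP; left; apply/eqP; field; rewrite !gt_eqF.
have /choice[xb xbP] : forall lam, exists x, `|lam - lame| < rho ->
    `|x - xe| <= r /\ T lam x = x.
  move=> lam; have [lr|nlr] := boolP (`|lam - lame| < rho); last by exists xe.
  by have [x xr xT] := fix_ex lam lr; exists x.
have lame_rho : `|lame - lame| < rho by rewrite subrr normr0.
(* The contraction absorbs half of the distance between two fixed points. The resulting Lipschitz
   bound, stronger than continuity, is what differentiating the branch relies on. *)
have lipb lam mu : `|lam - lame| < rho -> `|mu - lame| < rho ->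
    `|xb lam - xb mu| <= 2 * (K * M) * `|lam - mu|.
  move=> lr mr; have [xlr xlT] := xbP _ lr; have [xmr xmT] := xbP _ mr.
  have H1 := TL lam _ _ lr xlr xmr; have H2 := TT lam mu _ xmr.
  have H3 : `|xb lam - xb mu| <= `|T lam (xb lam) - T lam (xb mu)| + `|T lam (xb mu) - T mu (xb mu)|.
    have := ler_normD (T lam (xb lam) - T lam (xb mu)) (T lam (xb mu) - T mu (xb mu)).
    by rewrite subrKA xlT xmT.
  by rewrite -mulrA; exact: half_absorb H3 H1 H2.
exists rho, (2 * (K * M)), xb; split=> //; first by rewrite !mulr_gt0.
  have [xr xT] := xbP _ lame_rho.
  have := TL lame _ _ lame_rho xr xer; rewrite xT Txe => h.
  by apply/subr0_eq/normr0_eq0/eqP; rewrite eq_le normr_ge0 andbT; exact: half_le0.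
move=> lam lr; have [xr xT] := xbP _ lr; have [_ _ Omx] := nd _ xr.
split=> //; last by move=> mu mr; exact: lipb.
move: xT; rewrite /T => /eqP; rewrite -subr_eq0 addrAC subrr sub0r oppr_eq0 => /eqP E.
by rewrite -[LHS](mulmxKV uQ') E mul0mx.
Qed.

End Branch.

End Continuation.

Lemma continuous_at_inv (R : realType) (T : topologicalType) (x : T) (f : T -> R) :
  f x != 0 -> {for x, continuous f} -> {for x, continuous (fun y => (f y)^-1)}.
Proof. by move=> fx cf; exact: cvgV. Qed.

(** * Smoothness of the branch *)

Section SmoothBranch.
Variables (R : realType) (m : nat) (Om : set 'rV[R]_(m + 2)).
Variables (C : 'I_m -> 'rV[R]_(m + 2) -> R) (H : 'rV[R]_(m + 2) -> R).
Hypotheses (oOm : open Om) (sC : forall k, smooth_on Om (C k)) (sH : smooth_on Om H).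
Variables (lame : 'rV[R]_m) (rho L : R) (xb : 'rV[R]_m -> 'rV[R]_(m + 2)).
Hypotheses (rho0 : 0 < rho) (L0 : 0 < L).
Hypothesis branchP : forall lam, `|lam - lame| < rho ->
     [/\ Om (xb lam), grad (Flam C H lam) (xb lam) = 0 &
      forall mu, `|mu - lame| < rho -> `|xb lam - xb mu| <= L * `|lam - mu|].
Implicit Types (x y z : 'rV[R]_(m + 2)) (lam mu w : 'rV[R]_m).

(* A class of functions stable under partial derivatives, which therefore
   consists of smooth functions: this avoids any formula for the higher
   derivatives of [xb]. *)
Inductive branch_fun : ('rV[R]_m -> R) -> Prop :=
| branch_cst c : branch_fun (fun=> c)
| branch_param k : branch_fun (fun lam => lam 0 k)
| branch_coord j : branch_fun (fun lam => xb lam 0 j)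
| branch_comp h : smooth_on Om h -> branch_fun (fun lam => h (xb lam))
| branch_add f g : branch_fun f -> branch_fun g -> branch_fun (fun lam => f lam + g lam)
| branch_mul f g : branch_fun f -> branch_fun g -> branch_fun (fun lam => f lam * g lam)
| branch_inv f : branch_fun f -> (forall lam, `|lam - lame| < rho -> f lam != 0) ->
    branch_fun (fun lam => (f lam)^-1).

(** The Hessian of [F_lam] along the branch, with [lam] pulled out of the derivatives so that every
    entry is built from the constructors of [branch_fun]. *)
Definition branch_hess lam : 'M[R]_(m + 2) :=
  \matrix_(i, j) (partial i (partial j H) (xb lam) +
    \sum_(k < m) lam 0 k * partial i (partial j (C k)) (xb lam)).

Lemma branch_hessE lam : `|lam - lame| < rho ->
  hess (Flam C H lam) (xb lam) = branch_hess lam.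
Proof.
move=> /branchP[Omx _ _]; apply/matrixP => i j; rewrite !mxE.
exact: (iter_partial_Flam oOm sC sH lam [:: i; j] Omx).
Qed.

Lemma branch_gradC_fun i j : branch_fun (fun lam => gradC C (xb lam) i j).
Proof.
under eq_fun do rewrite !mxE.
exact/(branch_comp (h := partial j (C i)))/smooth_on_partial.
Qed.

Lemma branch_hess_fun i j : branch_fun (fun lam => branch_hess lam i j).
Proof.
under eq_fun do rewrite mxE.
apply: branch_add.
  by apply: (branch_comp (h := partial i (partial j H))); do 2 apply: smooth_on_partial.
apply: (closed_sum branch_cst branch_add) => k.
apply: branch_mul; first exact: branch_param.
by apply: (branch_comp (h := partial i (partial j (C k)))); do 2 apply: smooth_on_partial.
Qed.

Lemma branch_continuous lam : `|lam - lame| < rho -> {for lam, continuous xb}.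
Proof.
move=> lr; apply/continuous_epsP => e e0.
have [_ _ LP] := branchP lr.
exists (Num.min (rho - `|lam - lame|) (e / L)).
  by rewrite lt_min subr_gt0 lr divr_gt0.
move=> mu; rewrite lt_min => /andP[mu1 mu2]; rewrite distrC.
apply: le_trans (LP mu _) _.
  rewrite -(subrKA lam) (le_lt_trans (ler_normD _ _))//; lra.
by rewrite distrC mulrC -ler_pdivlMr// ltW.
Qed.

Lemma branch_fun_continuous f lam : branch_fun f -> `|lam - lame| < rho ->
  {for lam, continuous f}.
Proof.
move=> bf lr; elim: bf => {f}.
- exact: continuous_at_cst.
- by move=> k; exact: coord_continuous.
- move=> j; apply: (@continuous_comp _ _ _ xb (fun M : 'rV[R]_(m + 2) => M 0 j)).
    exact: branch_continuous.
  exact: coord_continuous.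
- move=> h sh; apply: (@continuous_comp _ _ _ xb h); first exact: branch_continuous.
  by have [Omx _ _] := branchP lr; exact: smooth_on_continuous sh Omx.
- by move=> f g _ cf _ cg; exact: continuous_at_add.
- by move=> f g _ cf _ cg; exact: continuous_at_mul.
- by move=> f _ cf f0; apply: continuous_at_inv cf; exact: f0.
Qed.

Lemma branch_fun_pos f : branch_fun f -> 0 < f lame ->
  exists2 r, 0 < r & r <= rho /\ forall lam, `|lam - lame| < r -> 0 < f lam.
Proof.
move=> bf f0; have lr : `|lame - lame| < rho by rewrite subrr normr0.
have /continuous_epsP cf := branch_fun_continuous bf lr.
have f20 : 0 < f lame / 2 by rewrite divr_gt0.
have [d d0 dP] := cf _ f20; exists (Num.min d rho); first by rewrite lt_min d0.
split; first by rewrite ge_min lexx orbT.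
move=> lam; rewrite lt_min => /andP[/dP + _]; rewrite ler_norml => /andP[]; lra.
Qed.

Lemma branch_fun_neq0 f : branch_fun f -> f lame != 0 ->
  exists2 r, 0 < r & r <= rho /\ forall lam, `|lam - lame| < r -> f lam != 0.
Proof.
move=> bf f0.
have [|r r0 [rr rP]] := branch_fun_pos (branch_mul bf bf).
  by rewrite -expr2 exprn_even_gt0.
exists r => //; split=> // lam /rP; apply: contraTneq => ->.
by rewrite mulr0 ltxx.
Qed.

Hypothesis uQ : forall lam, `|lam - lame| < rho -> branch_hess lam \in unitmx.

(** Cramer's formula exhibits the entries of the inverse as polynomials divided by a nonvanishing
    function, hence as members of [branch_fun]. *)
Definition branch_inv_hess lam : 'M[R]_(m + 2) :=
  (\det (branch_hess lam))^-1 *: \adj (branch_hess lam).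

Lemma branch_inv_hessE lam : `|lam - lame| < rho ->
  invmx (branch_hess lam) = branch_inv_hess lam.
Proof. by move=> /uQ uH; rewrite /invmx uH. Qed.

Lemma branch_inv_hess_fun i j : branch_fun (fun lam => branch_inv_hess lam i j).
Proof.
under eq_fun do rewrite mxE.
apply: branch_mul; last exact: (closed_adj branch_cst branch_add branch_mul branch_hess_fun).
apply: branch_inv; first exact: (closed_det branch_cst branch_add branch_mul branch_hess_fun).
by move=> lam /uQ; rewrite unitmxE unitfE.
Qed.

(** The solution [v] of [v *m Hess + w *m gradC = 0], obtained by differentiating
    [grad F_lam (xb lam) = 0] in the direction [w]. *)
Definition branch_velocity w lam : 'rV[R]_(m + 2) :=
  - (w *m gradC C (xb lam) *m branch_inv_hess lam).

Lemma branch_velocity_fun w j : branch_fun (fun lam => branch_velocity w lam 0 j).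
Proof.
rewrite (_ : (fun _ => _) =
  fun lam => -1 * (w *m gradC C (xb lam) *m branch_inv_hess lam) 0 j); last first.
  by apply/funext => lam; rewrite mxE mulN1r.
apply: branch_mul; first exact: branch_cst.
apply: (closed_mulmx branch_cst branch_add branch_mul) => [i l|]; last exact: branch_inv_hess_fun.
apply: (closed_mulmx branch_cst branch_add branch_mul) => [? ?|]; first exact: branch_cst.
exact: branch_gradC_fun.
Qed.

Lemma branch_derive w lam : `|lam - lame| < rho ->
  is_derive lam w xb (branch_velocity w lam).
Proof.
move=> lr; apply/is_derive_epsP => e e0.
have [Omx gx LP] := branchP lr; set x := xb lam in Omx gx LP *.
pose Q := branch_hess lam; have uQl : Q \in unitmx := uQ lr.
have [K K0 KP] := mulmx_bound (invmx Q).
have w1 : 0 < `|w| + 1 by rewrite ltr_wpDl.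
pose M := 2 * K * L * (`|w| + 1).
have M0 : 0 < M by rewrite !mulr_gt0.
have e1 : 0 < e / M by rewrite divr_gt0.
have [d1 d10 d1P] := smooth_on_grad_sdiff oOm (smooth_on_Flam oOm sC sH lam) Omx e1.
have [i j|L2 [d2 [L20 d20 L2P]]] := @loclip_mulmx _ _ _ _ (gradC C) x.
  exact: (gradC_loclip oOm sC i j Omx).
have /near_epsP[d3 d30 d3P] : nbhs x Om by exact: open_nbhs_nbhs.
pose N := L * (`|w| + 1).
have N0 : 0 < N by rewrite mulr_gt0.
pose N' := 2 * K * L2 * (`|w| + 1) * N.
have N'0 : 0 < N' by rewrite !mulr_gt0.
(* Since [|y - x| <= N * |h|], the first three radii bring [y] within [d1], [d2], [d3] of [x]; the
   fourth keeps [mu] in the parameter ball, and the last makes the quadratic error at most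
   [e / 2 * |h|]. *)
pose d := Num.min (Num.min (d1 / N) (d2 / N)) (Num.min (d3 / N)
   (Num.min ((rho - `|lam - lame|) / (`|w| + 1)) (e / N'))).
exists d.
  by rewrite !lt_min !divr_gt0// subr_gt0.
move=> h; rewrite !lt_min => /andP[/andP[h1 h2] /and3P[h3 h4 h5]].
pose mu := h *: w + lam; pose y := xb mu.
have mu_lam : mu - lam = h *: w by rewrite /mu addrK.
have nhw : `|h *: w| <= `|h| * (`|w| + 1) by rewrite normrZ ler_wpM2l// lerDl.
have mur : `|mu - lame| < rho.
  rewrite -(subrKA lam) mu_lam (le_lt_trans (ler_normD _ _))//.
  by move: h4; rewrite ltr_pdivlMr// => h4; lra.
have [Omy gy _] := branchP mur; rewrite -/y in Omy gy.
have yx : `|y - x| <= N * `|h|.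
  rewrite distrC (le_trans (LP _ mur))// distrC mu_lam /N -mulrA ler_pM2l//.
  by rewrite mulrC.
have ylt r : `|h| < r / N -> `|y - x| < r.
  by move=> hr; apply: le_lt_trans yx _; rewrite mulrC -ltr_pdivlMr.
have xx r : 0 < r -> `|x - x| < r by rewrite subrr normr0.
pose A := grad (Flam C H lam) y - grad (Flam C H lam) x - (y - x) *m Q.
have HA : `|A| <= e / M * `|y - x|.
  by rewrite /A /Q -branch_hessE//; apply: d1P; [exact: ylt|exact: xx].
pose B := (h *: w) *m (gradC C y - gradC C x).
have HB : `|B| <= L2 * (`|h *: w| * `|y - x|) by apply: L2P; [exact: ylt|exact: xx].
(* Subtracting the critical point equations at [lam] and [mu] leaves two errors: [A], from
   linearizing [grad F_lam], is [o(h)], and [B], from the variation of [gradC], is of second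
   order. *)
have -> : xb (h *: w + lam) - x - h *: branch_velocity w lam = - ((A + B) *m invmx Q).
  rewrite -/mu -/y /branch_velocity -branch_inv_hessE// -/Q -/x.
  rewrite scalerN opprK scalemxAl scalemxAl.
  have : grad (Flam C H lam) y = - ((h *: w) *m gradC C y).
    have E2 := grad_Flam oOm sC sH mu Omy; rewrite gy in E2.
    have E3 : grad H y = - (mu *m gradC C y) by apply/eqP; rewrite -addr_eq0 -E2.
    by rewrite (grad_Flam oOm sC sH lam Omy) E3 /mu mulmxDl opprD subrK.
  rewrite /A gx => ->; rewrite subr0 /B mulmxBr !(mulmxDl, mulNmx, mulmxK uQl).
  move: (_ *m gradC C x *m _) (_ *m gradC C y *m _) => a b.
  by apply/rowP => j; rewrite !mxE; ring.
rewrite normrN (le_trans (KP _))//.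
have HA' : `|A| <= e / M * (N * `|h|).
  by apply: le_trans HA _; rewrite ler_pM2l.
have HB' : `|B| <= L2 * (`|h| * (`|w| + 1) * (N * `|h|)).
  by apply: le_trans HB _; rewrite ler_pM2l// ler_pM.
have HB2 : L2 * (`|h| * (`|w| + 1) * (N * `|h|)) <= L2 * (`|h| * (`|w| + 1) * (N * (e / N'))).
  by rewrite ler_pM2l// ler_wpM2l ?mulr_ge0 ?(ltW w1)// ler_pM2l// ltW.
apply: (@le_trans _ _ (K * (e / M * (N * `|h|) + L2 * (`|h| * (`|w| + 1) * (N * (e / N')))))).
  by rewrite ler_pM2l// (le_trans (ler_normD _ _))// lerD// (le_trans HB').
rewrite le_eqVlt; apply/orP; left; apply/eqP; rewrite /M /N' /N; field.
by rewrite !gt_eqF.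
Qed.

Lemma branch_fun_derive f w : branch_fun f -> exists2 g, branch_fun g &
  forall lam, `|lam - lame| < rho -> is_derive lam w f (g lam).
Proof.
elim=> {f}.
- by move=> c; exists (fun=> 0); [exact: branch_cst|move=> lam _; exact: is_derive_cst].
- move=> k; exists (fun=> w 0 k); first exact: branch_cst.
  by move=> lam _; exact: (is_derive_coord k (is_derive_id lam w)).
- move=> j; exists (fun lam => branch_velocity w lam 0 j); first exact: branch_velocity_fun.
  by move=> lam lr; apply: is_derive_coord; exact: branch_derive.
- move=> h sh.
  exists (fun lam => \sum_j branch_velocity w lam 0 j * partial j h (xb lam)).
    apply: (closed_sum branch_cst branch_add) => j.
    apply: branch_mul; first exact: branch_velocity_fun.
    exact/(branch_comp (h := partial j h))/smooth_on_partial.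
  move=> lam lr; have [Omx _ _] := branchP lr.
  have := is_derive_comp_sdiff (branch_derive w lr) (smooth_on_sdiff oOm sh Omx).
  by rewrite dotE; under eq_bigr do rewrite [grad _ _ _ _]mxE.
- move=> f g _ [f' bf' df'] _ [g' bg' dg'].
  exists (fun lam => f' lam + g' lam); first exact: branch_add.
  by move=> lam lr; exact: (is_deriveD (df' lam lr) (dg' lam lr)).
- move=> f g bf [f' bf' df'] bg [g' bg' dg'].
  exists (fun lam => f lam * g' lam + g lam * f' lam).
    by apply: branch_add; exact: branch_mul.
  by move=> lam lr; exact: (is_deriveM (df' lam lr) (dg' lam lr)).
- move=> f bf [f' bf' df'] f0.
  exists (fun lam => -1 * ((f lam)^-1 * (f lam)^-1 * f' lam)).
    apply: branch_mul; first exact: branch_cst.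
    by apply: branch_mul => //; apply: branch_mul; exact: branch_inv.
  move=> lam lr; have [fd fE] := df' lam lr; apply: DeriveDef.
    by apply: derivableV fd; exact: f0.
  rewrite deriveV//; last exact: f0.
  by rewrite fE -[LHS]/(_ * _) mulN1r mulNr -invfM expr2.
Qed.

Lemma branch_fun_smooth f : branch_fun f -> smooth_on [set lam | `|lam - lame| < rho] f.
Proof.
have near_ball lam (P : 'rV[R]_m -> Prop) : `|lam - lame| < rho ->
    (forall mu, `|mu - lame| < rho -> P mu) -> nbhs lam P.
  move=> lr PP; apply/near_epsP; exists (rho - `|lam - lame|); first by rewrite subr_gt0.
  by move=> mu mr; apply: PP; rewrite -(subrKA lam) (le_lt_trans (ler_normD _ _))//; lra.
move=> bf s; have [g bg gP] : exists2 g, branch_fun g &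
    forall lam, `|lam - lame| < rho -> iter_partial s f lam = g lam.
  elim: s => [|i s [g bg gP]]; first by exists f.
  have [g' bg' dg'] := branch_fun_derive (ebasis R i) bg.
  exists g' => // lam lr; rewrite /= /partial.
  rewrite (@near_eq_derive _ _ _ _ g); first by case: (dg' lam lr).
  exact: near_ball.
move=> lam lr; have E : nbhs lam [set mu | g mu = iter_partial s f mu].
  by apply: near_ball => // mu /gP.
split=> [i|].
  apply: (near_eq_derivable (f := g) E); have [g' _ /(_ lam lr)[]] := branch_fun_derive (ebasis R i) bg.
  by [].
apply/continuous_epsP => e e0.
have /continuous_epsP/(_ _ e0)[d d0 dP] := branch_fun_continuous bg lr.
have /near_epsP[d' d'0 d'P] := E.
exists (Num.min d d'); first by rewrite lt_min d0.
move=> y; rewrite lt_min => /andP[yd yd'].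
by rewrite -!d'P//; [exact: dP|rewrite subrr normr0].
Qed.

End SmoothBranch.

(** * Stability *)

Section Trapping.
Variable R : realType.

(** The time sought is the infimum of those with [r <= h t]; continuity excludes both strict
    inequalities there. *)
Lemma first_exit (h : R -> R) (T r : R) : 0 <= T ->
  (forall t, 0 <= t <= T -> {for t, continuous h}) -> h 0 < r -> r <= h T ->
  exists2 t1, 0 <= t1 <= T & h t1 = r /\ forall s, 0 <= s <= t1 -> h s <= r.
Proof.
move=> T0 hc h0 hT; pose A := [set t | 0 <= t <= T /\ r <= h t].
have AT : A T by split=> //; rewrite T0 lexx.
have lA : lbound A 0 by move=> t [/andP[]].
have iA : has_inf A by split; [exists T|exists 0].
pose t1 := inf A.
have t10 : 0 <= t1 by apply: lb_le_inf => //; exists T.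
have t1T : t1 <= T by apply: ge_inf => //; exists 0.
have low s : 0 <= s -> s < t1 -> h s < r.
  move=> s0 st; rewrite ltNge; apply/negP => rs; move: (st); apply/negP; rewrite -leNgt.
  apply: ge_inf; first by exists 0.
  by split=> //; rewrite s0 (le_trans (ltW st)).
have t1c : 0 <= t1 <= T by rewrite t10.
have /continuous_epsP hc1 := hc t1 t1c.
have ht1 : h t1 = r.
  apply/eqP; rewrite eq_le; apply/andP; split.
    rewrite leNgt; apply/negP => rh.
    have t1p : 0 < t1.
      rewrite lt_neqAle t10 andbT; apply: contraTneq rh => <-.
      by rewrite -leNgt ltW.
    have e0 : 0 < (h t1 - r) / 2 by rewrite divr_gt0// subr_gt0.
    have [d d0 dP] := hc1 _ e0.
    pose s := t1 - Num.min d t1 / 2.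
    have m0 : 0 < Num.min d t1 by rewrite lt_min d0.
    have md : Num.min d t1 <= d by rewrite ge_min lexx.
    have mt : Num.min d t1 <= t1 by rewrite ge_min lexx orbT.
    have s0 : 0 <= s by rewrite /s; lra.
    have st : s < t1 by rewrite /s; lra.
    have sd : `|s - t1| < d by rewrite /s ltr_norml; apply/andP; split; lra.
    have := dP _ sd; have := low _ s0 st; rewrite ler_norml => + /andP[]; lra.
  rewrite leNgt; apply/negP => hr.
  have e0 : 0 < (r - h t1) / 2 by rewrite divr_gt0// subr_gt0.
  have [d d0 dP] := hc1 _ e0.
  have [s [/andP[s0 sT] rs] sd] := inf_adherent d0 iA.
  have st : t1 <= s.
    by apply: ge_inf; [exists 0|split=> //; rewrite s0].
  have sd' : `|s - t1| < d.
    by rewrite ger0_norm ?subr_ge0// ltrBlDl.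
  have := dP _ sd'; rewrite ler_norml => /andP[]; lra.
exists t1 => //; split=> // s /andP[s0]; rewrite le_eqVlt => /orP[/eqP->|st].
  by rewrite ht1.
by rewrite ltW// low.
Qed.

(** At the first exit [W] would have to reach [w]. Conservation is demanded only up to a time before
    which the curve stays in the ball, because a solution of the retracted equation is known to
    follow the original field only there. *)
Lemma trapped k (phi : R -> 'rV[R]_k) (xe : 'rV[R]_k) (W : 'rV[R]_k -> R) (r w T : R) :
  (forall x, `|x - xe| = r -> w <= W x) -> 0 <= T ->
  (forall t, 0 <= t <= T -> {for t, continuous phi}) ->
  `|phi 0 - xe| < r -> W (phi 0) < w ->
  (forall t1, 0 <= t1 <= T -> (forall s, 0 <= s <= t1 -> `|phi s - xe| <= r) ->
     W (phi t1) = W (phi 0)) ->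
  `|phi T - xe| < r.
Proof.
move=> Wr T0 cphi p0 W0 cons; rewrite ltNge; apply/negP => rT.
have [t tT|t1 t1T [E low]] := @first_exit (fun t => `|phi t - xe|) T r T0 _ p0 rT.
  apply/continuous_epsP => e e0.
  have /continuous_epsP/(_ _ e0)[d d0 dP] := cphi t tT.
  exists d => // s /dP; apply: le_trans; apply: le_trans (ler_dist_dist _ _) _.
  by rewrite opprB addrA subrK.
by have := Wr _ E; rewrite (cons _ t1T low) leNgt W0.
Qed.

(** Taylor's formula by monotonicity along the segment: [g1] and [g2] are the two signs of the
    remainder plus a linear term whose slope dominates the error on the derivative. *)
Lemma quadratic_taylor k (D : set 'rV[R]_k) (f : 'rV[R]_k -> R) x :
  open D -> smooth_on D f -> D x -> grad f x = 0 -> forall e, 0 < e ->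
  exists2 d, 0 < d & forall w, `|w| < d ->
    `|f (x + w) - f x - dot (w *m hess f x) w / 2| <= e * `|w| ^+ 2.
Proof.
move=> oD sf Dx gx e e0.
(* The divisor compensates the factor [k] in [dot_norm], the price of the sup norm; the successor
   covers [k = 0]. *)
have e1 : 0 < e / k.+1%:R by rewrite divr_gt0.
have [d1 d10 d1P] := smooth_on_grad_sdiff oD sf Dx e1.
have /near_epsP[d2 d20 d2P] : nbhs x D by exact: open_nbhs_nbhs.
exists (Num.min d1 d2); first by rewrite lt_min d10.
move=> w; rewrite lt_min => /andP[w1 w2].
pose B := dot (w *m hess f x) w; pose N := e * `|w| ^+ 2.
have tw r (t : R) : 0 <= t <= 1 -> `|w| < r -> `|x + t *: w - x| < r.
  move=> /andP[t0 t1] wr; rewrite addrAC subrr add0r normrZ ger0_norm//.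
  by apply: le_lt_trans wr; rewrite ler_piMl.
have dline (t : R) : is_derive t 1 (fun s : R => x + s *: w) w.
  apply/is_derive_epsP => r r0; exists 1 => // h _.
  rewrite (_ : _ - _ = 0) ?normr0 ?mulr_ge0 ?(ltW r0)//.
  by rewrite [h%:A]mulr1 scalerDl; apply/rowP => j; rewrite !mxE; ring.
have dg (t : R) : 0 <= t <= 1 ->
    is_derive t 1 (fun s => f (x + s *: w)) (dot w (grad f (x + t *: w))).
  move=> t01; apply: (is_derive_comp_sdiff (f := f) (dline t)).
  by apply: (smooth_on_sdiff oD sf); apply: d2P; exact: tw.
have bnd (t : R) : 0 <= t <= 1 -> `|dot w (grad f (x + t *: w)) - t * B| <= N.
  move=> t01; have xx : `|x - x| < d1 by rewrite subrr normr0.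
  have := d1P _ _ (tw _ _ t01 w1) xx; rewrite gx subr0 addrAC subrr add0r => H.
  have -> : dot w (grad f (x + t *: w)) - t * B =
      dot (grad f (x + t *: w) - (t *: w) *m hess f x) w.
    by rewrite dotBl -scalemxAl dotZl [dot w _]dotC.
  rewrite (le_trans (dot_norm _ _))//.
  apply: (@le_trans _ _ (k%:R * (e / k.+1%:R * `|w| * `|w|))).
    rewrite ler_wpM2l// ler_wpM2r// (le_trans H)// ler_wpM2l ?(ltW e1)//.
    by move/andP: t01 => [t0 t1]; rewrite normrZ ger0_norm// ler_piMl.
  have -> : k%:R * (e / k.+1%:R * `|w| * `|w|) = (k%:R / k.+1%:R) * N.
    by rewrite /N; ring.
  rewrite ler_piMl ?mulr_ge0 ?sqr_ge0 ?(ltW e0)//.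
  by rewrite ler_pdivrMr// mul1r ler_nat.
have dq (c t : R) : is_derive t 1 (fun s : R => c * (s * s)) (2 * c * t).
  have := is_deriveZ c (is_deriveM (is_derive_id t 1) (is_derive_id t 1)).
  rewrite (_ : c *: _ = 2 * c * t)//.
  by rewrite -[LHS]/(c * (t * 1 + t * 1)); ring.
have dl (c t : R) : is_derive t 1 (fun s : R => c * s) c.
  have := is_deriveZ c (is_derive_id t 1).
  by rewrite (_ : c *: _ = c)// -[LHS]/(c * 1) mulr1.
pose g1 (s : R) : R := B / 2 * (s * s) + N * s - f (x + s *: w).
pose g2 (s : R) : R := f (x + s *: w) - B / 2 * (s * s) + N * s.
have P1 (t : R) : 0 <= t <= 1 ->
    is_derive t 1 g1 (2 * (B / 2) * t + N - dot w (grad f (x + t *: w))).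
  by move=> t01; exact: (is_deriveB (is_deriveD (dq _ t) (dl _ t)) (dg t t01)).
have P2 (t : R) : 0 <= t <= 1 ->
    is_derive t 1 g2 (dot w (grad f (x + t *: w)) - 2 * (B / 2) * t + N).
  by move=> t01; exact: (is_deriveD (is_deriveB (dg t t01) (dq _ t)) (dl _ t)).
have B2 : 2 * (B / 2) = B by rewrite mulrC divfK.
have H1 : g1 0 <= g1 1.
  apply: (is_derive_le ler01 P1) => t t01.
  have := bnd t t01; rewrite ler_norml => /andP[_]; rewrite B2 [B * t]mulrC.
  by set u := dot _ _; set v := t * B; lra.
have H2 : g2 0 <= g2 1.
  apply: (is_derive_le ler01 P2) => t t01.
  have := bnd t t01; rewrite ler_norml => /andP[+ _]; rewrite B2 [B * t]mulrC.
  by set u := dot _ _; set v := t * B; lra.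
move: H1 H2; rewrite /g1 /g2 scale0r (addr0 x) scale1r -/B -/N.
move=> H1 H2; clear -H1 H2; move: (f (x + w)) (f x) B N H1 H2 => a b c n' H1 H2.
by rewrite ler_norml; apply/andP; split; lra.
Qed.

End Trapping.

Section Dynamics.
Variables (R : realType) (m : nat) (Om : set 'rV[R]_(m + 2)).
Variables (C : 'I_m -> 'rV[R]_(m + 2) -> R) (H nu : 'rV[R]_(m + 2) -> R).
Hypotheses (oOm : open Om) (sC : forall k, smooth_on Om (C k)) (sH : smooth_on Om H).
Hypothesis (snu : smooth_on Om nu).
Implicit Types (x y z : 'rV[R]_(m + 2)) (lam : 'rV[R]_m).

(** The components of the vector field are the case where [w] is a basis vector; linearity of the
    determinant in that row gives the rest. *)
Lemma dot_vfX x w :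
  dot (vfX C H nu x) w = nu x * jdet (gradC C x) w (grad H x).
Proof.
rewrite dotE jdetEl mulr_sumr; apply: eq_bigr => j _.
by rewrite mxE -mulrA; congr (_ * _); rewrite mulrC.
Qed.

Lemma dot_vfX_Flam lam x w : Om x ->
  dot (vfX C H nu x) w = nu x * jdet (gradC C x) w (grad (Flam C H lam) x).
Proof.
by move=> Omx; rewrite dot_vfX (grad_Flam oOm sC sH lam Omx) jdet_addr.
Qed.

Lemma Casimir_conserved k x : Om x -> dot (vfX C H nu x) (grad (C k) x) = 0.
Proof.
move=> Omx; have -> : grad (C k) x = row k (gradC C x).
  by apply/rowP => j; rewrite !mxE.
by rewrite dot_vfX jdet_rowl mulr0.
Qed.

Lemma Flam_conserved lam x : Om x -> dot (vfX C H nu x) (grad (Flam C H lam) x) = 0.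
Proof. by move=> Omx; rewrite (dot_vfX_Flam lam)// jdetvv mulr0. Qed.

Lemma conserved_along (f : 'rV[R]_(m + 2) -> R) (phi : R -> 'rV[R]_(m + 2)) T :
  smooth_on Om f -> (forall x, Om x -> dot (vfX C H nu x) (grad f x) = 0) -> 0 <= T ->
  (forall t, 0 <= t <= T -> Om (phi t) /\ is_derive t 1 phi (vfX C H nu (phi t))) ->
  f (phi T) = f (phi 0).
Proof.
move=> sf cf T0 sol; apply: esym.
apply: (@is_derive_constant R (f \o phi)
   (fun t => dot (vfX C H nu (phi t)) (grad f (phi t)))) => t.
  rewrite min_l// max_r// => /sol[Omt dt].
  exact: is_derive_comp_sdiff dt (smooth_on_sdiff oOm sf Omt).
by rewrite min_l// max_r// => /sol[Omt dt]; exact: cf.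
Qed.

Lemma vfX_lipschitz x : Om x -> exists L d : R, [/\ 0 < L, 0 < d &
  forall y z, `|y - x| < d -> `|z - x| < d ->
    `|vfX C H nu y - vfX C H nu z| <= L * `|y - z|].
Proof.
move=> Omx.
have [i|L [d [L0 d0 LP]]] := @loclip_family R _ 'I_(m + 2) (fun i y => vfX C H nu y 0 i) x.
  under eq_fun do rewrite mxE.
  apply: loclip_mul; first exact: smooth_on_loclip snu Omx.
  apply: (closed_det (loclip_cst x) (@loclip_add _ _ x) (@loclip_mul _ _ x)) => a b.
  rewrite /jacX; case: (@split_ordP m (1 + 1) a) => k ->.
    under eq_fun do rewrite (@col_mxEu _ m (1 + 1)).
    exact: (gradC_loclip oOm sC).
  under eq_fun do rewrite (@col_mxEd _ m (1 + 1)).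
  case: (@split_ordP 1 1 k) => l ->.
    by under eq_fun do rewrite (@col_mxEu _ 1 1); exact: loclip_cst.
  under eq_fun do rewrite (@col_mxEd _ 1 1) mxE.
  exact: smooth_on_loclip oOm (smooth_on_partial b sH) Omx.
exists L, d; split=> // y z yd zd; apply: norm_le_coord => [|i].
  by rewrite mulr_ge0// ltW.
suff -> : (vfX C H nu y - vfX C H nu z) 0 i = vfX C H nu y 0 i - vfX C H nu z 0 i.
  exact: LP.
by rewrite mxE; congr (_ + _); rewrite mxE.
Qed.

Section Stability.
Variables (xe : 'rV[R]_(m + 2)) (lam : 'rV[R]_m).
Hypotheses (Omxe : Om xe) (gxe : grad (Flam C H lam) xe = 0).
Let Q := hess (Flam C H lam) xe.
Let G := gradC C xe.
Hypotheses (uQ : Q \in unitmx) (fG : row_free G).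

Let F := Flam C H lam.
Let Dl x : 'rV[R]_m := \row_k (C k x - C k xe).

Lemma Casimir_linear e : 0 < e -> exists2 d, 0 < d & forall x, `|x - xe| < d ->
  `|Dl x - (x - xe) *m G^T| <= e * `|x - xe|.
Proof.
move=> e0; have [|k|d d0 dP] := @fin_common_radius R 'I_m (fun k d => forall x,
    `|x - xe| < d -> `|C k x - C k xe - dot (x - xe) (grad (C k) xe)| <= e * `|x - xe|).
- move=> k d d' _ dd' HC x xd; apply: HC; exact: lt_le_trans dd'.
- have [d d0 dP] := smooth_on_sdiff oOm (sC k) Omxe e0.
  by exists d => // x xd; apply: dP => //; rewrite subrr normr0.
exists d => // x xd; apply: norm_le_coord => [|k]; first by rewrite mulr_ge0// ltW.
have := dP k x xd; rewrite dotE !mxE; congr (`| _ - _ | <= _).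
by apply: eq_bigr => j _; rewrite !mxE.
Qed.

Hypothesis posI : 0 < \det Q * \det (G *m invmx Q *m G^T).

Lemma energy_Casimir_coercive : exists sg c K d : R,
  [/\ 0 < c, 0 < K, 0 < d & forall x, `|x - xe| < d ->
    c * `|x - xe| ^+ 2 <= sg * (F x - F xe) + K * `|Dl x| ^+ 2].
Proof.
have sQ : Q^T = Q by exact: (hess_Flam_sym oOm sC sH lam Omxe).
have [sg [c [sg2 c0 cP]]] := definite_on_ker fG uQ sQ posI.
have [K K0 KP] := definite_on_ker_coercive fG sQ sg2 c0 cP.
have e1 : 0 < c / 32 by rewrite divr_gt0.
have [d1 d10 d1P] := quadratic_taylor oOm (smooth_on_Flam oOm sC sH lam) Omxe gxe e1.
pose e := Num.min 1 (c / (32 * K)).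
have e0 : 0 < e by rewrite lt_min ltr01 divr_gt0// mulr_gt0.
have [d2 d20 d2P] := Casimir_linear e0.
(* The coercivity [c / 4], halved by Taylor's formula, is [c / 8]; the Taylor error and the
   nonlinearity of the Casimirs cost [c / 32] each. *)
exists sg, (c / 16), K, (Num.min d1 d2); split=> //.
- by rewrite divr_gt0.
- by rewrite lt_min d10.
move=> x; rewrite lt_min => /andP[x1 x2]; set w := x - xe in x1 x2 *.
have xw : xe + w = x by rewrite /w addrC subrK.
have := d1P w x1; rewrite xw -/Q -/F; set B := dot _ _ => HT.
have HB := KP w; rewrite -/B in HB.
have {}HT : sg * (F x - F xe) >= sg * B / 2 - c / 32 * `|w| ^+ 2.
  have : `|sg * (F x - F xe - B / 2)| <= c / 32 * `|w| ^+ 2.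
    rewrite normrM; have -> : `|sg| = 1; last by rewrite mul1r.
    by apply/eqP; rewrite -(@eqrXn2 _ 2)// -normrX sg2 normr1 expr1n.
  rewrite ler_norml => /andP[+ _]; rewrite mulrBr mulrA; lra.
have HG : `|w *m G^T| <= `|Dl x| + e * `|w|.
  rewrite -[w *m G^T](subKr (Dl x)) (le_trans (ler_normB _ _))// lerD2l.
  exact: d2P.
have HG2 : `|w *m G^T| ^+ 2 <= 2 * `|Dl x| ^+ 2 + 2 * (e * `|w| ^+ 2).
  have ee : e ^+ 2 <= e by rewrite expr2 ler_piMl ?(ltW e0)// ge_min lexx.
  have h1 : `|w *m G^T| ^+ 2 <= (`|Dl x| + e * `|w|) ^+ 2.
    by rewrite lerXn2r ?nnegrE ?addr_ge0 ?mulr_ge0 ?(ltW e0).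
  have h2 : 0 <= (`|Dl x| - e * `|w|) ^+ 2 by exact: sqr_ge0.
  have h3 : e ^+ 2 * `|w| ^+ 2 <= e * `|w| ^+ 2 by rewrite ler_wpM2r ?sqr_ge0.
  apply: le_trans h1 _; move: h2 h3; rewrite sqrrB sqrrD !exprMn; lra.
have HK : K * (2 * (e * `|w| ^+ 2)) <= c / 16 * `|w| ^+ 2.
  have Ke : K * e <= c / 32.
    apply: (@le_trans _ _ (K * (c / (32 * K)))); first by rewrite ler_pM2l// ge_min lexx orbT.
    by rewrite le_eqVlt; apply/orP; left; apply/eqP; field; rewrite gt_eqF.
  have -> : K * (2 * (e * `|w| ^+ 2)) = 2 * (K * e) * `|w| ^+ 2 by ring.
  by rewrite ler_wpM2r ?sqr_ge0//; lra.
have HK2 : K * `|w *m G^T| ^+ 2 <= K * (2 * `|Dl x| ^+ 2) + K * (2 * (e * `|w| ^+ 2)).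
  by rewrite -mulrDr ler_pM2l.
move: HT HB HK HK2; set a := `|w| ^+ 2; set b := `|Dl x| ^+ 2.
set X := sg * (F x - F xe); set Y := sg * B; set Z := K * (2 * (e * a)).
set g := K * `|w *m G^T| ^+ 2; have -> : K * (2 * b) = 2 * (K * b) by ring.
by set kb := K * b; move=> *; lra.
Qed.

(** Quantitative continuity of the Lyapunov function at [xe]; it provides the radius [delta] of
    stability. *)
Lemma energy_Casimir_upper (sg K : R) : 0 < K -> exists M d : R, [/\ 0 < M, 0 < d &
  forall x, `|x - xe| < d -> sg * (F x - F xe) + K * `|Dl x| ^+ 2 <= M * `|x - xe|].
Proof.
move=> K0.
have [L1 [d1 [L10 d10 d1P]]] := smooth_on_loclip oOm (smooth_on_Flam oOm sC sH lam) Omxe.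
have [k|L2 [d2 [L20 d20 d2P]]] := @loclip_family R _ 'I_m C xe.
  exact: smooth_on_loclip oOm (sC k) Omxe.
exists (`|sg| * L1 + K * L2 ^+ 2), (Num.min 1 (Num.min d1 d2)).
split; first by rewrite ltr_wpDl ?mulr_ge0 ?(ltW L10)// mulr_gt0// exprn_gt0.
  by rewrite !lt_min ltr01 d10.
move=> x; rewrite !lt_min => /and3P[x0 x1 x2]; rewrite mulrDl lerD//.
  apply: le_trans (ler_norm _) _; rewrite normrM -mulrA ler_wpM2l//.
  by apply: d1P => //; rewrite subrr normr0.
rewrite -mulrA ler_pM2l//.
have HD : `|Dl x| <= L2 * `|x - xe|.
  apply: norm_le_coord => [|k]; first by rewrite mulr_ge0// ltW.
  by rewrite mxE; apply: d2P => //; rewrite subrr normr0.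
apply: (@le_trans _ _ ((L2 * `|x - xe|) ^+ 2)).
  by rewrite lerXn2r ?nnegrE ?mulr_ge0 ?(ltW L20).
by rewrite exprMn ler_pM2l ?exprn_gt0// expr2 ler_piMl// ltW.
Qed.

(* Precomposing the vector field with this 1-Lipschitz map makes it globally
   Lipschitz without changing it near the equilibrium. *)
Definition box_retraction (c : 'rV[R]_(m + 2)) (r : R) x : 'rV[R]_(m + 2) :=
  \row_i Num.max (c 0 i - r) (Num.min (c 0 i + r) (x 0 i)).

Lemma box_retraction_le c r x : 0 < r -> `|box_retraction c r x - c| <= r.
Proof.
move=> r0; apply: norm_le_coord => [|i]; first exact: ltW.
rewrite !mxE; move: (c 0 i) (x 0 i) => a u; rewrite ler_norml.
have [h1|h1] := lerP (a + r) u; [have [h2|h2] := lerP (a - r) (a + r)|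
  have [h2|h2] := lerP (a - r) u]; apply/andP; split; lra.
Qed.

Lemma box_retraction_id c r x : `|x - c| <= r -> box_retraction c r x = x.
Proof.
move=> xc; apply/rowP => i; have := le_trans (coord_le_norm (x - c) i) xc.
rewrite !mxE ler_norml => /andP[h1 h2]; rewrite min_r; last by lra.
by rewrite max_r//; lra.
Qed.

Lemma box_retraction_lip c r x y :
  `|box_retraction c r x - box_retraction c r y| <= `|x - y|.
Proof.
apply: norm_le_coord => // i; apply: le_trans (coord_le_norm _ i); rewrite !mxE.
move: (c 0 i - r) (c 0 i + r) (x 0 i) (y 0 i) => a b u v.
rewrite ler_norml; apply/andP; split.
  have [a1|a1] := lerP a (Num.min b u); have [a2|a2] := lerP a (Num.min b v);
  move: a1 a2; have [b1|b1] := lerP b u; have [b2|b2] := lerP b v => *;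
  have := ler_norm (u - v); have := ler_norm (- (u - v)); rewrite normrN; lra.
have [a1|a1] := lerP a (Num.min b u); have [a2|a2] := lerP a (Num.min b v);
move: a1 a2; have [b1|b1] := lerP b u; have [b2|b2] := lerP b v => *;
have := ler_norm (u - v); have := ler_norm (- (u - v)); rewrite normrN; lra.
Qed.

Lemma definite_stable : lyapunov_stable C H nu Om xe.
Proof.
move=> eps eps0.
have [sg [c [K [d [c0 K0 d0 dP]]]]] := energy_Casimir_coercive.
have [M [d1 [M0 d10 d1P]]] := energy_Casimir_upper sg K0.
have [L [d2 [L0 d20 d2P]]] := vfX_lipschitz Omxe.
have /near_epsP[d3 d30 d3P] : nbhs xe Om by exact: open_nbhs_nbhs.
pose D := Num.min (Num.min eps d) (Num.min d2 d3); pose r := D / 2.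
have D0 : 0 < D by rewrite !lt_min eps0 d0 d20.
have r0 : 0 < r by rewrite divr_gt0.
have : r < D by rewrite ltr_pdivrMr// ltr_pMr// ltr1n.
rewrite !lt_min => /andP[/andP[reps rd] /andP[rd2 rd3]].
pose W x := sg * (F x - F xe) + K * `|Dl x| ^+ 2.
pose w := c * r ^+ 2; have w0 : 0 < w by rewrite mulr_gt0// exprn_gt0.
have Wr x : `|x - xe| = r -> w <= W x by move=> xr; rewrite /w -xr; apply: dP; rewrite xr.
pose delta := Num.min r (Num.min d1 (w / M)).
have rOm x : `|x - xe| <= r -> Om x by move=> xr; apply: d3P; exact: le_lt_trans rd3.
have Wcons (phi : R -> 'rV[R]_(m + 2)) (T : R) : 0 <= T ->
  (forall t : R, 0 <= t <= T -> Om (phi t) /\ is_derive t 1 phi (vfX C H nu (phi t))) ->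
  W (phi T) = W (phi 0).
  move=> T0 sol; rewrite /W /F.
  rewrite (conserved_along (smooth_on_Flam oOm sC sH lam) (Flam_conserved lam) T0 sol).
  congr (_ + _ * `|_| ^+ 2); apply/rowP => k; rewrite !mxE.
  by rewrite (conserved_along (sC k) (Casimir_conserved k) T0 sol).
exists delta; first by rewrite !lt_min r0 d10 divr_gt0.
move=> y; rewrite !lt_min => /and3P[yr yd1 ydM].
have Wy : W y < w.
  by apply: le_lt_trans (d1P y yd1) _; rewrite mulrC -ltr_pdivlMr.
split; last first.
  move=> phi a b a0 b0 phi0 sol t /andP[t0 tb].
  apply: lt_trans reps.
  have sol' s : 0 <= s <= t -> Om (phi s) /\ is_derive s 1 phi (vfX C H nu (phi s)).
    by move=> /andP[s0 st]; apply: sol; rewrite (lt_le_trans a0)// (le_lt_trans st).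
  apply: (trapped Wr t0); rewrite ?phi0.
  - by move=> s /sol'[_ /is_derive_continuous].
  - exact: yr.
  - exact: Wy.
  move=> t1 /andP[t10 t1t] _; rewrite -phi0; apply: (Wcons _ _ t10) => s /andP[s0 st1].
  by apply: sol'; rewrite s0 (le_trans st1).
pose g x := vfX C H nu (box_retraction xe r x).
have gL x z : `|g x - g z| <= L * `|x - z|.
  have near_box u : `|box_retraction xe r u - xe| < d2.
    by apply: le_lt_trans rd2; exact: box_retraction_le.
  apply: le_trans (d2P _ _ (near_box x) (near_box z)) _.
  by rewrite ler_pM2l// box_retraction_lip.
have [phi [phi0 dphi]] := global_solution y L0 gL.
have cphi t : {for t, continuous phi} by exact: is_derive_continuous (dphi t).
have stay t : 0 <= t -> `|phi t - xe| < r.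
  move=> t0; apply: (trapped Wr t0); rewrite ?phi0.
  - by move=> s _; exact: cphi.
  - exact: yr.
  - exact: Wy.
  move=> t1 /andP[t10 t1t] low; rewrite -phi0; apply: (Wcons _ _ t10) => s s1.
  split; first by apply: rOm; exact: low.
  by have := dphi s; rewrite /g box_retraction_id//; exact: low.
(* Stability asks for a solution starting at a negative time. Continuity at 0 gives a short backward
   interval on which the curve is still inside the ball. *)
have e0 : 0 < (r - `|y - xe|) / 2 by rewrite divr_gt0// subr_gt0.
have /continuous_epsP/(_ _ e0)[da da0 daP] := cphi 0.
exists phi, (- da); split; first by rewrite oppr_lt0.
split; [exact: phi0|move=> t dat].
have tr : `|phi t - xe| < r.
  have [t0|t0] := lerP 0 t; first exact: stay.
  have td : `|t - 0| < da by rewrite subr0 ltr0_norm// ltrNl.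
  rewrite -(subrKA (phi 0)) (le_lt_trans (ler_normD _ _))//.
  have := daP t td; rewrite phi0.
  by move: e0; set u := `|phi t - y|; set v := `|y - xe|; lra.
split; first by apply: rOm; exact: ltW.
by have := dphi t; rewrite /g box_retraction_id// ltW.
Qed.

End Stability.

End Dynamics.

(** * Instability *)

Section Instability.
Variable R : realType.

Lemma dot_sub_split k (g v x y : 'rV[R]_k) :
  dot g x - dot v y = dot (g - v) x + dot v (x - y).
Proof. by rewrite dotBl [dot v (_ - _)]dotC dotBl !(dotC _ v); ring. Qed.

Lemma sdiff_dot k (c u x : 'rV[R]_k) : sdiff (fun y => dot (y - c) u) x u.
Proof.
move=> e e0; exists 1 => // y z _ _.
have -> : dot (y - c) u - dot (z - c) u - dot (y - z) u = 0 by rewrite !dotBl; ring.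
by rewrite normr0 mulr_ge0// ltW.
Qed.

(** The three pairings are the blocks of [w *m (jmx G u v)^T], so they are linear coordinates and
    bound [w] through the inverse matrix. *)
Lemma jmx_coord_bound m (G : 'M[R]_(m, m + 2)) u v : jdet G u v != 0 ->
  exists2 K : R, 0 < K & forall w, `|w| <= K * (`|w *m G^T| + `|dot w u| + `|dot w v|).
Proof.
move=> Juv; pose M := jmx G u v.
have uM : M^T \in unitmx by rewrite unitmx_tr unitmxE unitfE.
have [K K0 KP] := mulmx_bound (invmx M^T); exists K => // w.
rewrite -{1}[w](mulmxK uM) (le_trans (KP _))// ler_pM2l//.
have -> : w *m M^T = row_mx (w *m G^T) (row_mx (w *m u^T) (w *m v^T) : 'rV[R]_(1 + 1)).
  by rewrite /M /jmx (@tr_col_mx _ m (1 + 1)) (@mul_mx_row _ _ _ m (1 + 1)) tr_col_mx mul_mx_row.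
have n0 := normr_ge0 (w *m G^T); have n1 := normr_ge0 (dot w u); have n2 := normr_ge0 (dot w v).
apply: norm_le_coord => [|j]; first by rewrite !addr_ge0.
case: (@split_ordP m (1 + 1) j) => k ->.
  rewrite (@row_mxEl _ _ m (1 + 1)).
  by rewrite (le_trans (coord_le_norm _ k))// -addrA lerDl addr_ge0.
rewrite (@row_mxEr _ _ m (1 + 1)); case: (@split_ordP 1 1 k) => l ->.
  rewrite (@row_mxEl _ _ 1 1) (ord1 l) -[X in `|X|]/(dot w u).
  by rewrite addrAC lerDr addr_ge0.
by rewrite (@row_mxEr _ _ 1 1) (ord1 l) -[X in `|X|]/(dot w v) lerDr addr_ge0.
Qed.

(* [p' = mu p + e1] and [q' = - mu q + e2], so the right-hand side is
   the derivative of [p ^ 2 - q ^ 2]; [k] is the conserved size of the Casimirs. *)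
Lemma saddle_growth (mu K e p q w k e1 e2 : R) : 0 < mu -> 0 < K ->
  e = mu / (12 * K) -> 0 <= k ->
  w <= 2 * K * (k + `|p| + `|q|) -> `|e1| <= e * w -> `|e2| <= e * w ->
  mu * (p * p - q * q - k * k) <= 2 * p * (mu * p + e1) - 2 * q * (- mu * q + e2).
Proof.
move=> mu0 K0 eE k0 wK he1 he2.
have e0 : 0 < e by rewrite eE divr_gt0// mulr_gt0.
pose s := `|p| + `|q|.
have ew : e * w <= mu / 6 * (k + s).
  apply: le_trans (ler_wpM2l (ltW e0) wK) _.
  by rewrite le_eqVlt; apply/orP; left; apply/eqP; rewrite eE /s; field; rewrite gt_eqF.
have s0 : 0 <= s by rewrite addr_ge0.
have P1 : - (p * e1) <= `|p| * (mu / 6 * (k + s)).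
  apply: le_trans (ler_norm _) _; rewrite normrN normrM ler_wpM2l//.
  exact: le_trans ew.
have P2 : q * e2 <= `|q| * (mu / 6 * (k + s)).
  apply: le_trans (ler_norm _) _; rewrite normrM ler_wpM2l//.
  exact: le_trans ew.
have p2 : `|p| * `|p| = p * p by rewrite -normrM ger0_norm// -expr2 sqr_ge0.
have q2 : `|q| * `|q| = q * q by rewrite -normrM ger0_norm// -expr2 sqr_ge0.
have P3 : - (p * e1) + q * e2 <= s * (mu / 6 * (k + s)).
  by apply: le_trans (lerD P1 P2) _; rewrite -mulrDl.
have s2 : s * s <= 2 * (p * p + q * q).
  rewrite -p2 -q2 -subr_ge0 /s (_ : _ - _ = (`|p| - `|q|) ^+ 2) ?sqr_ge0//; ring.
have sk : 2 * (s * k) <= s * s + k * k.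
  by rewrite -subr_ge0 (_ : _ - _ = (s - k) ^+ 2) ?sqr_ge0//; ring.
have P4 : s * (mu / 6 * (k + s)) <= mu * ((p * p + q * q) / 2 + k * k / 12).
  have -> : s * (mu / 6 * (k + s)) = mu * ((s * s + s * k) / 6) by field.
  by rewrite ler_pM2l//; lra.
have kk : 0 <= mu * (k * k) by rewrite mulr_ge0 ?mulr_ge0// ltW.
have qq : 0 <= mu * (q * q) by rewrite mulr_ge0 ?(ltW mu0)// -expr2 sqr_ge0.
have E : 2 * p * (mu * p + e1) - 2 * q * (- mu * q + e2) =
   2 * (mu * (p * p)) + 2 * (mu * (q * q)) - 2 * (- (p * e1) + q * e2) by ring.
rewrite E; have P5 := le_trans P3 P4; move: P5 kk qq.
by set a := - (p * e1) + q * e2; lra.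
Qed.

Variables (m : nat) (Om : set 'rV[R]_(m + 2)).
Variables (C : 'I_m -> 'rV[R]_(m + 2) -> R) (H nu : 'rV[R]_(m + 2) -> R).
Hypotheses (oOm : open Om) (sC : forall k, smooth_on Om (C k)) (sH : smooth_on Om H).
Hypothesis (snu : smooth_on Om nu).
Implicit Types x y z : 'rV[R]_(m + 2).
Variables (xe : 'rV[R]_(m + 2)) (lam : 'rV[R]_m).
Hypotheses (Omxe : Om xe) (gxe : grad (Flam C H lam) xe = 0).
Let Q := hess (Flam C H lam) xe.
Let G := gradC C xe.

(** Because [grad F_lam] vanishes at [xe], only this argument of the bracket has to be linearized.
    The remaining factors are gathered in [h x], which multiplies a quantity of order [|x - xe|], so
    a Lipschitz bound on [h] suffices. *)
Lemma vfX_linearization u e : 0 < e -> exists2 d, 0 < d & forall x, `|x - xe| < d ->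
  `|dot (vfX C H nu x) u - nu xe * jdet G u ((x - xe) *m Q)| <= e * `|x - xe|.
Proof.
move=> e0; pose h x : 'rV[R]_(m + 2) := \row_j (nu x * jdet (gradC C x) u (ebasis R j)).
have hE x v : nu x * jdet (gradC C x) u v = dot v (h x).
  rewrite jdetEr mulr_sumr dotE; apply: eq_bigr => j _.
  by rewrite mxE mulrCA.
have [j|Lh [d1 [Lh0 d10 d1P]]] := @loclip_family R _ 'I_(m + 2) (fun j x => h x 0 j) xe.
  under eq_fun do rewrite mxE.
  apply: loclip_mul; first exact: smooth_on_loclip snu Omxe.
  apply: (closed_det (loclip_cst xe) (@loclip_add _ _ xe) (@loclip_mul _ _ xe)) => a b.
  rewrite /jmx; case: (@split_ordP m (1 + 1) a) => k ->.
    under eq_fun do rewrite (@col_mxEu _ m (1 + 1)).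
    exact: (gradC_loclip oOm sC).
  by under eq_fun do rewrite (@col_mxEd _ m (1 + 1)); exact: loclip_cst.
pose N : R := (m + 2)%:R; have N0 : 0 < N by rewrite ltr0n addn2.
pose A := `|h xe| + Lh; have A0 : 0 < A by rewrite ltr_wpDl.
have [K K0 KP] := mulmx_bound Q.
have e1 : 0 < e / (2 * N * A) by rewrite divr_gt0// !mulr_gt0.
have [d2 d20 d2P] := smooth_on_grad_sdiff oOm (smooth_on_Flam oOm sC sH lam) Omxe e1.
have /near_epsP[d3 d30 d3P] : nbhs xe Om by exact: open_nbhs_nbhs.
have d40 : 0 < e / (2 * N * K * Lh) by rewrite divr_gt0// !mulr_gt0.
exists (Num.min (Num.min 1 d1) (Num.min (Num.min d2 d3) (e / (2 * N * K * Lh)))).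
  by rewrite !lt_min ltr01 d10 d20 d30.
move=> x; rewrite !lt_min => /andP[/andP[x0 x1] /andP[/andP[x2 x3] x4]].
have Omx := d3P x x3.
have xx r : 0 < r -> `|xe - xe| < r by rewrite subrr normr0.
rewrite (dot_vfX_Flam nu oOm sC sH lam _ Omx) !hE.
set w := x - xe in x0 x1 x2 x3 x4 *; set g := grad _ x.
have hh : `|h x - h xe| <= Lh * `|w|.
  apply: norm_le_coord => [|j]; first by rewrite mulr_ge0// ltW.
  have -> : (h x - h xe) 0 j = h x 0 j - h xe 0 j.
    by rewrite mxE; congr (_ + _); rewrite mxE.
  by apply: d1P => //; exact: xx.
have hx : `|h x| <= A.
  rewrite -[h x](subrK (h xe)) (le_trans (ler_normD _ _))// addrC lerD2l.
  by apply: le_trans hh _; rewrite ler_piMr// ltW.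
have gw : `|g - w *m Q| <= e / (2 * N * A) * `|w|.
  by have := d2P x xe x2 (xx _ d20); rewrite gxe subr0.
have -> : dot g (h x) - dot (w *m Q) (h xe) =
    dot (g - w *m Q) (h x) + dot (w *m Q) (h x - h xe).
  exact: dot_sub_split.
rewrite (le_trans (ler_normD _ _))// [leRHS](_ : _ = e / 2 * `|w| + e / 2 * `|w|); last by field.
apply: lerD; apply: le_trans (dot_norm _ _) _; rewrite -/N.
  apply: (@le_trans _ _ (N * ((e / (2 * N * A) * `|w|) * A))).
    by rewrite ler_pM2l// ler_pM.
  by rewrite le_eqVlt; apply/orP; left; apply/eqP; field; rewrite !gt_eqF.
apply: (@le_trans _ _ (N * ((K * `|w|) * (Lh * (e / (2 * N * K * Lh)))))).
  rewrite ler_pM2l// ler_pM//; apply: le_trans hh _.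
  by rewrite ler_pM2l// ltW.
by rewrite le_eqVlt; apply/orP; left; apply/eqP; field; rewrite !gt_eqF.
Qed.

Hypotheses (uQ : Q \in unitmx) (fG : row_free G) (nu0 : nu xe != 0).
Hypothesis negI : \det Q * \det (G *m invmx Q *m G^T) < 0.

Lemma hyperbolic_pair : exists (a b : 'rV[R]_(m + 2)) (mu : R),
  [/\ 0 < mu, b *m G^T = 0, dot b (b *m Q) = 0 /\ dot b (a *m Q) != 0,
    jdet G (a *m Q) (b *m Q) != 0 &
    (forall w, nu xe * jdet G (a *m Q) (w *m Q) = mu * dot w (a *m Q)) /\
    (forall w, nu xe * jdet G (b *m Q) (w *m Q) = - mu * dot w (b *m Q))].
Proof.
have sQ : Q^T = Q by exact: (hess_Flam_sym oOm sC sH lam Omxe).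
have [a [b [aG bG aa bb ab]]] := indefinite_on_ker fG uQ sQ negI.
have [ka ka0 [Ja Jb]] := jdet_null fG sQ aG bG aa bb ab.
have sw v w : dot v (w *m Q) = dot w (v *m Q) by rewrite dotC dot_mulmx sQ.
have ba : dot b (a *m Q) != 0 by rewrite dotC.
have Ka : forall w, nu xe * jdet G (a *m Q) (w *m Q) = nu xe * ka * dot w (a *m Q).
  by move=> w; rewrite Ja sw mulrA.
have Kb : forall w, nu xe * jdet G (b *m Q) (w *m Q) = - (nu xe * ka) * dot w (b *m Q).
  by move=> w; rewrite Jb sw !mulNr mulrN mulrA.
have Jab : jdet G (a *m Q) (b *m Q) != 0 by rewrite Ja mulf_neq0// sw.
have nk0 : nu xe * ka != 0 by rewrite mulf_neq0.
(* The sign of [nu xe * ka] is not prescribed; exchanging [a] and [b] reverses it. *)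
have [nk|nk|nk] := ltrgtP (nu xe * ka) 0; last by rewrite nk eqxx in nk0.
  exists b, a, (- (nu xe * ka)); split=> //.
  - by rewrite oppr_gt0.
  - by split; [rewrite dotC|rewrite sw].
  - by rewrite jdetC oppr_eq0.
  - by rewrite opprK.
by exists a, b, (nu xe * ka); split=> //; split=> //; rewrite dotC.
Qed.

Lemma indefinite_unstable : unstable C H nu Om xe.
Proof.
move=> stab; have [a [b [mu [mu0 bG [bb ba] Jab [Ka Kb]]]]] := hyperbolic_pair.
have [K K0 KP] := jmx_coord_bound Jab.
pose e := mu / (12 * K); have e0 : 0 < e by rewrite divr_gt0// mulr_gt0.
have [d1 d10 d1P] := vfX_linearization (a *m Q) e0.
have [d2 d20 d2P] := vfX_linearization (b *m Q) e0.
(* With this precision the nonlinearity of the Casimirs costs half of [|w|] in [KP]; absorbing it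
   turns the constant [K] into the [2 * K] of [saddle_growth]. *)
have K20 : 0 < (2 * K)^-1 by rewrite invr_gt0 mulr_gt0.
have [d3 d30 d3P] := Casimir_linear oOm sC Omxe K20.
pose eps := Num.min d1 (Num.min d2 d3).
have eps0 : 0 < eps by rewrite !lt_min d10 d20.
have [del del0 delP] := stab _ eps0.
pose Dl x : 'rV[R]_m := \row_k (C k x - C k xe).
pose be := dot b (a *m Q).
have b1 : 0 < `|b| + 1 by rewrite ltr_wpDl.
(* This precision makes the Casimirs at the starting point at most half of [|p|], which is
   [s * |be|] there. *)
have e30 : 0 < `|be| / (2 * (`|b| + 1)) by rewrite divr_gt0 ?normr_gt0// mulr_gt0.
have [d4 d40 d4P] := Casimir_linear oOm sC Omxe e30.
pose s := Num.min del d4 / 2 / (`|b| + 1).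
have m0 : 0 < Num.min del d4 by rewrite lt_min del0.
have s0 : 0 < s by rewrite !divr_gt0.
(* Along [b] the coordinate [q] vanishes, since [b] is null for [Q], and so does the linear part of
   the Casimirs, while [p = s * be] is nonzero. *)
pose y := xe + s *: b.
have yw : y - xe = s *: b by rewrite /y addrAC subrr add0r.
have nsb : `|s *: b| < Num.min del d4.
  rewrite normrZ gtr0_norm//; apply: (@le_lt_trans _ _ (s * (`|b| + 1))).
    by rewrite ler_pM2l// lerDl.
  by rewrite /s divfK ?gt_eqF// ltr_pdivrMr// ltr_pMr// ltr1n.
have [[phi [a0 [a00 [phi0 sol]]]] stay] : (exists phi a, a < 0 /\ phi 0 = y /\
    solution_on_pinfty C H nu Om phi a) /\
    (forall phi a b, a < 0 -> 0 < b -> phi 0 = y -> solution_on C H nu Om phi a b ->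
         forall t, 0 <= t < b -> `|phi t - xe| < eps).
  by apply: delP; rewrite yw; apply: lt_le_trans nsb _; rewrite ge_min lexx.
have stayphi (t : R) : 0 <= t -> `|phi t - xe| < eps.
  move=> t0; have t10 : 0 < t + 1 by apply: ltr_wpDl.
  have tt : 0 <= t < t + 1 by rewrite t0 ltrDl ltr01.
  have so : solution_on C H nu Om phi a0 (t + 1) by move=> r /andP[ar _]; exact: sol.
  exact: (stay phi a0 (t + 1) a00 t10 phi0 so t tt).
have solp (t : R) : 0 <= t -> Om (phi t) /\ is_derive t 1 phi (vfX C H nu (phi t)).
  by move=> t0; apply: sol; exact: lt_le_trans t0.
pose k := `|Dl y|; have k0 : 0 <= k by exact: normr_ge0.
have Dlk (t : R) : 0 <= t -> `|Dl (phi t)| = k.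
  move=> t0; rewrite /k -phi0; congr `|_|; apply/rowP => i; rewrite !mxE; congr (_ - _).
  apply: (conserved_along oOm (sC i) _ t0) => [x Omx|r /andP[r0 _]]; last exact: solp.
  exact: Casimir_conserved Omx.
pose p (t : R) := dot (phi t - xe) (a *m Q); pose q (t : R) := dot (phi t - xe) (b *m Q).
pose p' (t : R) := dot (vfX C H nu (phi t)) (a *m Q).
pose q' (t : R) := dot (vfX C H nu (phi t)) (b *m Q).
have dp (t : R) : 0 <= t -> is_derive t 1 p (p' t).
  by move=> /solp[_ dt]; exact: (is_derive_comp_sdiff dt (sdiff_dot xe (a *m Q) (phi t))).
have dq (t : R) : 0 <= t -> is_derive t 1 q (q' t).
  by move=> /solp[_ dt]; exact: (is_derive_comp_sdiff dt (sdiff_dot xe (b *m Q) (phi t))).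
have growth (t : R) : 0 <= t ->
    mu * (p t * p t - q t * q t - k * k) <= 2 * p t * p' t - 2 * q t * q' t.
  move=> t0; have := stayphi t t0; rewrite !lt_min => /and3P[h1 h2 h3].
  have := d1P _ h1; have := d2P _ h2; rewrite Ka Kb -/(p t) -/(q t) -/(p' t) -/(q' t) => H2 H1.
  have -> : p' t = mu * p t + (p' t - mu * p t) by rewrite addrC subrK.
  have -> : q' t = - mu * q t + (q' t - - mu * q t) by rewrite addrC subrK.
  apply: (@saddle_growth mu K e (p t) (q t) `|phi t - xe| k) => //.
  have HK := KP (phi t - xe); rewrite -/(p t) -/(q t) in HK.
  have HG : `|(phi t - xe) *m G^T| <= k + (2 * K)^-1 * `|phi t - xe|.
    rewrite -(Dlk t t0) -[_ *m G^T](subKr (Dl (phi t))) (le_trans (ler_normB _ _))// lerD2l.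
    exact: d3P.
  have HK' : `|phi t - xe| <= K * (k + (2 * K)^-1 * `|phi t - xe| + `|p t| + `|q t|).
    by apply: le_trans HK _; rewrite ler_pM2l// !lerD2r.
  have E : K * (k + (2 * K)^-1 * `|phi t - xe| + `|p t| + `|q t|) =
      `|phi t - xe| / 2 + K * (k + `|p t| + `|q t|) by field; rewrite gt_eqF.
  rewrite E in HK'; rewrite -mulrA.
  by move: HK'; set u := `|phi t - xe|; set v := K * _; lra.
pose Z (t : R) := p t * p t - q t * q t - k * k.
(* The integrating factor turns [mu * Z t <= Z' t] into monotonicity of [Y], so the sign of [Z] need
   not be followed along the solution. *)
pose Y (t : R) := Z t * expR (- mu * t).
pose Z' (t : R) := 2 * p t * p' t - 2 * q t * q' t.
have dY (t : R) : 0 <= t -> is_derive t 1 Y ((Z' t - mu * Z t) * expR (- mu * t)).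
  move=> t0; have D := is_deriveM (is_deriveB (is_deriveB (is_deriveM (dp t t0) (dp t t0))
    (is_deriveM (dq t t0) (dq t t0))) (is_derive_cst (k * k) t 1)) (is_derive_expM (- mu) t).
  apply: (is_derive_eq D); rewrite /Z' /Z.
  change ((p t * p t - q t * q t - k * k) * (- mu * expR (- mu * t)) +
    expR (- mu * t) * (p t * p' t + p t * p' t - (q t * q' t + q t * q' t) - 0) =
    (2 * p t * p' t - 2 * q t * q' t - mu * (p t * p t - q t * q t - k * k)) * expR (- mu * t)).
  by ring.
have Z0 : 0 < Z 0.
  rewrite /Z /p /q phi0 yw !dotZl bb mulr0 mul0r subr0 -/be.
  have kb : k <= s * `|be| / 2.
    have := d4P y; rewrite yw -scalemxAl bG scaler0 subr0 -/(Dl y) -/k.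
    have h4 : `|s *: b| < d4 by apply: lt_le_trans nsb _; rewrite ge_min lexx orbT.
    move=> /(_ h4) hk; apply: le_trans hk _; rewrite normrZ (gtr0_norm s0).
    apply: (@le_trans _ _ (`|be| / (2 * (`|b| + 1)) * (s * (`|b| + 1)))).
      by rewrite ler_pM2l// ler_pM2l// lerDl.
    by rewrite le_eqVlt; apply/orP; left; apply/eqP; field; rewrite gt_eqF.
  have b2 : be * be = `|be| * `|be| by rewrite -normrM ger0_norm// -expr2 sqr_ge0.
  have sb0 : 0 < s * `|be| by rewrite mulr_gt0// normr_gt0.
  have kk : k * k <= (s * `|be| / 2) * (s * `|be| / 2) by rewrite ler_pM.
  have -> : s * be * (s * be) = s * `|be| * (s * `|be|) by rewrite mulrACA b2 mulrACA.
  have ss : 0 < s * `|be| * (s * `|be|) by rewrite mulr_gt0.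
  by move: kk ss; set u := s * `|be|; rewrite mulrACA; set v := u * u; lra.
have [M M0 MP] := dot_bound (a *m Q).
(* At this time the lower bound [Z 0 * (1 + mu * T)] equals [Z 0 + (M * eps) ^ 2], more than the
   confined solution allows. *)
pose T := (M * eps) ^+ 2 / (Z 0 * mu).
have T0 : 0 <= T by rewrite divr_ge0 ?sqr_ge0// mulr_ge0// ltW.
have YT : Y 0 <= Y T.
  apply: (is_derive_le T0 (fun t (t01 : 0 <= t <= T) => dY t (proj1 (andP t01)))) => t /andP[t0 _].
  by rewrite mulr_ge0 ?expR_ge0// subr_ge0; exact: growth.
have ZT : Z 0 * (1 + mu * T) <= Z T.
  have : Z 0 * expR (mu * T) <= Z T.
    have := ler_wpM2r (expR_ge0 (mu * T)) YT; rewrite /Y mulr0 expR0 mulr1 -mulrA.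
    by rewrite -expRD mulNr addNr expR0 mulr1.
  by apply: le_trans; rewrite ler_pM2l// expR_ge1Dx.
have pT : Z T <= (M * eps) ^+ 2.
  apply: (@le_trans _ _ (p T * p T)).
    have qq : 0 <= q T * q T by rewrite -expr2 sqr_ge0.
    have kk : 0 <= k * k by rewrite mulr_ge0.
    by rewrite /Z; lra.
  have pM : `|p T| <= M * eps.
    by apply: le_trans (MP _) _; rewrite ler_pM2l// ltW// stayphi.
  by rewrite -expr2 -[p T ^+ 2]real_normK ?num_real// lerXn2r ?nnegrE// mulr_ge0// ltW.
have : Z 0 * (1 + mu * T) = Z 0 + (M * eps) ^+ 2.
  by rewrite /T; field; rewrite !gt_eqF.
by move=> E; move: ZT; rewrite E => /le_trans/(_ pT); rewrite gerDr leNgt Z0.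
Qed.

End Instability.

(** * The invariant along the branch, and the conclusion *)

Lemma det_IX_form (R : realType) (m : nat) (G : 'M[R]_(m, m + 2)) (Q : 'M[R]_(m + 2)) :
  Q^T = Q -> wedge_dot ((invmx Q *m G^T)^T) G = \det (G *m invmx Q *m G^T).
Proof. by move=> sQ; rewrite /wedge_dot trmx_mul trmxK trmx_inv sQ. Qed.

Lemma wedge_neq0_row_free (R : realType) (p k : nat) (G W : 'M[R]_(p, k)) :
  \det (G *m W^T) != 0 -> row_free G.
Proof.
move=> d; apply/row_freeP; exists (W^T *m invmx (G *m W^T)).
by rewrite mulmxA mulmxV// unitmxE unitfE.
Qed.

Lemma wedge_dependent (R : realType) (m k : nat) (G : 'M[R]_(m, k)) (l : 'rV[R]_m) :
  wedge (col_mx G (- (l *m G))) = (fun=> 0).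
Proof.
apply/funext => W; apply/eqP/det0P; exists (row_mx l (1%:M : 'M[R]_1)).
  apply/eqP => /(congr1 (fun v : 'rV[R]_(m + 1) => v 0 (rshift m 0))).
  by rewrite row_mxEr !mxE eqxx => /eqP; rewrite oner_eq0.
by rewrite mulmxA mul_row_col mul1mx subrr mul0mx.
Qed.

Section Assembly.
Variables (R : realType) (m : nat) (Om : set 'rV[R]_(m + 2)).
Variables (C : 'I_m -> 'rV[R]_(m + 2) -> R) (H nu : 'rV[R]_(m + 2) -> R).
Hypotheses (oOm : open Om) (sC : forall k, smooth_on Om (C k)) (sH : smooth_on Om H).
Hypothesis (snu : smooth_on Om nu).

Lemma critical_regular_equilibrium x lam (W : 'M[R]_(m, m + 2)) : Om x ->
  nu x != 0 -> \det (gradC C x *m W^T) != 0 -> grad (Flam C H lam) x = 0 ->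
  \det (hess (Flam C H lam) x) != 0 -> nondeg_regular_equilibrium C H nu Om x.
Proof.
move=> Omx nx Wx gx hx; split; last by exists lam.
split=> //.
  by move=> w0; move: Wx; rewrite -[\det _]/(wedge (gradC C x) W) w0 eqxx.
have -> : grad H x = - (lam *m gradC C x).
  by apply/eqP; rewrite -addr_eq0 -(grad_Flam oOm sC sH lam Omx) gx.
exact: wedge_dependent.
Qed.

Variables (xe : 'rV[R]_(m + 2)) (lame : 'rV[R]_m).
Hypothesis nxe : nondeg_regular_equilibrium C H nu Om xe.
Hypotheses (gxe : grad (Flam C H lame) xe = 0) (hxe : \det (hess (Flam C H lame) xe) != 0).

(** The factor [sg], later 1 or -1, treats both signs of the invariant at once. All conditions to be
    preserved are positivity or nonvanishing of members of [branch_fun], so finitely many shrinkings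
    of the ball suffice. *)
Lemma equilibrium_branch (sg : R) : 0 < sg * IX C H nu lame xe ->
  exists (r : R) (xb : 'rV[R]_m -> 'rV[R]_(m + 2)),
    [/\ 0 < r, xb lame = xe, smooth_on_vec [set lam | `|lam - lame| < r] xb &
     forall lam, `|lam - lame| < r ->
       [/\ Om (xb lam), grad (Flam C H lam) (xb lam) = 0,
           nondeg_regular_equilibrium C H nu Om (xb lam),
           row_free (gradC C (xb lam)) & 0 < sg * IX C H nu lam (xb lam)]].
Proof.
move=> Ipos; have [[Omxe nuxe wxe _] _] := nxe.
(* One [W] that pairs nontrivially with the Casimir gradients reduces their independence to the
   nonvanishing of one scalar function of [lam]. *)
have [W Wxe] : exists W, \det (gradC C xe *m W^T) != 0.
  apply: contrapT => nW; apply: wxe; apply/funext => W; apply/eqP/negPn/negP => h.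
  by apply: nW; exists W.
have uQ : hess (Flam C H lame) xe \in unitmx by rewrite unitmxE unitfE.
have [rho [L [xb [rho0 L0 xbe branchP]]]] := continuous_branch oOm sC sH Omxe gxe uQ.
have lr (r : R) : 0 < r -> `|lame - lame| < r by rewrite subrr normr0.
have He : branch_hess C H xb lame = hess (Flam C H lame) xe.
  by have := branch_hessE oOm sC sH branchP (lr rho rho0); rewrite xbe => ->.
(* A first shrinking keeps the Hessian invertible; the class is then instantiated anew with the
   radius [r], since inverses belong to it only where the denominator has no zero in the ball. *)
have [|r r0 [rrho rP]] := branch_fun_neq0 rho0 L0 branchP
    (closed_det (@branch_cst _ _ Om lame rho xb) (@branch_add _ _ _ _ _ _) (@branch_mul _ _ _ _ _ _)
      (@branch_hess_fun _ _ _ _ _ sC sH lame rho xb)).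
  by rewrite /= He.
have bP lam : `|lam - lame| < r -> [/\ Om (xb lam), grad (Flam C H lam) (xb lam) = 0 &
    forall mu, `|mu - lame| < r -> `|xb lam - xb mu| <= L * `|lam - mu|].
  move=> lamr; have [h1 h2 h3] := branchP lam (lt_le_trans lamr rrho).
  by split=> // mu mur; apply: h3; exact: lt_le_trans rrho.
have uH lam : `|lam - lame| < r -> branch_hess C H xb lam \in unitmx.
  by move=> /rP; rewrite unitmxE unitfE.
pose bf := @branch_fun R m Om lame r xb.
have bcst : forall c, bf (fun=> c) by exact: branch_cst.
have badd : forall f g, bf f -> bf g -> bf (fun lam => f lam + g lam) by exact: branch_add.
have bmul : forall f g, bf f -> bf g -> bf (fun lam => f lam * g lam) by exact: branch_mul.
have bG i j : bf (fun lam => gradC C (xb lam) i j) by exact: branch_gradC_fun.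
have bGT i j : bf (fun lam => (gradC C (xb lam))^T i j).
  by under eq_fun do rewrite mxE.
have bnu : bf (fun lam => nu (xb lam)) by exact: branch_comp.
have bW : bf (fun lam => \det (gradC C (xb lam) *m W^T)).
  by apply: (closed_det bcst badd bmul); exact: (closed_mulmx bcst badd bmul).
have bH i j : bf (fun lam => branch_hess C H xb lam i j) by exact: branch_hess_fun.
have bI i j : bf (fun lam => branch_inv_hess C H xb lam i j) by exact: branch_inv_hess_fun.
have bIX : bf (fun lam => sg * (nu (xb lam) * nu (xb lam) * \det (branch_hess C H xb lam) *
    \det ((branch_inv_hess C H xb lam *m (gradC C (xb lam))^T)^T *m (gradC C (xb lam))^T))).
  apply: (bmul _ _); first exact: bcst.
  apply: (bmul _ _); first by apply: (bmul _ _); [exact: bmul|exact: (closed_det bcst badd bmul)].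
  apply: (closed_det bcst badd bmul); apply: (closed_mulmx bcst badd bmul) => // i j.
  by under eq_fun do rewrite mxE; exact: (closed_mulmx bcst badd bmul).
have IXE lam : `|lam - lame| < r -> IX C H nu lam (xb lam) =
    nu (xb lam) * nu (xb lam) * \det (branch_hess C H xb lam) *
    \det ((branch_inv_hess C H xb lam *m (gradC C (xb lam))^T)^T *m (gradC C (xb lam))^T).
  move=> lamr; rewrite /IX (branch_hessE oOm sC sH bP lamr).
  by rewrite (branch_inv_hessE uH lamr) expr2.
have [|r1 r10 [r1r r1P]] := branch_fun_neq0 r0 L0 bP bnu; first by rewrite xbe.
have [|r2 r20 [r2r r2P]] := branch_fun_neq0 r0 L0 bP bW; first by rewrite xbe.
have [|r3 r30 [r3r r3P]] := branch_fun_pos r0 L0 bP bIX.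
  by have := IXE lame (lr r r0); rewrite xbe => E; rewrite -E.
exists (Num.min r1 (Num.min r2 r3)), xb; split.
- by rewrite !lt_min r10 r20.
- exact: xbe.
- move=> j s lam; rewrite /= !lt_min => /andP[lr1 _].
  apply: (branch_fun_smooth oOm sC sH L0 bP uH (branch_coord _ _ _ _ j)).
  exact: lt_le_trans r1r.
move=> lam; rewrite !lt_min => /and3P[l1 l2 l3].
have lamr : `|lam - lame| < r by exact: lt_le_trans r1r.
have [Omx gx _] := bP lam lamr.
have hx : \det (hess (Flam C H lam) (xb lam)) != 0.
  by rewrite (branch_hessE oOm sC sH bP lamr); exact: rP.
split.
- exact: Omx.
- exact: gx.
- exact: (critical_regular_equilibrium Omx (r1P _ l1) (r2P _ l2) gx hx).
- exact: wedge_neq0_row_free (r2P _ l2).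
by rewrite (IXE lam lamr); exact: r3P.
Qed.

End Assembly.

Theorem theorem5p9 (R : realType) (m : nat) (Om : set 'rV[R]_(m + 2))
  (C : 'I_m -> 'rV[R]_(m + 2) -> R) (H nu : 'rV[R]_(m + 2) -> R)
  (xe : 'rV[R]_(m + 2)) (lame : 'rV[R]_m) :
  open Om ->
  (forall k, smooth_on Om (C k)) -> smooth_on Om H -> smooth_on Om nu ->
  nondeg_regular_equilibrium C H nu Om xe ->
  grad (Flam C H lame) xe = 0 ->
  \det (hess (Flam C H lame) xe) != 0 ->
  (IX C H nu lame xe < 0 ->
     exists (V : set 'rV[R]_m) (U : set 'rV[R]_(m + 2)) (xb : 'rV[R]_m -> 'rV[R]_(m + 2)),
       [/\ open V /\ V lame, open U /\ U xe, U `<=` Om,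
           smooth_on_vec V xb /\ xb lame = xe &
           forall lam, V lam ->
             [/\ U (xb lam), nondeg_regular_equilibrium C H nu Om (xb lam)
               & unstable C H nu Om (xb lam)]]) /\
  (0 < IX C H nu lame xe ->
     exists (V : set 'rV[R]_m) (U : set 'rV[R]_(m + 2)) (xb : 'rV[R]_m -> 'rV[R]_(m + 2)),
       [/\ open V /\ V lame, open U /\ U xe, U `<=` Om,
           smooth_on_vec V xb /\ xb lame = xe &
           forall lam, V lam ->
             [/\ U (xb lam), nondeg_regular_equilibrium C H nu Om (xb lam)
               & lyapunov_stable C H nu Om (xb lam)]]).
Proof.
move=> oOm sC sH snu nxe gxe hxe.
have Omxe : Om xe by case: nxe => -[].
have openV r : open [set lam : 'rV[R]_m | `|lam - lame| < r].
  rewrite (_ : [set _ | _] = ball lame r); first exact: ball_open.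
  by apply/seteqP; split=> lam; rewrite -ball_normE /= distrC.
(* A nonzero [IX] contains the factor [\det Hess], so the Hessian is invertible; the positive factor
   [nu x ^+ 2] does not affect the sign. *)
have unitQ x lam : Om x -> nu x != 0 -> IX C H nu lam x != 0 ->
    [/\ hess (Flam C H lam) x \in unitmx, nu x ^+ 2 > 0 & IX C H nu lam x = nu x ^+ 2 *
     (\det (hess (Flam C H lam) x) *
      \det (gradC C x *m invmx (hess (Flam C H lam) x) *m (gradC C x)^T))].
  move=> Omx nx; rewrite /IX det_IX_form; last exact: (hess_Flam_sym oOm sC sH lam Omx).
  move=> I0; split; last by rewrite mulrA.
    by rewrite unitmxE unitfE; apply: contraNneq I0 => ->; rewrite mulr0 mul0r.
  by rewrite exprn_even_gt0.
split=> Isg.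
  have [|r [xb [r0 xbe sxb xbP]]] := equilibrium_branch oOm sC sH snu nxe gxe hxe (sg := -1).
    by rewrite mulN1r oppr_gt0.
  (* [U] can be all of [Om], an open neighbourhood of [xe] that contains the branch. *)
  exists [set lam | `|lam - lame| < r], Om, xb; split.
  - by split; [exact: openV|rewrite /= subrr normr0].
  - by split.
  - exact: subset_refl.
  - by split.
  move=> lam lr; have [Omx gx rx fG] := xbP lam lr; rewrite mulN1r oppr_gt0 => Ix.
  have nx : nu (xb lam) != 0 by case: rx => -[].
  have [uQ n2 IE] := unitQ _ lam Omx nx (ltr0_neq0 Ix).
  split; [exact: Omx|exact: rx|]; apply: (indefinite_unstable oOm sC sH snu Omx gx uQ fG nx).
  by rewrite -(pmulr_rlt0 _ n2) -IE.
have [|r [xb [r0 xbe sxb xbP]]] := equilibrium_branch oOm sC sH snu nxe gxe hxe (sg := 1).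
  by rewrite mul1r.
exists [set lam | `|lam - lame| < r], Om, xb; split.
- by split; [exact: openV|rewrite /= subrr normr0].
- by split.
- exact: subset_refl.
- by split.
move=> lam lr; have [Omx gx rx fG] := xbP lam lr; rewrite mul1r => Ix.
have nx : nu (xb lam) != 0 by case: rx => -[].
have [uQ n2 IE] := unitQ _ lam Omx nx (lt0r_neq0 Ix).
split; [exact: Omx|exact: rx|]; apply: (definite_stable oOm sC sH snu Omx gx uQ fG).
by rewrite -(pmulr_rgt0 _ n2) -IE.
Qed.
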